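(* Let $p$ be a probability density on $\mathbb{R}^d$ whose potential $U=-\log p$ is differentiable with Lipschitz-continuous and dissipative gradient. Then for any $\overline\tau\in(0,1)$ the dilation path $(p_\tau)_{\tau\in[0,\overline\tau]}$, $$p_\tau(x)=\frac{1}{(1-\tau)^{d/2}}\,p\!\left(\frac{x}{\sqrt{1-\tau}}\right),$$ satisfies the Path Assumption stated in the context on the index set $I=[0,\overline\tau]$.
   Context: A vector field $v:\mathbb{R}^d\to\mathbb{R}^d$ is dissipative with constants $a,b,R>0$ if $\langle x,v(x)\rangle\ge a|x|^2-b\,\mathbf{1}_{B_R(0)}(x)$ for all $x\in\mathbb{R}^d$, where $B_R(0)$ is the open ball of radius $R$ around $0$; it is dissipative if such constants exist. A probability measure $\nu$ satisfies the log-Sobolev inequality (LSI) if there is $C>0$ such that $\int f^2\log\big(f^2/\overline{f^2}\big)\,\mathrm{d}\nu\le C\int|\nabla f|^2\,\mathrm{d}\nu$ for all $f\in C_c^\infty(\mathbb{R}^d)$, where $\overline{f^2}=\int f^2\,\mathrm{d}\nu$; the smallest such $C$ is the log-Sobolev constant of $\nu$. Path Assumption on an interval $I\subset[0,\infty)$ containing $0$, for probability densities $(p_\tau)_{\tau\in I}$ with $U_\tau:=-\log p_\tau$ and $\pi_\tau(\mathrm{d}x)=p_\tau(x)\,\mathrm{d}x$: (1) $\tau\mapsto U_\tau(x)$ is differentiable and there is $c>0$ with $|\partial_\tau U_\tau(x)|\le c(|x|^2+1)$ for all $x\in\mathbb{R}^d$, $\tau\in I$. (2) $U_\tau$ is differentiable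 and $\nabla U_\tau$ is $L_\tau$-Lipschitz. (3) For every $\tau\in I$, $\tau>0$, $\nabla U_\tau$ is dissipative with constants $a_\tau,b_\tau,R_\tau>0$. (4) Over $\tau\in I$, $\tau>0$: $\sup L_\tau<\infty$, $\inf a_\tau>0$, $\sup b_\tau<\infty$, $\sup R_\tau<\infty$. (5) Each $\pi_\tau$ satisfies the LSI with constant $C_{\mathrm{LSI}}(\tau)$, and $\sup_{\tau\in I}C_{\mathrm{LSI}}(\tau)<\infty$. *)

(* Defs.v *)
From HB Require Import structures.
From mathcomp Require Import all_boot all_order all_algebra.
From mathcomp Require Import all_classical all_reals all_analysis.
From mathcomp Require Import measurable_realfun.

Set Implicit Arguments.
Unset Strict Implicit.
Unset Printing Implicit Defensive.
Import Order.TTheory GRing.Theory Num.Theory.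
Import numFieldNormedType.Exports.

Local Open Scope classical_set_scope.
Local Open Scope ring_scope.

Definition rV_display : measure_display.
Proof. exact: default_measure_display. Qed.

(* 'rV[R]_n carries the product sigma-algebra, generated by the n coordinate
   functions; it is the Borel sigma-algebra of R^n. *)
Section measurable_rV.
Context {R : realType} (n : nat).

Let coors : 'I_n -> 'rV[R]_n -> measurableTypeR R := fun i v => v ord0 i.

Let rV_set0 : g_sigma_preimage coors set0.
Proof. exact: sigma_algebra0. Qed.

Let rV_setC A : g_sigma_preimage coors A -> g_sigma_preimage coors (~` A).
Proof. exact: sigma_algebraC. Qed.

Let rV_bigcup (F : (set 'rV[R]_n)^nat) : (forall i, g_sigma_preimage coors (F i)) ->
  g_sigma_preimage coors (\bigcup_i (F i)).
Proof. exact: sigma_algebra_bigcup. Qed.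

HB.instance Definition _ :=
  @isMeasurable.Build rV_display 'rV[R]_n
    (g_sigma_preimage coors) rV_set0 rV_setC rV_bigcup.

End measurable_rV.

Section measurable_rV_theory.
Context {R : realType}.

Lemma measurable_coord n (i : 'I_n) :
  measurable_fun [set: 'rV[R]_n] (fun v : 'rV[R]_n => v ord0 i).
Proof.
move=> _ Y mY; rewrite setTI; apply: sub_sigma_algebra => /=.
rewrite -bigcup_seq/=; exists i => /=; first by rewrite mem_index_enum.
by exists Y => //; rewrite setTI.
Qed.

Lemma measurable_fun_rVP d (T : measurableType d) n (f : T -> 'rV[R]_n) :
  (forall i, measurable_fun [set: T] (fun t => f t ord0 i)) ->
  measurable_fun [set: T] f.
Proof.
move=> mf _ A mA; rewrite setTI.
pose G := image_set_system [set: T] f (@measurable _ T).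
suff : G A by rewrite /G /image_set_system /= setTI.
apply: mA; split => [|B].
  by apply: sigma_algebra_image; exact: sigma_algebra_measurable.
rewrite -bigcup_seq => -[i /= _ [C mC <-]].
rewrite /G /image_set_system /= !setTI.
by have := mf i measurableT C mC; rewrite setTI.
Qed.

Definition rV_cons n (x : R * 'rV[R]_n) : 'rV[R]_n.+1 :=
  row_mx (x.1%:M : 'rV_1) x.2.

Lemma rV_cons0 n (x : R * 'rV[R]_n) : rV_cons x ord0 ord0 = x.1.
Proof.
rewrite /rV_cons (_ : ord0 = lshift n (ord0 : 'I_1)); last exact/val_inj.
by rewrite (@row_mxEl _ 1 1 n) mxE eqxx mulr1n.
Qed.

Lemma rV_consS n (x : R * 'rV[R]_n) (i : 'I_n) :
  rV_cons x ord0 (lift ord0 i) = x.2 ord0 i.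
Proof.
rewrite /rV_cons (_ : lift ord0 i = rshift 1 i); last exact/val_inj.
by rewrite (@row_mxEr _ 1 1 n).
Qed.

Lemma measurable_rV_cons n : measurable_fun setT (@rV_cons n).
Proof.
apply: measurable_fun_rVP => i; have [j ->|->] := unliftP ord0 i.
  under eq_fun do rewrite rV_consS.
  exact: measurableT_comp (measurable_coord j) measurable_snd.
by under eq_fun do rewrite rV_cons0; exact: measurable_fst.
Qed.

Lemma measurable_rV_box n (A : 'I_n -> set R) :
  (forall i, measurable (A i)) ->
  measurable [set v : 'rV[R]_n | forall i, A i (v ord0 i)].
Proof.
move=> mA; rewrite (_ : mkset _ =
    \bigcap_(i in [set: 'I_n]) ((fun v : 'rV[R]_n => v ord0 i) @^-1` A i)).
  apply: fin_bigcap_measurable => // i _.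
  by rewrite -[X in measurable X]setTI; exact: measurable_coord.
by apply/seteqP; split => [v Av i _|v Av i]; exact: Av.
Qed.

Lemma rV_cons_box n (A : 'I_n.+1 -> set R) :
  @rV_cons n @^-1` [set v | forall i, A i (v ord0 i)] =
  A ord0 `*` [set v : 'rV[R]_n | forall i, A (lift ord0 i) (v ord0 i)].
Proof.
apply/seteqP; split => [x Ax|x [A0 Ax] i /=].
  split => /= [|i]; first by have := Ax ord0; rewrite rV_cons0.
  by have := Ax (lift ord0 i); rewrite rV_consS.
by have [j ->|->] := unliftP ord0 i; rewrite ?rV_consS ?rV_cons0.
Qed.

End measurable_rV_theory.


Section lebesgue_rV.
Context {R : realType}.
Local Open Scope ereal_scope.

Section step.
Context (n : nat) (mu : {sigma_finite_measure set 'rV[R]_n -> \bar R}).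

Definition lebesgue_rV_step : set 'rV[R]_n.+1 -> \bar R :=
  pushforward (lebesgue_measure \x mu) (@rV_cons R n).

Let step0 : lebesgue_rV_step set0 = 0.
Proof. by rewrite /lebesgue_rV_step /pushforward preimage_set0 measure0. Qed.

Let step_ge0 A : 0 <= lebesgue_rV_step A.
Proof. by apply: integral_ge0 => x _; exact: measure_ge0. Qed.

Let step_sigma_additive : semi_sigma_additive lebesgue_rV_step.
Proof.
have mc := @measurable_rV_cons R n.
move=> F mF tF mUF; rewrite /lebesgue_rV_step /pushforward preimage_bigcup.
apply: measure_semi_sigma_additive.
- by move=> k; rewrite -[X in measurable X]setTI; exact: mc.
- apply/trivIsetP => /= i j _ _ ij; rewrite -preimage_setI.
  by move/trivIsetP : tF => /(_ _ _ _ _ ij) ->//; rewrite preimage_set0.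
- by rewrite -preimage_bigcup -[X in measurable X]setTI; exact: mc.
Qed.

HB.instance Definition _ := isMeasure.Build _ _ _ lebesgue_rV_step
  step0 step_ge0 step_sigma_additive.

Let step_sigma_finite : sigma_finite setT lebesgue_rV_step.
Proof.
pose u (v : 'rV[R]_n.+1) : R * 'rV[R]_n :=
  (v ord0 ord0, \row_i v ord0 (lift ord0 i)).
have mu' : measurable_fun setT u.
  apply/measurable_fun_pairP; split; first exact: measurable_coord.
  apply: measurable_fun_rVP => i; under eq_fun do rewrite mxE.
  exact: measurable_coord.
have cK x : u (rV_cons x) = x.
  case: x => a v; rewrite /u rV_cons0; congr pair.
  by apply/rowP => i; rewrite mxE rV_consS.
have [F FT Foo] : sigma_finite setT (@lebesgue_measure R \x mu).
  have /sigma_finiteP[F [TF ndF Foo]] := sigma_finiteT (@lebesgue_measure R).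
  have /sigma_finiteP[G [TG ndG Goo]] := sigma_finiteT mu.
  exists (fun k => F k `*` G k).
    rewrite -setXTT TF TG predeqE => -[x y]; split.
      move=> [/= [k _ Fkx] [l _ Gly]]; exists (maxn k l) => //; split.
      - by move: x Fkx; exact/subsetPset/ndF/leq_maxl.
      - by move: y Gly; exact/subsetPset/ndG/leq_maxr.
    by move=> [k _ []/= ? ?]; split; exists k.
  move=> k; have [? ?] := Foo k; have [? ?] := Goo k.
  split; first exact: measurableX.
  by rewrite product_measure1E// lte_mul_pinfty// ge0_fin_numE.
exists (fun k => u @^-1` F k); first by rewrite -preimage_bigcup -FT preimage_setT.
move=> k; have [mF Fk] := Foo k; split.
  by rewrite -[X in measurable X]setTI; exact: mu'.
rewrite /lebesgue_rV_step /pushforward (_ : _ @^-1` _ = F k)//.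
by apply/seteqP; split => x /=; rewrite cK.
Qed.

HB.instance Definition _ := Measure_isSigmaFinite.Build _ _ _ lebesgue_rV_step
  step_sigma_finite.

End step.

(* The n-fold product of the Lebesgue measure of R; it is determined by its
   values on boxes, see lebesgue_rV_box. *)
Fixpoint lebesgue_rV (n : nat) : {sigma_finite_measure set 'rV[R]_n -> \bar R} :=
  match n with
  | 0%N => dirac (0%R : 'rV[R]_0)
  | k.+1 => lebesgue_rV_step (lebesgue_rV k)
  end.

Lemma lebesgue_rV_box n (A : 'I_n -> set R) : (forall i, measurable (A i)) ->
  lebesgue_rV n [set v | forall i, A i (v ord0 i)] =
  \prod_(i < n) lebesgue_measure (A i).
Proof.
elim: n A => [A _|n IHn A mA].
  rewrite big_ord0 /= diracE mem_set//; by case.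
rewrite big_ord_recl -IHn// /= /lebesgue_rV_step /pushforward rV_cons_box.
apply: product_measure1E; first exact: mA.
exact: (@measurable_rV_box R n (fun i => A (lift ord0 i))).
Qed.

End lebesgue_rV.

Section euclidean.
Context {R : realType} {d : nat}.
Implicit Types (x y : 'rV[R]_d) (v : 'rV[R]_d -> 'rV[R]_d).

Definition dotr x y : R := \sum_(i < d) x ord0 i * y ord0 i.

(* The norm `|x| of the library on 'rV[R]_d is the sup norm: every metric
   statement below uses enorm. *)
Definition enorm x : R := Num.sqrt (dotr x x).

Definition grad (f : 'rV[R]_d -> R) x : 'rV[R]_d :=
  \row_i 'D_(delta_mx ord0 i) f x.

Definition lipschitz_with (L : R) v :=
  forall x y, enorm (v x - v y) <= L * enorm (x - y).

Definition dissipative_with (a b r : R) v :=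
  forall x, a * enorm x ^+ 2 - b * \1_[set y | enorm y < r] x <= dotr x (v x).

Definition dissipative v := exists a b r : R,
  [/\ 0 < a, 0 < b, 0 < r & dissipative_with a b r v].

(* partials [:: i1; ...; ik] f is the iterated partial derivative of f along
   the coordinates i1, ..., ik. *)
Definition partials (s : seq 'I_d) (f : 'rV[R]_d -> R) : 'rV[R]_d -> R :=
  foldr (fun i g x => 'D_(delta_mx ord0 i) g x) f s.

(* C^oo: partial derivatives of all orders exist and are differentiable (hence
   continuous). *)
Definition smooth (f : 'rV[R]_d -> R) :=
  forall s x, differentiable (partials s f) x.

Definition test_function (f : 'rV[R]_d -> R) :=
  smooth f /\ compact (closure [set x | f x != 0]).

End euclidean.

Section density.
Context {R : realType} {d : nat}.
Local Open Scope ereal_scope.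

Definition prob_density (p : 'rV[R]_d -> R) :=
  [/\ measurable_fun setT p, (forall x, (0 <= p x)%R) &
      \int[lebesgue_rV d]_x (p x)%:E = 1].

Definition density_prob (p : 'rV[R]_d -> R) (hp : prob_density p) :
    set 'rV[R]_d -> \bar R :=
  fun A => \int[lebesgue_rV d]_(x in A) (p x)%:E.

Context (p : 'rV[R]_d -> R) (hp : prob_density p).

Let dens0 : density_prob hp set0 = 0.
Proof. by rewrite /density_prob integral_set0. Qed.

Let dens_ge0 A : 0 <= density_prob hp A.
Proof. by apply: integral_ge0 => x _; case: hp => _ p0 _; rewrite lee_fin. Qed.

Let dens_sigma_additive : semi_sigma_additive (density_prob hp).
Proof.
have [mp p0 p1] := hp; move=> A mA tA mUA.
rewrite /density_prob integral_bigcup//=; last first.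
  apply: (integrableS _ _ (subsetT _)) => //; apply/integrableP; split.
    exact/measurable_EFinP.
  under eq_integral do rewrite /= ger0_norm//.
  by rewrite p1 ltry.
apply: is_cvg_ereal_nneg_natsum_cond => n _ _.
by apply: integral_ge0 => /= x ?; rewrite lee_fin.
Qed.

HB.instance Definition _ := isMeasure.Build _ _ _ (density_prob hp)
  dens0 dens_ge0 dens_sigma_additive.

Let dens_setT : density_prob hp setT = 1.
Proof. by have [_ _] := hp. Qed.

HB.instance Definition _ :=
  @Measure_isProbability.Build _ _ R (density_prob hp) dens_setT.

End density.

Section log_sobolev.
Context {R : realType} {d : nat}.
Implicit Types (nu : probability 'rV[R]_d R) (f : 'rV[R]_d -> R).

(* For a test function both integrands are bounded, so that the real-valued
   integrals below are genuine; since ln 0 = 0 and x / 0 = 0, the integrand of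
   entropy vanishes where f does. *)
Definition entropy nu f : R :=
  \int[nu]_x (f x ^+ 2 * ln (f x ^+ 2 / \int[nu]_y (f y ^+ 2))).

Definition lsi_with nu (C : R) := forall f, test_function f ->
  entropy nu f <= C * \int[nu]_x (enorm (grad f x) ^+ 2).

Definition lsi nu := exists2 C : R, 0 < C & lsi_with nu C.

(* The infimum is attained whenever nu satisfies the inequality (see
   lsi_const_lsi): it is then the smallest constant. *)
Definition lsi_const nu : R := inf [set C : R | 0 < C /\ lsi_with nu C].

Lemma lsi_const_lsi nu : lsi nu -> lsi_with nu (lsi_const nu).
Proof.
move=> [C C0 nuC] f tf; set D := (X in _ * X).
have D0 : 0 <= D by apply: Rintegral_ge0 => x _; rewrite sqr_ge0.
move: D0; rewrite le_eqVlt => /predU1P[D0|D0].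
  by have := nuC f tf; rewrite -/D -D0 !mulr0.
rewrite -ler_pdivrMr//; apply: lb_le_inf; first by exists C.
by move=> B [B0 nuB]; rewrite ler_pdivrMr//; exact: nuB.
Qed.

End log_sobolev.

Section path.
Context {R : realType} {d : nat}.
Implicit Types (I : set R) (p : R -> 'rV[R]_d -> R).

(* Derivative relative to I, hence one-sided at an endpoint of I. *)
Definition diff_quotient_in I (f : R -> R) (t : R) : set_system R :=
  h^-1 * (f (t + h) - f t) @[h --> within [set h | I (t + h)] 0^'].

Definition derivable_in I f t := cvg (diff_quotient_in I f t).

Definition derive_in I f t : R := lim (diff_quotient_in I f t).

Definition potential (q : 'rV[R]_d -> R) (x : 'rV[R]_d) : R := - ln (q x).

(* Positivity of the densities makes the potentials real-valued (ln is 0 on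
   nonpositive numbers). *)
Definition path_assumption I p :=
  let U t := potential (p t) in
  let J := I `&` [set t | 0 < t] in
  [/\ is_interval I, I `<=` [set t | 0 <= t] & I 0] /\
  (forall t x, I t -> 0 < p t x) /\
  exists dens : forall t, I t -> prob_density (p t),
  exists L a b r C : R -> R,
  [/\
    (forall x t, I t -> derivable_in I (U ^~ x) t) /\
    (exists2 c, 0 < c & forall x t, I t ->
      `|derive_in I (U ^~ x) t| <= c * (enorm x ^+ 2 + 1)),
    forall t, I t ->
      (forall x, differentiable (U t) x) /\ lipschitz_with (L t) (grad (U t)),
    forall t, J t -> [/\ 0 < a t, 0 < b t, 0 < r t &
      dissipative_with (a t) (b t) (r t) (grad (U t))],
    [/\ (ereal_sup [set (L t)%:E | t in J] < +oo)%E,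
        (0 < ereal_inf [set (a t)%:E | t in J])%E,
        (ereal_sup [set (b t)%:E | t in J] < +oo)%E &
        (ereal_sup [set (r t)%:E | t in J] < +oo)%E] &
    (forall t (It : I t),
      lsi (density_prob (dens t It)) /\
      C t = lsi_const (density_prob (dens t It))) /\
    (ereal_sup [set (C t)%:E | t in I] < +oo)%E].

Definition dilation (q : 'rV[R]_d -> R) (t : R) (x : 'rV[R]_d) : R :=
  ((1 - t) `^ (d%:R / 2))^-1 * q ((Num.sqrt (1 - t))^-1 *: x).

End path.

(* Main.v *)
Require Import Defs.
From HB Require Import structures.
From mathcomp Require Import all_boot all_order all_algebra.
From mathcomp Require Import all_classical all_reals all_analysis.
From mathcomp Require Import measurable_realfun ring lra.

(* Each density of the path is exp(-V) for a potential V = U_tau that is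
   "tame": |grad V|^2 and |V| are bounded by K(1 + |x|^2) and
   <x, grad V> >= a|x|^2 - b, with K, a and b not depending on tau.  It thus
   suffices to prove a log-Sobolev inequality whose constant depends only on d,
   K, a and b.  Integrating div(x f^2 exp(-V)) by parts over cubes, where the
   boundary terms have a favourable sign, bounds the second moment of
   f^2 exp(-V); together with a Poincare inequality on a cube this gives a global
   one.  For int f^2 exp(-V) = 1 the entropy is at most a constant times the
   integral of s^2 + s^2 ln^+(4 s^2) against exp(-V), with s = f - 1 or
   s = f + 1; the logarithm is controlled by the Euclidean log-Sobolev
   inequality for s exp(-V/2), the growth of V and the moment bound, and
   int s^2 exp(-V) by the Poincare inequality. *)

Set Implicit Arguments.
Unset Strict Implicit.
Unset Printing Implicit Defensive.
Import Order.TTheory GRing.Theory Num.Theory.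
Import numFieldNormedType.Exports.

Local Open Scope classical_set_scope.
Local Open Scope ring_scope.

(** * The Borel structure of R^d and Tonelli on cubes *)

(** The obstacle is that the potentials are only C^1 with Lipschitz gradient and need not be convex,
    even far out: no curvature criterion applies, and no second derivative may be taken. What is
    available is that [ln p] grows at most quadratically, while dissipativity controls exactly a
    second moment weighted by f^2; the two match. The shift to f - 1 or f + 1 has this reason: t^2
    ln t^2 - t^2 + 1 vanishes to second order at t = 1 and t = -1, so near these values the entropy
    is a quadratic quantity, which a Poincare inequality bounds. The sign is that of the constant c
    in the Poincare inequality, since int f^2 exp(-V) = 1 forces |c| to be close to 1 when f is
    close to c. No defective inequality has to be tightened afterwards. Almost all integrals are
    extended-real integrals of nonnegative functions. Signed integrands are split into positive and
    negative parts placed on opposite sides, and quantities are cancelled only where they are known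
    to be finite: on cubes, or after a bound by a finite number. *)

Section topology_rV.
Context {R : realType}.

Lemma cvg_rV T (F : set_system T) {FF : Filter F} n (f : T -> 'rV[R]_n) (M : 'rV[R]_n) :
  (forall i, f t ord0 i @[t --> F] --> M ord0 i) -> f @ F --> M.
Proof.
move=> h A [P MP PA].
have : \forall t \near F, forall i, P ord0 i (f t ord0 i).
  by apply: filter_forall => i; exact: (h i _ (MP ord0 i)).
apply: filterS => t Pt; apply: PA => i j.
by rewrite (ord1 i); exact: Pt.
Qed.

(** The sigma-algebra is generated by the coordinates, so openness must be reduced to boxes: an open
    set is the union of the rational boxes that it contains, and these are countably many. A box
    that is not contained in [O] contributes the empty set to the union. *)
Lemma open_rV_measurable n (O : set 'rV[R]_n) : open O -> measurable O.
Proof.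
move=> oO.
pose B (q : {ffun 'I_n -> rat * rat}) : set 'rV[R]_n :=
  [set v | forall i, `]ratr (q i).1, ratr (q i).2[%classic (v ord0 i)].
rewrite (_ : O = \bigcup_q (if pselect (B q `<=` O) then B q else set0)); last first.
  apply/seteqP; split => [x Ox|x [q _]]; last by case: pselect => // BO; exact: BO.
  have [P xP PO] : nbhs x O by exact: open_nbhs_nbhs.
  have h i : exists q : rat * rat,
      ratr q.1 < x ord0 i < ratr q.2 /\ `]ratr q.1, ratr q.2[%classic `<=` P ord0 i.
    have /nbhs_ballP[e /= e0 eP] := xP ord0 i.
    have /rat_in_itvoo[a] : x ord0 i - e < x ord0 i by lra.
    rewrite in_itv/= => /andP[xa ax].
    have /rat_in_itvoo[b] : x ord0 i < x ord0 i + e by lra.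
    rewrite in_itv/= => /andP[xb bx].
    exists (a, b) => /=; split; first by rewrite ax/= xb.
    move=> y /=; rewrite in_itv/= => /andP[ay yb]; apply: eP.
    rewrite /ball/= ltr_norml; apply/andP; split; lra.
  have [q /all_and2[qx qP]] := choice h.
  have BO : B (finfun q) `<=` O.
    move=> v Bv; apply: PO => i j; rewrite (ord1 i); apply: qP.
    by have := Bv j; rewrite ffunE.
  exists (finfun q) => //; case: pselect => // _ i /=.
  by rewrite in_itv/= ffunE; exact: qx.
apply: countable_bigcupT_measurable => [|q]; first exact: countableP.
case: (pselect (B q `<=` O)) => BO /=; last exact: measurable0.
apply: (@measurable_rV_box R n (fun i => `]ratr (q i).1, ratr (q i).2[%classic)) => i.
exact: measurable_itv.
Qed.

Lemma continuous_rV_measurable n (f : 'rV[R]_n -> R) :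
  continuous f -> measurable_fun setT f.
Proof.
move=> /continuousP cf; apply: (measurability _ (RGenOpens.measurableE R)).
move=> _ [_ [a [b ->] <-]]; rewrite setTI; apply: open_rV_measurable.
exact/cf/interval_open.
Qed.

Lemma rV_consE n (t : R) (x : 'rV[R]_n) :
  rV_cons (t, x) = t *: delta_mx ord0 ord0 + rV_cons (0, x).
Proof.
apply/rowP => i; rewrite [RHS]mxE [X in X + _]mxE [X in _ * X]mxE.
have [j ->|->] := unliftP ord0 i.
  by rewrite !rV_consS/= mulr0 add0r.
by rewrite !rV_cons0 eqxx mulr1 addr0.
Qed.

Lemma rV_consD n (s t : R) (x y : 'rV[R]_n) :
  rV_cons (s + t, x + y) = rV_cons (s, x) + rV_cons (t, y).
Proof.
by apply/rowP => i; rewrite [RHS]mxE; have [j ->|->] := unliftP ord0 i;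
  rewrite ?rV_consS ?rV_cons0//= mxE.
Qed.

Lemma rV_consZ n (c t : R) (x : 'rV[R]_n) :
  rV_cons (c * t, c *: x) = c *: rV_cons (t, x).
Proof.
by apply/rowP => i; rewrite [RHS]mxE; have [j ->|->] := unliftP ord0 i;
  rewrite ?rV_consS ?rV_cons0//= mxE.
Qed.

Lemma rV_cons_delta n (i : 'I_n) :
  rV_cons (0 : R, delta_mx ord0 i) = delta_mx ord0 (lift ord0 i).
Proof.
apply/rowP => j; rewrite [RHS]mxE; have [k ->|->] := unliftP ord0 j.
  by rewrite rV_consS/= mxE (inj_eq lift_inj).
by rewrite rV_cons0 eqxx/=.
Qed.

Lemma continuous_rV_consl n (x : 'rV[R]_n) : continuous (fun t => rV_cons (t, x)).
Proof.
move=> t; apply: cvg_rV => i; have [j ->|->] := unliftP ord0 i.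
  by under eq_cvg do rewrite rV_consS; rewrite rV_consS; exact: cvg_cst.
by under eq_cvg do rewrite rV_cons0; rewrite rV_cons0; exact: cvg_id.
Qed.

Lemma continuous_rV_consr n (t : R) :
  continuous (fun x : 'rV[R]_n => rV_cons (t, x)).
Proof.
move=> x; apply: (@cvg_rV _ _ (nbhs_filter x)) => i; have [j ->|->] := unliftP ord0 i.
  by under eq_cvg do rewrite rV_consS; rewrite rV_consS; exact: coord_continuous.
by under eq_cvg do rewrite rV_cons0; rewrite rV_cons0; exact: cvg_cst.
Qed.

End topology_rV.

Section cube.
Context {R : realType}.

Definition cube d (M : R) : set 'rV[R]_d :=
  [set x | forall i, `[- M, M]%classic (x ord0 i)].

Lemma measurable_cube d M : measurable (@cube d M).
Proof.
by apply: (@measurable_rV_box R d (fun=> `[- M, M]%classic)) => i; exact: measurable_itv. Qed.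

Lemma compact_cube d M : compact (@cube d M).
Proof. by apply: (@rV_compact R d (fun=> `[- M, M]%classic)) => i; exact: segment_compact. Qed.

Lemma cube_cons d M t (x : 'rV[R]_d) :
  @cube d.+1 M (rV_cons (t, x)) = (`[- M, M]%classic t /\ cube M x).
Proof.
rewrite -[LHS]/((@rV_cons R d @^-1` cube M) (t, x)).
by rewrite (@rV_cons_box R d (fun=> `[- M, M]%classic)).
Qed.

End cube.
Arguments cube {R} d M.

Section tonelli.
Context {R : realType}.
Local Notation mu := (@lebesgue_measure R).
Local Notation leb := (@lebesgue_rV R).
Local Open Scope ereal_scope.

Lemma ge0_integral_rV0 (f : 'rV[R]_0 -> R) :
  \int[leb 0]_x (f x)%:E = (f 0%R)%:E.
Proof.
rewrite /= integral_dirac// ?diracT ?mul1e//.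
move=> _ Y mY; rewrite setTI.
have [h|h] := pselect (Y (f 0%R)%:E).
  rewrite (_ : _ @^-1` Y = setT)//; apply/seteqP; split => // x _ /=.
  by rewrite (_ : x = 0%R)//; apply/rowP => -[].
rewrite (_ : _ @^-1` Y = set0)//; apply/seteqP; split => // x /=.
by rewrite (_ : x = 0%R)//; apply/rowP => -[].
Qed.

Section step.
Context d (f : 'rV[R]_d.+1 -> \bar R).
Hypothesis mf : measurable_fun setT f.
Hypothesis f0 : forall x, 0 <= f x.

Let mfc : measurable_fun setT (f \o @rV_cons R d).
Proof. exact: measurableT_comp mf (@measurable_rV_cons R d). Qed.

Let intE : \int[leb d.+1]_x f x = \int[mu \x leb d]_x (f \o @rV_cons R d) x.
Proof.
rewrite -[LHS]/(\int[pushforward (mu \x leb d) (@rV_cons R d)]_x f x).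
rewrite ge0_integral_pushforward//; exact: measurable_rV_cons.
Qed.

Lemma tonelli_rV : \int[leb d.+1]_x f x = \int[mu]_t \int[leb d]_x f (rV_cons (t, x)).
Proof. by rewrite intE (@fubini_tonelli1 _ _ _ _ _ mu (leb d) _ mfc (fun=> f0 _)). Qed.

Lemma tonelli_rVC : \int[leb d.+1]_x f x = \int[leb d]_x \int[mu]_t f (rV_cons (t, x)).
Proof. by rewrite intE (@fubini_tonelli2 _ _ _ _ _ mu (leb d) _ mfc (fun=> f0 _)). Qed.

Lemma measurable_tonelli_rV :
  measurable_fun setT (fun t => \int[leb d]_x f (rV_cons (t, x))).
Proof. by have := @measurable_fun_fubini_tonelli_F _ _ _ _ _ (leb d) _ mfc (fun=> f0 _). Qed.

Lemma measurable_tonelli_rVC :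
  measurable_fun setT (fun x => \int[mu]_t f (rV_cons (t, x))).
Proof. by have := @measurable_fun_fubini_tonelli_G _ _ _ _ _ mu _ mfc (fun=> f0 _). Qed.

End step.

Section step_cube.
Context d (M : R) (f : 'rV[R]_d.+1 -> \bar R).
Hypothesis mf : measurable_fun setT f.
Hypothesis f0 : forall x, 0 <= f x.

Let mfQ : measurable_fun setT (f \_ (cube d.+1 M)).
Proof.
apply/(measurable_restrictT _ (@measurable_cube R d.+1 M)).
exact: measurable_funTS.
Qed.

Let fQ0 x : 0 <= (f \_ (cube d.+1 M)) x.
Proof. by rewrite erestrict_ge0. Qed.

Let fQE t x : (f \_ (cube d.+1 M)) (rV_cons (t, x)) =
  (if t \in `[(- M)%R, M]%classic then
     if x \in cube d M then f (rV_cons (t, x)) else 0 else 0).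
Proof.
rewrite patchE (_ : (_ \in _) = (t \in `[(- M)%R, M]%classic) && (x \in cube d M)).
  by case: (t \in _); case: (x \in _).
by apply/idP/andP; rewrite !inE cube_cons.
Qed.

Lemma tonelli_cube : \int[leb d.+1]_(x in cube d.+1 M) f x =
  \int[mu]_(t in `[(- M)%R, M]) \int[leb d]_(x in cube d M) f (rV_cons (t, x)).
Proof.
rewrite integral_mkcond (tonelli_rV mfQ fQ0) [RHS]integral_mkcond.
apply: eq_integral => t _; rewrite patchE.
under eq_integral do rewrite fQE.
case: ifPn => _; last by rewrite integral0.
by rewrite [RHS]integral_mkcond; apply: eq_integral => x _; rewrite patchE.
Qed.

Lemma tonelli_cubeC : \int[leb d.+1]_(x in cube d.+1 M) f x =
  \int[leb d]_(x in cube d M) \int[mu]_(t in `[(- M)%R, M]) f (rV_cons (t, x)).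
Proof.
rewrite integral_mkcond (tonelli_rVC mfQ fQ0) [RHS]integral_mkcond.
apply: eq_integral => x _; rewrite patchE.
under eq_integral do rewrite fQE.
case: ifPn => _; last by under eq_integral do rewrite if_same; rewrite integral0.
by rewrite [RHS]integral_mkcond; apply: eq_integral => t _; rewrite patchE.
Qed.

Lemma measurable_tonelli_cube : measurable_fun `[(- M)%R, M]
  (fun t => \int[leb d]_(x in cube d M) f (rV_cons (t, x))).
Proof.
have := measurable_tonelli_rV mfQ fQ0 => h.
apply: (eq_measurable_fun (fun t => \int[leb d]_x (f \_ (cube d.+1 M)) (rV_cons (t, x)))).
  move=> t tM; rewrite [RHS]integral_mkcond; apply: eq_integral => x _.
  by rewrite fQE tM patchE.
exact: measurable_funTS.
Qed.

Lemma measurable_tonelli_cubeC : measurable_fun (cube d M)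
  (fun x => \int[mu]_(t in `[(- M)%R, M]) f (rV_cons (t, x))).
Proof.
have := measurable_tonelli_rVC mfQ fQ0 => h.
apply: (eq_measurable_fun (fun x => \int[mu]_t (f \_ (cube d.+1 M)) (rV_cons (t, x)))).
  move=> x xM; rewrite [RHS]integral_mkcond; apply: eq_integral => t _.
  by rewrite fQE xM patchE.
exact: measurable_funTS.
Qed.

End step_cube.

End tonelli.

(** * One-dimensional calculus *)

Section ge0_integral_EFin.
Context d (T : measurableType d) {R : realType}.
Variables (mu : {measure set T -> \bar R}) (D : set T).
Hypothesis mD : measurable D.
Implicit Types f g : T -> R.

Lemma ge0_le_integral_EFin f g : measurable_fun D f -> measurable_fun D g ->
  (forall x, D x -> 0 <= f x) -> (forall x, D x -> f x <= g x) ->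
  (\int[mu]_(x in D) (f x)%:E <= \int[mu]_(x in D) (g x)%:E)%E.
Proof.
move=> mf mg f0 fg; apply: ge0_le_integral => //.
- exact/measurable_EFinP.
- exact/measurable_EFinP.
Qed.

Lemma ge0_integralD_EFin f g : measurable_fun D f -> measurable_fun D g ->
  (forall x, D x -> 0 <= f x) -> (forall x, D x -> 0 <= g x) ->
  (\int[mu]_(x in D) (f x + g x)%:E =
   \int[mu]_(x in D) (f x)%:E + \int[mu]_(x in D) (g x)%:E)%E.
Proof.
move=> mf mg f0 g0; under eq_integral do rewrite EFinD.
rewrite ge0_integralD//.
- exact/measurable_EFinP.
- exact/measurable_EFinP.
Qed.

Lemma ge0_integralZ_EFin c f : measurable_fun D f ->
  (forall x, D x -> 0 <= f x) -> 0 <= c ->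
  (\int[mu]_(x in D) (c * f x)%:E = c%:E * \int[mu]_(x in D) (f x)%:E)%E.
Proof.
move=> mf f0 c0; under eq_integral do rewrite EFinM.
by rewrite ge0_integralZl_EFin//; exact/measurable_EFinP.
Qed.

(** [f] vanishes almost everywhere. This settles the cases of zero mass, where a logarithm of a
    quotient by the mass carries no information. *)
Lemma ge0_integralM_eq0 f g : measurable_fun D f -> measurable_fun D g ->
  (forall x, D x -> 0 <= f x) -> (forall x, D x -> 0 <= g x) ->
  (\int[mu]_(x in D) (f x)%:E = 0 -> \int[mu]_(x in D) (f x * g x)%:E = 0)%E.
Proof.
move=> mf mg f0 g0 If.
have mfE : measurable_fun D (EFin \o f) by exact/measurable_EFinP.
have mfgE : measurable_fun D (EFin \o (fun x => f x * g x)).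
  by apply/measurable_EFinP; exact: measurable_funM.
have f_eq0 : ae_eq mu D (EFin \o f) (cst 0%E).
  apply/(ae_eq_integral_abs mu mD mfE); rewrite -If.
  by apply: eq_integral => x; rewrite inE => Dx; rewrite gee0_abs// lee_fin f0.
transitivity (\int[mu]_(x in D) `|(f x * g x)%:E|)%E.
  apply: eq_integral => x; rewrite inE => Dx.
  by rewrite gee0_abs// lee_fin mulr_ge0 ?f0 ?g0.
apply/(ae_eq_integral_abs mu mD mfgE).
move: f_eq0; apply: filterS => x h Dx; have /= [->] := h Dx.
by rewrite mul0r.
Qed.

End ge0_integral_EFin.

Lemma continuous_max0 {R : realType} (T : topologicalType) (f : T -> R) :
  continuous f -> continuous (fun x => Num.max 0 (f x)).
Proof.
move=> cf x; have c0 : {for x, continuous (fun=> 0 : R^o)} by exact: cvg_cst.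
exact: (continuous_max c0 (cf x)).
Qed.

Section one_dimensional.
Context {R : realType}.
Local Notation mu := (@lebesgue_measure R).
Implicit Types (f g F : R -> R) (a b c t M : R).

Lemma is_derive_continuous F f : (forall x : R, is_derive x 1 F (f x)) -> continuous F.
Proof.
move=> dF x; apply: differentiable_continuous; apply/derivable1_diffP.
exact: ex_derive.
Qed.

Lemma continuous_measurable_EFin f (D : set R) : continuous f ->
  measurable_fun D (EFin \o f).
Proof.
move=> cf; apply/measurable_EFinP; apply: measurable_funTS.
exact: continuous_measurable_fun.
Qed.

Lemma is_derive_FTC f F a b : a < b -> continuous f ->
  (forall x : R, is_derive x 1 F (f x)) ->
  (\int[mu]_(x in `[a, b]) (f x)%:E = (F b - F a)%:E)%E.
Proof.
move=> ab cf dF; have cF := is_derive_continuous dF.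
rewrite (continuous_FTC2 (F := F) ab) //.
- exact: continuous_subspaceT.
- split => [x _||]; first exact: ex_derive.
  + exact/cvg_at_right_filter/cF.
  + exact/cvg_at_left_filter/cF.
- by move=> x _; rewrite derive1E derive_val.
Qed.

Lemma is_derive_FTC_le f F a b : a <= b -> continuous f ->
  (forall x : R, is_derive x 1 F (f x)) ->
  (`|F b - F a|%:E <= \int[mu]_(x in `[a, b]) `|f x|%:E)%E.
Proof.
rewrite le_eqVlt => /predU1P[-> _ _|ab cf dF].
  by rewrite subrr normr0; apply: integral_ge0 => x _; rewrite lee_fin.
rewrite -abse_EFin -(is_derive_FTC ab cf dF).
by apply: le_abse_integral => //; exact: continuous_measurable_EFin.
Qed.

Lemma segment_lebesgue_measure a b : a <= b -> mu `[a, b] = (b - a)%:E.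
Proof.
rewrite le_eqVlt => /predU1P[->|ab]; rewrite lebesgue_measure_itv/= lte_fin.
  by rewrite ltxx subrr.
by rewrite ab.
Qed.

Lemma integral_segment_cst (r : \bar R) a b : a <= b ->
  (\int[mu]_(_ in `[a, b]) r = r * (b - a)%:E)%E.
Proof.
move=> ab; rewrite integral_cst//=; congr (_ * _)%E.
exact: segment_lebesgue_measure.
Qed.

(** The derivative of g^2 is 2 g g', bounded by g^2 + g'^2. Integrate it from u to t and average
    over u in the unit interval [t - 1, t]: the average of g(u)^2 supplies the second copy of
    g^2. *)
Lemma sqr_le_integral g g' t : continuous g' ->
  (forall x : R, is_derive x 1 g (g' x)) ->
  ((g t ^+ 2)%:E <= \int[mu]_x (2 * g x ^+ 2 + g' x ^+ 2)%:E)%E.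
Proof.
move=> cg' dg; have cg := is_derive_continuous dg.
pose h x := g x ^+ 2 + g' x ^+ 2.
have ch : continuous h.
  by move=> x; apply: cvgD; apply: cvgM; (exact: cg || exact: cg').
have h0 x : 0 <= h x by rewrite addr_ge0 ?sqr_ge0.
have dg2 (x : R) : is_derive x 1 (fun y => g y ^+ 2) (2 * g x * g' x).
  apply: (is_derive_eq (is_deriveM (dg x) (dg x))); rewrite /GRing.scale/=; ring.
have c2 : continuous (fun x => 2 * g x * g' x).
  by move=> x; apply: cvgM; [apply: cvgM; [exact: cvg_cst|exact: cg]|exact: cg'].
have mh D : measurable_fun D (EFin \o h) by exact: continuous_measurable_EFin.
have mg2 D : measurable_fun D (fun x => (g x ^+ 2)%:E).
  apply: continuous_measurable_EFin => x; exact: cvgM (cg _) (cg _).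
have step u : u \in `[t - 1, t] -> ((g t ^+ 2)%:E <= (g u ^+ 2)%:E + \int[mu]_x (h x)%:E)%E.
  rewrite in_itv/= => /andP[_ ut]; rewrite -leeBlDl// -EFinB.
  rewrite (le_trans _ (le_trans (is_derive_FTC_le ut c2 dg2) _))//.
    by rewrite lee_fin ler_norm.
  rewrite (@le_trans _ _ (\int[mu]_(x in `[u, t]) (h x)%:E)%E)//.
    apply: ge0_le_integral => //.
    - apply: continuous_measurable_EFin => x; apply: cvg_norm; exact: c2.
    - exact: mh.
    - move=> x _; rewrite lee_fin /h -mulrA normrM ger0_norm// normrM.
      rewrite -(real_normK (num_real (g x))) -(real_normK (num_real (g' x))).
      have := sqr_ge0 (`|g x| - `|g' x|); nra.
  by apply: ge0_subset_integral => //; [exact: mh|move=> x _; rewrite lee_fin].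
have mg2' : measurable_fun setT (fun x => g x ^+ 2) by exact/measurable_EFinP.
have mh' : measurable_fun setT h by exact/measurable_EFinP.
have -> : (\int[mu]_x (2 * g x ^+ 2 + g' x ^+ 2)%:E =
    \int[mu]_x (g x ^+ 2 + h x)%:E)%E.
  by apply: eq_integral => x _; congr EFin; rewrite /h; ring.
rewrite ge0_integralD_EFin//; last by move=> x _; rewrite sqr_ge0.
set I := (\int[mu]_x (h x)%:E)%E in step *.
have I0 : (0 <= I)%E by apply: integral_ge0 => x _; rewrite lee_fin.
have t1 : t - (t - 1) = 1 by ring.
have t1t : t - 1 <= t by lra.
have : (\int[mu]_(u in `[(t - 1)%R, t]) (g t ^+ 2)%:E <=
   \int[mu]_(u in `[(t - 1)%R, t]) ((g u ^+ 2)%:E + I))%E.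
  apply: ge0_le_integral => //.
  - by move=> u _; rewrite lee_fin sqr_ge0.
  - by apply: emeasurable_funD; [exact: mg2|exact: measurable_cst].
rewrite integral_segment_cst// t1 mule1 ge0_integralD//; last 2 first.
  by move=> u _; rewrite lee_fin sqr_ge0.
  exact: mg2.
move=> /le_trans; apply; rewrite integral_segment_cst// t1 mule1 leeD2r//.
by apply: ge0_subset_integral => //; [exact: mg2|move=> u _; rewrite lee_fin sqr_ge0].
Qed.

(** Cauchy-Schwarz on an interval of length at most 2M, obtained from the pointwise Young inequality
    |f'| <= l/2 + f'^2 / (2l) with a constant l, so that an infinite right-hand side needs no
    separate theory. *)
Lemma sqr_osc_le_integral f f' M t u : continuous f' ->
  (forall x : R, is_derive x 1 f (f' x)) -> 0 < M ->
  t \in `[- M, M] -> u \in `[- M, M] ->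
  (((f t - f u) ^+ 2)%:E <= (2 * M)%:E * \int[mu]_(x in `[(- M)%R, M]) (f' x ^+ 2)%:E)%E.
Proof.
move=> cf' df M0.
wlog ut : t u / u <= t.
  move=> h tM uM; have [ut|/ltW tu] := leP u t; first exact: h.
  by rewrite -sqrrN opprB; exact: h.
rewrite !in_itv/= => /andP[_ tM] /andP[Mu _].
have m2 D : measurable_fun D (fun x => (f' x ^+ 2)%:E).
  apply: continuous_measurable_EFin => x; exact: cvgM (cf' _) (cf' _).
have m1 D : measurable_fun D (fun x => `|f' x|%:E).
  apply: continuous_measurable_EFin => x; apply: cvg_norm; exact: cf'.
set J := (\int[mu]_(x in _) _)%E.
have J0 : (0 <= J)%E by apply: integral_ge0 => x _; rewrite lee_fin sqr_ge0.
pose D := `|f t - f u|.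
have [D0|D0] := eqVneq D 0.
  move: D0 => /normr0_eq0 ->; rewrite expr0n/= mule_ge0// lee_fin; lra.
have Dgt0 : 0 < D by rewrite lt_neqAle eq_sym D0 /D normr_ge0.
(* Integrating Young's inequality gives D <= l M + J / (2l). This l makes the first term D / 2, and
   what remains is D^2 <= 2 M J. *)
pose l := D / (2 * M).
have l0 : 0 < l by rewrite divr_gt0// mulr_gt0.
have : (D%:E <= (l * M)%:E + ((2 * l)^-1)%:E * J)%E.
  apply: (le_trans (is_derive_FTC_le ut cf' df)).
  apply: (@le_trans _ _ (\int[mu]_(x in `[(- M)%R, M]) `|f' x|%:E)%E).
    apply: ge0_subset_integral => //; first exact: m1.
    by apply: subset_itvScc; rewrite bnd_simp.
  have mf2 : measurable_fun `[- M, M] (fun x => f' x ^+ 2) by exact/measurable_EFinP.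
  have lv0 : 0 <= (2 * l)^-1 by rewrite invr_ge0; lra.
  apply: (@le_trans _ _ (\int[mu]_(x in `[(- M)%R, M]) (l / 2 + (2 * l)^-1 * f' x ^+ 2)%:E)%E).
    apply: ge0_le_integral_EFin => //.
    - by apply/measurable_EFinP; exact: m1.
    - apply: measurable_funD; first exact: measurable_cst.
      by apply: measurable_funM => //; exact: measurable_cst.
    - move=> x _; rewrite -(real_normK (num_real (f' x))).
      have := sqr_ge0 (`|f' x| - l).
      have -> : l / 2 + (2 * l)^-1 * `|f' x| ^+ 2 = `|f' x| + (2 * l)^-1 * (`|f' x| - l) ^+ 2.
        field; lra.
      by move=> h; rewrite lerDl mulr_ge0.
  rewrite (@ge0_integralD_EFin _ _ _ _ _ _ (fun=> l / 2))//.
  - rewrite [X in (_ + X)%E]ge0_integralZ_EFin//; last by move=> x _; rewrite sqr_ge0.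
    rewrite leeD2r// integral_segment_cst; last lra.
    rewrite -EFinM lee_fin; lra.
  - by apply: measurable_funM => //; exact: measurable_cst.
  - by move=> x _; lra.
  - by move=> x _; rewrite mulr_ge0// sqr_ge0.
case: J J0 => [J J0|_|//]; last by move=> _; rewrite gt0_muley ?leey// lte_fin; lra.
rewrite -!EFinM -!EFinD !lee_fin => h; rewrite -(real_normK (num_real (f t - f u))) -/D.
have -> : D ^+ 2 = 2 * D * (D - l * M) by rewrite /l; field; lra.
have {}h : D - l * M <= (2 * l)^-1 * J by lra.
apply: (le_trans (ler_wpM2l _ h)); first lra.
have -> : 2 * D * ((2 * l)^-1 * J) = 2 * M * J.
  by rewrite /l; field; apply/andP; split; [lra|exact: D0].
exact: lexx.
Qed.

(** The integral of (x u)' = u + x u' is M u(M) + M u(-M), which is nonnegative: at both ends the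
    field x points outwards. The positive and negative parts of x u' stand on opposite sides so that
    both integrands are nonnegative and Tonelli applies to them in higher dimension. *)
Lemma integral_parts_le (u u' : R -> R) M : continuous u' ->
  (forall x : R, is_derive x 1 u (u' x)) -> (forall x, 0 <= u x) -> 0 < M ->
  (\int[mu]_(x in `[(- M)%R, M]) (Num.max 0 (- (x * u' x)))%:E <=
   \int[mu]_(x in `[(- M)%R, M]) (u x + Num.max 0 (x * u' x))%:E)%E.
Proof.
move=> cu' du u0 M0; have cu := is_derive_continuous du.
pose A x := u x + Num.max 0 (x * u' x); pose B x := Num.max 0 (- (x * u' x)).
have cx : continuous (fun x : R => x * u' x).
  by move=> x; apply: cvgM; [exact: cvg_id|exact: cu'].
have cB : continuous B.
  by apply: continuous_max0 => x; apply: cvgN; exact: cx.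
have cA : continuous A.
  by move=> x; apply: cvgD; [exact: cu|exact: (continuous_max0 cx)].
have AB x : A x - B x = u x + x * u' x.
  by rewrite /A /B -addrA; congr (_ + _); have [h|h] := leP 0 (x * u' x);
    [rewrite !max_l|rewrite !max_r]; lra.
have iA : mu.-integrable `[(- M)%R, M] (EFin \o A).
  apply: continuous_compact_integrable; first exact: segment_compact.
  exact: continuous_subspaceT.
have iB : mu.-integrable `[(- M)%R, M] (EFin \o B).
  apply: continuous_compact_integrable; first exact: segment_compact.
  exact: continuous_subspaceT.
rewrite -sube_ge0; last first.
  by apply/orP; left; exact: (integrable_fin_num _ iB).
rewrite -integralB//.
have -> : (\int[mu]_(x in `[(- M)%R, M]) ((A x)%:E - (B x)%:E) =
    \int[mu]_(x in `[(- M)%R, M]) (u x + x * u' x)%:E)%E.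
  by apply: eq_integral => x _; rewrite -EFinB AB.
have dxu (x : R) : is_derive x 1 (fun x => x * u x) (u x + x * u' x).
  apply: (is_derive_eq (is_deriveM (is_derive_id x (1 : R)) (du x))).
  by rewrite /GRing.scale/=; ring.
have cxu : continuous (fun x : R => u x + x * u' x).
  by move=> x; apply: cvgD; [exact: cu|exact: cx].
have MM : - M < M by lra.
rewrite (is_derive_FTC MM cxu dxu) lee_fin.
have := u0 M; have := u0 (- M); nra.
Qed.

(** Uniqueness of the Lebesgue measure: c times its image under multiplication by c gives every
    interval its length. *)
Lemma lebesgue_measure_scale c (A : set R) : 0 < c -> measurable A ->
  mu (( *%R c) @^-1` A) = (c^-1%:E * mu A)%E.
Proof.
move=> c0 mA.
have c'0 : 0 <= c by exact: ltW.
have mc : measurable_fun setT ( *%R c : R -> measurableTypeR R).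
  exact: mulrl_measurable.
pose nu := mscale (NngNum c'0) (pushforward mu ( *%R c : R -> measurableTypeR R)).
have -> : mu A = nu mc A.
  apply: lebesgue_measure_unique => // _ [[a b] _ <-].
  rewrite /nu/= /mscale/= /pushforward/=.
  rewrite (_ : _ @^-1` _ = `]a / c, b / c]%classic); last first.
    apply/seteqP; split => x /=; rewrite !in_itv/= ltr_pdivrMr// ler_pdivlMr//;
    by rewrite !(mulrC c).
  rewrite !lebesgue_measure_itv/= !lte_fin ltr_pM2r ?invr_gt0//.
  by case: ifP => _; rewrite ?mule0// -!EFinB -EFinM; congr EFin; field; lra.
rewrite /nu /mscale/= /pushforward muleA -EFinM mulVf ?mul1e//; lra.
Qed.

Lemma ge0_integral_scale c (f : R -> \bar R) : 0 < c ->
  measurable_fun setT f -> (forall x, 0 <= f x)%E ->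
  (\int[mu]_x f (c * x)%R = c^-1%:E * \int[mu]_x f x)%E.
Proof.
move=> c0 mf f0.
have mc : measurable_fun setT ( *%R c : R -> measurableTypeR R).
  exact: mulrl_measurable.
have cv0 : 0 <= c^-1 by rewrite invr_ge0 ltW.
rewrite -(@ge0_integral_mscale _ _ _ mu setT _ (NngNum cv0))//.
transitivity (\int[pushforward mu ( *%R c : R -> measurableTypeR R)]_x f x)%E.
  by rewrite ge0_integral_pushforward.
apply: eq_measure_integral => A mA _.
exact: lebesgue_measure_scale.
Qed.

End one_dimensional.

(** * The Euclidean log-Sobolev inequality *)

Section C1.
Context {R : realType}.

(** The partial derivatives are carried as data, and only derivatives along the axes are required,
    so that the property passes to slices and its partial derivatives to the lines used in the
    inductions on the dimension. *)
Definition C1 d (g : 'rV[R]_d -> R) (G : 'I_d -> 'rV[R]_d -> R) :=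
  [/\ continuous g, forall i, continuous (G i) &
      forall x i, is_derive x (delta_mx ord0 i) g (G i x)].

Lemma continuous_cstr (T : topologicalType) (c : R) : continuous (fun _ : T => c).
Proof. by move=> x; exact: cvg_cst. Qed.

Lemma continuous_addr (T : topologicalType) (f g : T -> R) :
  continuous f -> continuous g -> continuous (fun x => f x + g x).
Proof. by move=> cf cg x; apply: cvgD; [exact: cf|exact: cg]. Qed.

Lemma continuous_oppr (T : topologicalType) (f : T -> R) :
  continuous f -> continuous (fun x => - f x).
Proof. by move=> cf x; apply: cvgN; exact: cf. Qed.

Lemma continuous_mulr (T : topologicalType) (f g : T -> R) :
  continuous f -> continuous g -> continuous (fun x => f x * g x).
Proof. by move=> cf cg x; apply: cvgM; [exact: cf|exact: cg]. Qed.

Lemma continuous_scalel (T : topologicalType) (c : R) (f : T -> R) :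
  continuous f -> continuous (fun x => c * f x).
Proof. by move=> cf; apply: continuous_mulr => // x; exact: cvg_cst. Qed.

Lemma continuous_scaler (T : topologicalType) (c : R) (f : T -> R) :
  continuous f -> continuous (fun x => f x * c).
Proof. by move=> cf; apply: continuous_mulr => // x; exact: cvg_cst. Qed.

Lemma continuous_bigsum (T : topologicalType) I (r : seq I) (F : I -> T -> R) :
  (forall i, continuous (F i)) -> continuous (fun x => \sum_(i <- r) F i x).
Proof.
move=> cF; elim: r => [|i r IHr].
  by under eq_fun do rewrite big_nil; move=> x; exact: cvg_cst.
by under eq_fun do rewrite big_cons; exact: continuous_addr.
Qed.

Lemma continuous_sqr (T : topologicalType) (f : T -> R) :
  continuous f -> continuous (fun x => f x ^+ 2).
Proof. by move=> cf; exact: continuous_mulr. Qed.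

(** A directional derivative depends only on the restriction to one line. This moves derivatives
    between a space and its slices, lines and rays. *)
Lemma is_derive_along (V W : normedModType R) (a v : V) (b w : W) (f : V -> R)
    (g : W -> R) l :
  (forall h, f (h *: v + a) = g (h *: w + b)) ->
  is_derive b w g l -> is_derive a v f l.
Proof.
move=> fg [dg gl].
have fa : f a = g b by have := fg 0; rewrite !scale0r !add0r.
have E : (fun h => h^-1 *: ((f \o shift a) (h *: v) - f a)) =
         (fun h => h^-1 *: ((g \o shift b) (h *: w) - g b)).
  by apply/funext => h /=; rewrite fg fa.
by split; [rewrite /derivable E|rewrite /derive E].
Qed.

Section slice.
Context d (g : 'rV[R]_d.+1 -> R) (G : 'I_d.+1 -> 'rV[R]_d.+1 -> R).

Lemma continuous_slicer t : continuous g -> continuous (fun x => g (rV_cons (t, x))).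
Proof.
move=> cg x; apply: (continuous_comp (@continuous_rV_consr R d t x)); exact: cg.
Qed.

Lemma continuous_slicel x : continuous g -> continuous (fun t => g (rV_cons (t, x))).
Proof.
move=> cg t; apply: (continuous_comp (@continuous_rV_consl R d x t)); exact: cg.
Qed.

Hypothesis gG : C1 g G.

Lemma C1_slice t :
  C1 (fun x => g (rV_cons (t, x))) (fun i x => G (lift ord0 i) (rV_cons (t, x))).
Proof.
have [cg cG dg] := gG; split => [|i|x i].
- exact: continuous_slicer.
- move=> x; apply: (continuous_comp (@continuous_rV_consr R d t x)); exact: cG.
- apply: (is_derive_along _ (dg (rV_cons (t, x)) (lift ord0 i))) => h.
  by congr g; rewrite -rV_cons_delta -rV_consZ -rV_consD mulr0 add0r.
Qed.

Lemma C1_line (t : R) x :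
  is_derive t 1 (fun t => g (rV_cons (t, x))) (G ord0 (rV_cons (t, x))).
Proof.
have [cg cG dg] := gG.
apply: (is_derive_along _ (dg (rV_cons (t, x)) ord0)) => h; congr g.
rewrite [LHS]rV_consE [in RHS](rV_consE t) addrA -scalerDl.
by rewrite [_ *: 1]mulr1.
Qed.

End slice.

Lemma measurable_continuous_rV d (f : 'rV[R]_d -> R) D :
  continuous f -> measurable_fun D f.
Proof. by move=> cf; apply: measurable_funTS; exact: continuous_rV_measurable. Qed.

Lemma measurable_continuous_EFin_rV d (f : 'rV[R]_d -> R) D :
  continuous f -> measurable_fun D (fun x => (f x)%:E).
Proof. by move=> cf; apply/measurable_EFinP; exact: measurable_continuous_rV. Qed.

End C1.
Arguments continuous_slicer {R d g} t _.
Arguments continuous_slicel {R d g} x _.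
Arguments measurable_continuous_rV {R d f} D _.
Arguments measurable_continuous_EFin_rV {R d f} D _.

Section ln_plus.
Context {R : realType}.
Implicit Types x y : R.

(** The positive part of the logarithm: with it the entropy integrands are nonnegative, and they
    stay continuous where the function vanishes. *)
Definition lnp x : R := ln (Num.max 1 x).

Let max1_gt0 x : 0 < Num.max 1 x.
Proof. by rewrite lt_max ltr01. Qed.

Lemma lnp_ge0 x : 0 <= lnp x.
Proof. by apply: ln_ge0; rewrite le_max lexx. Qed.

Lemma lnp0 : lnp 0 = 0.
Proof. by rewrite /lnp max_l ?ln1. Qed.

Lemma ln_le_lnp x : 0 < x -> ln x <= lnp x.
Proof. by move=> x0; rewrite ler_ln ?posrE ?max1_gt0// le_max lexx orbT. Qed.

Lemma le_lnp x y : x <= y -> lnp x <= lnp y.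
Proof.
move=> xy; rewrite ler_ln ?posrE ?max1_gt0//.
by rewrite ge_max !le_max lexx xy orbT.
Qed.

Lemma lnpM x y : 0 <= y -> lnp (x * y) <= lnp x + lnp y.
Proof.
move=> y0; rewrite -lnM ?posrE ?max1_gt0// ler_ln ?posrE ?max1_gt0//; last first.
  by rewrite mulr_gt0.
rewrite ge_max; apply/andP; split.
  by rewrite -[leLHS]mulr1 ler_pM ?ler01// le_max lexx.
by rewrite (le_trans (ler_wpM2r y0 _) (ler_wpM2l _ _))// ?le_max ?lexx ?orbT// ltW.
Qed.

Lemma lnp_le x : 0 <= x -> lnp x <= x.
Proof.
move=> x0; apply: (@le_trans _ _ (ln (1 + x))).
  by rewrite ler_ln ?posrE ?max1_gt0 ?ge_max ?lerDl ?x0 ?lerDr ?ler01//; lra.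
by apply: le_ln1Dx; lra.
Qed.

Lemma lnp_2D x : 0 <= x -> lnp (2 + x) <= 1 + x.
Proof.
move=> x0; rewrite /lnp max_r; last lra.
by rewrite (_ : 2 + x = 1 + (1 + x)); [apply: le_ln1Dx; lra|ring].
Qed.

Lemma lnp_expR x : 0 <= x -> lnp (expR x) = x.
Proof. by move=> x0; rewrite /lnp max_r ?expRK// -expR0 ler_expR. Qed.

Lemma continuous_lnp : continuous lnp.
Proof.
move=> x; have c1 : {for x, continuous (fun=> 1 : R^o)} by exact: cvg_cst.
have cm : {for x, continuous (fun x : R => Num.max 1 x)}.
  exact: (continuous_max c1 (@cvg_id _ (nbhs x))).
exact: (continuous_comp cm (continuous_ln (max1_gt0 x))).
Qed.

Lemma continuous_lnp_div (T : topologicalType) (f : T -> R) (c : R) :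
  continuous f -> continuous (fun t => lnp (f t / c)).
Proof.
move=> cf t; apply: (@continuous_comp _ _ _ (fun t => f t / c) lnp).
  by apply: continuous_scaler.
exact: continuous_lnp.
Qed.

End ln_plus.
Arguments continuous_lnp_div {R T f} c _.

Section euclidean_log_sobolev.
Context {R : realType}.
Local Notation mu := (@lebesgue_measure R).
Local Notation leb := (@lebesgue_rV R).

(* The chain rule for the entropy of [g ^+ 2]: with [h t] the marginal of
   [g ^+ 2] in the first coordinate, [ln (g^2 / n) = ln (g^2 / h) + ln (h / n)],
   and the one-dimensional bound [h <= 2 n + \int (G ord0)^2] controls the last
   term without differentiating the marginal. *)
Lemma euclidean_log_sobolev d (g : 'rV[R]_d -> R) G (n : R) :
  C1 g G ->
  (\int[leb d]_x (g x ^+ 2)%:E = n%:E)%E ->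
  (\int[leb d]_x (g x ^+ 2 * lnp (g x ^+ 2 / n))%:E <=
   \int[leb d]_x (\sum_(i < d) G i x ^+ 2)%:E + (d%:R * n)%:E)%E.
Proof.
elim: d g G n => [|d IHd] g G n gG gn.
  rewrite !ge0_integral_rV0 big_ord0 mul0r adde0 lee_fin.
  move: gn; rewrite ge0_integral_rV0 => -[->].
  have [->|n0] := eqVneq n 0; first by rewrite mul0r.
  by rewrite divff// /lnp maxxx ln1 mulr0.
have [cg cG dg] := gG.
have cg2 := continuous_sqr cg.
have cGi i := continuous_sqr (cG i).
have n0 : 0 <= n.
  by rewrite -lee_fin -gn; apply: integral_ge0 => x _; rewrite lee_fin sqr_ge0.
have ce m : continuous (fun x => g x ^+ 2 * lnp (g x ^+ 2 / m)).
  exact: (continuous_mulr cg2 (continuous_lnp_div _ cg2)).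
have e0 m x : 0 <= g x ^+ 2 * lnp (g x ^+ 2 / m).
  by rewrite mulr_ge0 ?sqr_ge0 ?lnp_ge0.
set D := (\int[leb d.+1]_x (G ord0 x ^+ 2)%:E)%E.
set K := (\int[leb d.+1]_x (\sum_(i < d) G (lift ord0 i) x ^+ 2)%:E)%E.
have cS : continuous (fun x => \sum_(i < d) G (lift ord0 i) x ^+ 2).
  exact: continuous_bigsum.
have S0 x : 0 <= \sum_(i < d) G (lift ord0 i) x ^+ 2.
  by apply: sumr_ge0 => i _; exact: sqr_ge0.
have D0 : (0 <= D)%E by apply: integral_ge0 => x _; rewrite lee_fin sqr_ge0.
have K0 : (0 <= K)%E by apply: integral_ge0 => x _; rewrite lee_fin.
have -> : (\int[leb d.+1]_x (\sum_(i < d.+1) G i x ^+ 2)%:E = D + K)%E.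
  under eq_integral do rewrite big_ord_recl.
  rewrite (@ge0_integralD_EFin _ _ _ _ _ _ (fun x => G ord0 x ^+ 2))//.
  - exact: measurable_continuous_rV.
  - exact: measurable_continuous_rV.
  - by move=> x _; exact: sqr_ge0.
have [->|DN] := eqVneq D +oo%E.
  by rewrite addye ?addye ?leey//; case: K K0.
have [dd DE] : exists dd, D = dd%:E by case: (D) D0 DN => // r; exists r.
rewrite DE lee_fin in D0.
pose H t := (\int[leb d]_x (g (rV_cons (t, x)) ^+ 2)%:E)%E.
have H0 t : (0 <= H t)%E by apply: integral_ge0 => x _; rewrite lee_fin sqr_ge0.
have mg2 : measurable_fun setT (fun x => (g x ^+ 2)%:E).
  exact: measurable_continuous_EFin_rV.
have g20 x : (0 <= (g x ^+ 2)%:E)%E by rewrite lee_fin sqr_ge0.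
have mH : measurable_fun setT H by exact: (measurable_tonelli_rV mg2 g20).
have intH : (\int[mu]_t H t = n%:E)%E by rewrite -gn tonelli_rV.
(* The one-dimensional bound on each line parallel to the first axis, integrated over the other
   coordinates. It also shows that every slice has finite mass. *)
have HD t : (H t <= (2 * n + dd)%:E)%E.
  have c2 : continuous (fun x => 2 * g x ^+ 2 + G ord0 x ^+ 2).
    by apply: continuous_addr; [exact: continuous_scalel|exact: cGi].
  have p2 x : (0 <= (2 * g x ^+ 2 + G ord0 x ^+ 2)%:E)%E.
    by rewrite lee_fin; have := sqr_ge0 (g x); have := sqr_ge0 (G ord0 x); lra.
  have m2 : measurable_fun setT (fun x => (2 * g x ^+ 2 + G ord0 x ^+ 2)%:E).
    exact: measurable_continuous_EFin_rV.
  have -> : ((2 * n + dd)%:E =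
      \int[leb d.+1]_x (2 * g x ^+ 2 + G ord0 x ^+ 2)%:E)%E.
    rewrite (@ge0_integralD_EFin _ _ _ _ _ _ (fun x => 2 * g x ^+ 2))//.
    - rewrite ge0_integralZ_EFin//.
      + by rewrite gn -/D DE -EFinM -EFinD.
      + exact: measurable_continuous_rV.
      + by move=> x _; exact: sqr_ge0.
    - by apply: measurable_continuous_rV; exact: continuous_scalel.
    - exact: measurable_continuous_rV.
    - by move=> x _; rewrite mulr_ge0 ?sqr_ge0.
    - by move=> x _; exact: sqr_ge0.
  rewrite tonelli_rVC//; apply: ge0_le_integral => //.
  - have cs : continuous (fun x => g (rV_cons (t, x)) ^+ 2) := continuous_slicer t cg2.
    have ms := measurable_continuous_EFin_rV setT cs.
    refine ms.
  - exact: (measurable_tonelli_rVC m2 p2).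
  - move=> x _; apply: (sqr_le_integral (g := fun t => g (rV_cons (t, x)))
      (g' := fun t => G ord0 (rV_cons (t, x)))).
    + exact: (continuous_slicel x (cG ord0)).
    + by move=> s; exact: C1_line.
pose h t := fine (H t).
have Hh t : H t = (h t)%:E.
  by rewrite /h fineK// ge0_fin_numE// (le_lt_trans (HD t))// ltry.
have h0 t : 0 <= h t by rewrite -lee_fin -Hh.
have hD t : h t <= 2 * n + dd by rewrite -lee_fin -Hh.
(* Total coefficient of the slice mass [h t]: [d] comes from the induction hypothesis on the slice,
   and [1 + dd / n] bounds [lnp (h t / n)]. Since the slice masses sum to [n], the integrated cost
   is [c * n], that is [d.+1 * n + dd] when [n] is not 0: the one new multiple of [n] and the energy
   in the first coordinate. *)
pose c := d%:R + (1 + dd / n).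
have c0 : 0 <= c by rewrite !addr_ge0// divr_ge0.
pose Kt t := (\int[leb d]_x (\sum_(i < d) G (lift ord0 i) (rV_cons (t, x)) ^+ 2)%:E)%E.
have mS : measurable_fun setT (fun x => (\sum_(i < d) G (lift ord0 i) x ^+ 2)%:E).
  exact: measurable_continuous_EFin_rV.
have SE0 x : (0 <= (\sum_(i < d) G (lift ord0 i) x ^+ 2)%:E)%E by rewrite lee_fin.
have Kt0 t : (0 <= Kt t)%E by apply: integral_ge0.
have mK : measurable_fun setT Kt by exact: (measurable_tonelli_rV mS SE0).
have logh t : lnp (h t / n) <= 1 + dd / n.
  have [->|nN0] := eqVneq n 0; first by rewrite invr0 !mulr0 lnp0 addr0 ler01.
  have np : 0 < n by rewrite lt_neqAle eq_sym nN0.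
  apply: le_trans (lnp_2D _); last by rewrite divr_ge0.
  apply: le_lnp; rewrite ler_pdivrMr// mulrDl divfK//.
have step t : (\int[leb d]_x (g (rV_cons (t, x)) ^+ 2 *
    lnp (g (rV_cons (t, x)) ^+ 2 / n))%:E <= Kt t + c%:E * H t)%E.
  have cs : continuous (fun x => g (rV_cons (t, x)) ^+ 2).
    exact: (continuous_slicer t cg2).
  have csn m : continuous (fun x => g (rV_cons (t, x)) ^+ 2 *
      lnp (g (rV_cons (t, x)) ^+ 2 / m)).
    exact: (continuous_slicer t (ce m)).
  (* On a slice of zero mass the induction hypothesis would divide by 0; there the integrand
     vanishes almost everywhere. *)
  have [ht0|htN0] := eqVneq (h t) 0.
    rewrite (@ge0_integralM_eq0 _ _ _ _ _ _ (fun x => g (rV_cons (t, x)) ^+ 2))//.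
    - by rewrite adde_ge0// mule_ge0// lee_fin.
    - exact: measurable_continuous_rV.
    - by apply: measurable_continuous_rV; exact: (continuous_lnp_div _ cs).
    - by move=> x _; exact: sqr_ge0.
    - by move=> x _; exact: lnp_ge0.
    - by rewrite -/(H t) Hh ht0.
  have htp : 0 < h t by rewrite lt_neqAle eq_sym htN0 h0.
  have := IHd _ _ (h t) (C1_slice gG t) (Hh t).
  rewrite -/(Kt t) => IH.
  apply: (@le_trans _ _ (\int[leb d]_x (g (rV_cons (t, x)) ^+ 2 *
      lnp (g (rV_cons (t, x)) ^+ 2 / h t) +
      lnp (h t / n) * g (rV_cons (t, x)) ^+ 2)%:E)%E).
    have c3 : continuous (fun x => lnp (h t / n) * g (rV_cons (t, x)) ^+ 2).
      exact: continuous_scalel.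
    apply: ge0_le_integral_EFin => //.
    - exact: measurable_continuous_rV.
    - by apply: measurable_continuous_rV; apply: continuous_addr; [exact: csn|exact: c3].
    - move=> x _; rewrite [X in _ + X]mulrC -mulrDr ler_wpM2l ?sqr_ge0//.
      apply: le_trans (lnpM _ _); last by rewrite divr_ge0.
      by rewrite mulrA divfK.
  rewrite (@ge0_integralD_EFin _ _ _ _ _ _ (fun x => g (rV_cons (t, x)) ^+ 2 *
      lnp (g (rV_cons (t, x)) ^+ 2 / h t)))//; last 3 first.
  - exact: measurable_continuous_rV.
  - by apply: measurable_continuous_rV; exact: continuous_scalel.
  - by move=> x _; rewrite mulr_ge0 ?lnp_ge0 ?sqr_ge0.
  rewrite [X in (_ + X)%E]ge0_integralZ_EFin//; last 3 first.
  - exact: measurable_continuous_rV.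
  - by move=> x _; exact: sqr_ge0.
  - exact: lnp_ge0.
  rewrite -/(H t) (le_trans (leeD2r _ IH))// -addeA leeD2l// Hh -!EFinM -EFinD lee_fin.
  by rewrite /c mulrDl lerD2l ler_wpM2r.
have mce : measurable_fun setT (fun x => (g x ^+ 2 * lnp (g x ^+ 2 / n))%:E).
  exact: measurable_continuous_EFin_rV.
rewrite tonelli_rV//; last by move=> x; rewrite lee_fin.
apply: (@le_trans _ _ (\int[mu]_t (Kt t + c%:E * H t))%E).
  apply: ge0_le_integral => //.
  - by move=> t _; apply: integral_ge0 => x _; rewrite lee_fin.
  - by apply: (measurable_tonelli_rV mce) => x; rewrite lee_fin.
  - by apply: emeasurable_funD => //; exact: measurable_funeM.
rewrite ge0_integralD//; last 2 first.
- by move=> t _; rewrite mule_ge0.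
- exact: measurable_funeM.
rewrite ge0_integralZl_EFin// intH -EFinM.
have -> : (\int[mu]_t Kt t = K)%E by rewrite /K (tonelli_rV mS SE0).
rewrite DE [X in (_ <= X)%E]addeAC [X in (_ <= X)%E]addeC leeD2l//.
rewrite -EFinD lee_fin /c.
have [->|nN0] := eqVneq n 0; first by rewrite !mulr0 addr0.
have -> : (d%:R + (1 + dd / n)) * n = dd + d.+1%:R * n by rewrite -natr1; field.
exact: lexx.
Qed.

End euclidean_log_sobolev.

(** * The Poincare inequality on cubes *)

Section cubes.
Context {R : realType}.
Local Notation mu := (@lebesgue_measure R).
Local Notation leb := (@lebesgue_rV R).

(** The inequality between the integrals of the two parts of div(x u) is proved one coordinate at a
    time: the first by the one-dimensional bound on lines, the others by the induction hypothesis on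
    slices. *)
Lemma integral_parts_cube d (u : 'rV[R]_d -> R) V M :
  C1 u V -> (forall x, 0 <= u x) -> 0 < M ->
  (\int[leb d]_(x in cube d M) (\sum_(i < d) Num.max 0 (- (x ord0 i * V i x)))%:E <=
   \int[leb d]_(x in cube d M)
     (\sum_(i < d) (u x + Num.max 0 (x ord0 i * V i x)))%:E)%E.
Proof.
elim: d u V => [|d IHd] u V uV u0 M0.
  under eq_integral do rewrite big_ord0.
  by under [leRHS]eq_integral do rewrite big_ord0.
have [cu cV du] := uV.
pose B (i : 'I_d.+1) (x : 'rV[R]_d.+1) := Num.max 0 (- (x ord0 i * V i x)).
pose A (i : 'I_d.+1) (x : 'rV[R]_d.+1) := u x + Num.max 0 (x ord0 i * V i x).
have cxV i : continuous (fun x : 'rV[R]_d.+1 => x ord0 i * V i x).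
  by apply: continuous_mulr; [exact: coord_continuous|exact: cV].
have cB i : continuous (B i).
  exact: (continuous_max0 (continuous_oppr (cxV i))).
have cA i : continuous (A i).
  exact: (continuous_addr cu (continuous_max0 (cxV i))).
have B0 i x : 0 <= B i x by rewrite /B le_max lexx.
have A0 i x : 0 <= A i x by rewrite addr_ge0// le_max lexx.
(* Tonelli in both orders: the term of the first coordinate is integrated innermost along lines, the
   remaining sum innermost over slices. *)
have split_ord0 (F : 'I_d.+1 -> 'rV[R]_d.+1 -> R) :
    (forall i, continuous (F i)) -> (forall i x, 0 <= F i x) ->
    (\int[leb d.+1]_(x in cube d.+1 M) (\sum_(i < d.+1) F i x)%:E =
     \int[leb d]_(x in cube d M)
       \int[mu]_(t in `[(- M)%R, M]) (F ord0 (rV_cons (t, x)))%:E +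
     \int[mu]_(t in `[(- M)%R, M])
       \int[leb d]_(x in cube d M)
         (\sum_(i < d) F (lift ord0 i) (rV_cons (t, x)))%:E)%E.
  move=> cF F0; under eq_integral do rewrite big_ord_recl.
  have cs : continuous (fun x => \sum_(i < d) F (lift ord0 i) x).
    exact: continuous_bigsum.
  have s0 x : 0 <= \sum_(i < d) F (lift ord0 i) x.
    by apply: sumr_ge0 => i _.
  rewrite (@ge0_integralD_EFin _ _ _ _ _ (@measurable_cube R d.+1 M) (F ord0))//.
  - have F0E x : (0 <= (F ord0 x)%:E)%E by rewrite lee_fin.
    have s0E x : (0 <= (\sum_(i < d) F (lift ord0 i) x)%:E)%E by rewrite lee_fin.
    rewrite tonelli_cubeC//; last exact: measurable_continuous_EFin_rV.
    by rewrite tonelli_cube//; exact: measurable_continuous_EFin_rV.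
  - exact: measurable_continuous_rV.
  - exact: measurable_continuous_rV.
have mcube := @measurable_cube R d M.
rewrite (split_ord0 B)// (split_ord0 A)//; apply: leeD.
  apply: ge0_le_integral => //.
  - by move=> x _; apply: integral_ge0 => t _; rewrite lee_fin.
  - apply: (@measurable_tonelli_cubeC R d M (fun x => (B ord0 x)%:E)).
      exact: measurable_continuous_EFin_rV.
    by move=> x; rewrite lee_fin.
  - apply: (@measurable_tonelli_cubeC R d M (fun x => (A ord0 x)%:E)).
      exact: measurable_continuous_EFin_rV.
    by move=> x; rewrite lee_fin.
  - move=> x _; rewrite /A /B; under eq_integral do rewrite rV_cons0/=.
    under [leRHS]eq_integral do rewrite rV_cons0/=.
    apply: (@integral_parts_le _ (fun t => u (rV_cons (t, x)))
      (fun t => V ord0 (rV_cons (t, x)))) => //.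
    + exact: (continuous_slicel x (cV ord0)).
    + by move=> t; exact: C1_line.
have cAs : continuous (fun x => \sum_(i < d) A (lift ord0 i) x).
  exact: continuous_bigsum.
have cBs : continuous (fun x => \sum_(i < d) B (lift ord0 i) x).
  exact: continuous_bigsum.
have As0 x : 0 <= \sum_(i < d) A (lift ord0 i) x by exact: sumr_ge0.
have Bs0 x : 0 <= \sum_(i < d) B (lift ord0 i) x by exact: sumr_ge0.
apply: ge0_le_integral => //.
- by move=> t _; apply: integral_ge0 => x _; rewrite lee_fin.
- apply: (@measurable_tonelli_cube R d M (fun x => (\sum_(i < d) B (lift ord0 i) x)%:E)).
    exact: measurable_continuous_EFin_rV.
  by move=> x; rewrite lee_fin.
- apply: (@measurable_tonelli_cube R d M (fun x => (\sum_(i < d) A (lift ord0 i) x)%:E)).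
    exact: measurable_continuous_EFin_rV.
  by move=> x; rewrite lee_fin.
move=> t _; rewrite /A /B.
under eq_integral do under eq_bigr do rewrite rV_consS/=.
under [leRHS]eq_integral do under eq_bigr do rewrite rV_consS/=.
exact: (IHd _ _ (C1_slice uV t) (fun x => u0 _) M0).
Qed.

(** Along lines, f is compared with its value on one slice t = y, and on that slice the inequality
    of lower dimension gives the constant [c], which need not be the mean of f. The slice is chosen
    so that its energy is at most the average over t up to a margin; the additive [e] accounts for
    this margin. *)
Lemma local_poincare d M : 0 < M -> exists2 K : R, 0 < K &
  forall (f : 'rV[R]_d -> R) F e, C1 f F -> 0 < e -> exists c,
  (\int[leb d]_(x in cube d M) ((f x - c) ^+ 2)%:E <=
   K%:E * \int[leb d]_(x in cube d M) (\sum_(i < d) F i x ^+ 2)%:E + e%:E)%E.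
Proof.
move=> M0; elim: d => [|d [K K0 IHd]].
  exists 1 => // f F e fF e0; exists (f 0).
  have -> : (\int[leb 0]_(x in cube 0 M) ((f x - f 0%R) ^+ 2)%:E = 0)%E.
    apply: integral0_eq => x _; rewrite (_ : x = 0) ?subrr ?expr0n//.
    by apply/rowP => -[].
  rewrite mul1e; apply: adde_ge0; last by rewrite lee_fin ltW.
  by apply: integral_ge0 => x _; rewrite big_ord0.
(* Write (f - c)^2 <= 2 (f - f(y, .))^2 + 2 (f(y, .) - c)^2 and integrate over t in an interval of
   length 2M. The oscillation bound 2 M J turns the first term into 8 M^2 J. The second becomes 4M
   times a slice integral, and the slice energy is about 1 / (2M) of the total energy, whence 2K. *)
exists (8 * M ^+ 2 + 2 * K); first by have := sqr_ge0 M; lra.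
move=> f F e fF e0.
have [cf cF df] := fF.
have mcube k := @measurable_cube R k M.
have mQ := mcube d.
pose S x := \sum_(i < d) F (lift ord0 i) x ^+ 2.
have S0 x : 0 <= S x by apply: sumr_ge0 => i _; exact: sqr_ge0.
have cS : continuous S by apply: continuous_bigsum => i; exact: continuous_sqr.
have SE0 x : (0 <= (S x)%:E)%E by rewrite lee_fin.
have mS : measurable_fun setT (EFin \o S) by exact: measurable_continuous_EFin_rV.
have cF0 : continuous (fun x => F ord0 x ^+ 2) by exact: continuous_sqr.
have F00 x : (0 <= (F ord0 x ^+ 2)%:E)%E by rewrite lee_fin sqr_ge0.
have mF0 : measurable_fun setT (fun x => (F ord0 x ^+ 2)%:E).
  exact: measurable_continuous_EFin_rV.
set A := (\int[leb d.+1]_(x in cube d.+1 M) (S x)%:E)%E.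
set B := (\int[leb d.+1]_(x in cube d.+1 M) (F ord0 x ^+ 2)%:E)%E.
have -> : (\int[leb d.+1]_(x in cube d.+1 M) (\sum_(i < d.+1) F i x ^+ 2)%:E = B + A)%E.
  under eq_integral do rewrite big_ord_recl.
  rewrite (@ge0_integralD_EFin _ _ _ _ _ (mcube d.+1) (fun x => F ord0 x ^+ 2))//.
  - exact: measurable_continuous_rV.
  - exact: measurable_continuous_rV.
  - by move=> x _; exact: sqr_ge0.
  - by move=> x _; exact: S0.
have A0 : (0 <= A)%E by apply: integral_ge0.
have B0 : (0 <= B)%E by apply: integral_ge0.
have M2 : 0 <= M ^+ 2 by exact: sqr_ge0.
have K'0 : 0 < 8 * M ^+ 2 + 2 * K by lra.
have [->|AN] := eqVneq A +oo%E.
  exists 0; rewrite addey ?gt0_muley ?addye ?leey// ?lte_fin//.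
  by case: B B0.
have [a AE] : exists a, A = a%:E by case: (A) A0 AN => // r; exists r.
have a0 : 0 <= a by rewrite -lee_fin -AE.
pose phi t := (\int[leb d]_(x in cube d M) (S (rV_cons (t, x)))%:E)%E.
have phi0 t : (0 <= phi t)%E by apply: integral_ge0.
have mphi : measurable_fun `[- M, M] phi by exact: (measurable_tonelli_cube mS SE0).
have Aphi : A = (\int[mu]_(t in `[(- M)%R, M]) phi t)%E.
  by rewrite /A tonelli_cube.
(* [e1] is the margin in the choice of the slice and enters with the factor 2K; [e2] is the error of
   the induction hypothesis and enters with the factor 4M. Each costs e / 2. *)
pose e1 := e / (4 * K); pose e2 := e / (8 * M).
have e10 : 0 < e1 by rewrite divr_gt0// mulr_gt0.
have e20 : 0 < e2 by rewrite divr_gt0// mulr_gt0.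
have MM : - M <= M by lra.
(* If every slice exceeded the average by the margin, integrating over t would give a + e1 <= a. *)
have [y My phiy] : exists2 y, `[- M, M]%classic y &
    ((2 * M)%:E * phi y <= (a + e1)%:E)%E.
  apply: contrapT => h.
  have h' y : `[- M, M]%classic y -> ((a + e1)%:E <= (2 * M)%:E * phi y)%E.
    by move=> My; rewrite leNgt; apply/negP => /ltW lt; apply: h; exists y.
  have : (\int[mu]_(t in `[(- M)%R, M]) (a + e1)%:E <=
      \int[mu]_(t in `[(- M)%R, M]) ((2 * M)%:E * phi t))%E.
    apply: ge0_le_integral => //.
    - by move=> t _; rewrite lee_fin addr_ge0// ltW.
    - exact: measurable_funeM.
  rewrite integral_segment_cst// ge0_integralZl_EFin//; last lra.
  rewrite -Aphi AE -EFinM lee_fin; have := mulr_gt0 e10 M0; nra.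
have [c Hc] := IHd _ _ _ (C1_slice fF y) e20.
exists c.
have cfc : continuous (fun x => (f x - c) ^+ 2).
  exact: (continuous_sqr (continuous_addr cf (@continuous_cstr _ _ (- c)))).
have mfc : measurable_fun setT (fun x => ((f x - c) ^+ 2)%:E).
  exact: measurable_continuous_EFin_rV.
have fc0 x : (0 <= ((f x - c) ^+ 2)%:E)%E by rewrite lee_fin sqr_ge0.
rewrite tonelli_cubeC//.
pose J x := (\int[mu]_(t in `[(- M)%R, M]) (F ord0 (rV_cons (t, x)) ^+ 2)%:E)%E.
have J0 x : (0 <= J x)%E by apply: integral_ge0.
have mJ : measurable_fun (cube d M) J by exact: (measurable_tonelli_cubeC mF0 F00).
have BJ : B = (\int[leb d]_(x in cube d M) J x)%E by rewrite /B tonelli_cubeC.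
pose q x := (f (rV_cons (y, x)) - c) ^+ 2.
have cq : continuous q by exact: (continuous_slicer y cfc).
have q0 x : 0 <= q x by exact: sqr_ge0.
have mq D : measurable_fun D (EFin \o q) by exact: measurable_continuous_EFin_rV.
apply: (@le_trans _ _ (\int[leb d]_(x in cube d M)
    ((8 * M ^+ 2)%:E * J x + (4 * M)%:E * (q x)%:E))%E).
  apply: ge0_le_integral => //.
  - by move=> x _; apply: integral_ge0.
  - exact: (measurable_tonelli_cubeC mfc fc0).
  - by apply: emeasurable_funD; apply: measurable_funeM.
  - move=> x _.
    apply: (@le_trans _ _ (\int[mu]_(t in `[(- M)%R, M])
        ((4 * M)%:E * J x + (2 * q x)%:E))%E).
      apply: ge0_le_integral => //.
      + apply: continuous_measurable_EFin; exact: (continuous_slicel x cfc).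
      + move=> t tM.
        have := @sqr_osc_le_integral _ (fun t => f (rV_cons (t, x)))
          (fun t => F ord0 (rV_cons (t, x))) M t y
          (continuous_slicel x (cF ord0)) (fun s => C1_line fF s x) M0 tM My.
        rewrite -/(J x); case: (J x) (J0 x) => [j j0|_ _|//]; last first.
          by rewrite gt0_muley ?addye ?leey// lte_fin; lra.
        rewrite -!EFinM -EFinD !lee_fin /q.
        set X := f _; set Y := f _; have := sqr_ge0 (X - Y - (Y - c)); nra.
    rewrite integral_segment_cst//.
    rewrite (_ : M - - M = 2 * M); last ring.
    case: (J x) (J0 x) => [j j0|_|//]; last first.
      have h8 : (0 < (8 * M ^+ 2)%:E)%E by rewrite lte_fin mulr_gt0// exprn_gt0.
      by rewrite (gt0_muley h8) addye ?leey.
    by rewrite -!EFinM -!EFinD lee_fin; nra.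
rewrite ge0_integralD//; last 4 first.
- by move=> x _; rewrite mule_ge0// lee_fin; lra.
- exact: measurable_funeM.
- by move=> x _; rewrite mule_ge0 ?lee_fin//; lra.
- exact: measurable_funeM.
rewrite ge0_integralZl_EFin//; last lra.
rewrite ge0_integralZl_EFin//; last 2 first.
  by move=> x _; rewrite lee_fin.
  lra.
rewrite -BJ AE; rewrite -/(phi y) -/(q _) in Hc.
have [->|BN] := eqVneq B +oo%E.
  have h : (0 < (8 * M ^+ 2 + 2 * K)%:E)%E by rewrite lte_fin.
  by rewrite (addye (x := a%:E))// (gt0_muley h) addye// leey.
have [b bE] : exists b, B = b%:E by case: (B) B0 BN => // r; exists r.
have b0 : 0 <= b by rewrite -lee_fin -bE.
rewrite bE.
have [v vE] : exists v, phi y = v%:E.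
  case: (phi y) (phi0 y) phiy => [v _ _||//]; first by exists v.
  by rewrite gt0_muley ?lte_fin ?mulr_gt0// leye_eq.
rewrite vE -EFinM lee_fin in phiy.
rewrite vE -EFinM -EFinD in Hc.
have M4 : (0 <= (4 * M)%:E)%E by rewrite lee_fin; lra.
apply: (le_trans (leeD2l _ (lee_wpmul2l M4 Hc))).
rewrite -!EFinM -!EFinD lee_fin.
have E1 : 2 * K * e1 = e / 2 by rewrite /e1; field; lra.
have E2 : 4 * M * e2 = e / 2 by rewrite /e2; field; lra.
have : 4 * M * (K * v) <= 2 * K * (a + e1).
  rewrite (_ : 4 * M * (K * v) = 2 * K * (2 * M * v)); last ring.
  by rewrite ler_wpM2l// mulr_ge0// ltW.
have : 0 <= M ^+ 2 * a by rewrite mulr_ge0.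
have : 0 <= K * b by rewrite mulr_ge0// ltW.
nra.
Qed.

End cubes.

(** * Scaling of integrals, calculus of C^1 functions, and exhaustion of the space by cubes *)

Section scaling.
Context {R : realType}.
Local Notation leb := (@lebesgue_rV R).

Lemma ge0_integral_rV_scale d (c : R) (f : 'rV[R]_d -> \bar R) : 0 < c ->
  measurable_fun setT f -> (forall x, 0 <= f x)%E ->
  (\int[leb d]_x f (c *: x) = (c ^- d)%:E * \int[leb d]_x f x)%E.
Proof.
move=> c0; elim: d f => [|d IHd] f mf f0.
  rewrite expr0 invr1 mul1e; apply: eq_integral => x _; congr f.
  by apply/rowP => -[].
have mfc : measurable_fun setT (fun x : 'rV[R]_d.+1 => f (c *: x)).
  apply: (measurableT_comp mf); apply: measurable_fun_rVP => i.
  under eq_fun do rewrite mxE.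
  by apply: measurable_funM => //; exact: measurable_coord.
rewrite tonelli_rV//.
have mF := measurable_tonelli_rV mf f0.
have slice (t : R) : (\int[leb d]_x f (c *: rV_cons (t, x)) =
    (c ^- d)%:E * \int[leb d]_x f (rV_cons ((c * t)%R, x)))%E.
  under eq_integral do rewrite -rV_consZ.
  rewrite (IHd (fun x => f (rV_cons (c * t, x))))//.
  apply: (measurableT_comp mf); apply: measurable_fun_rVP => i.
  have [j ->|->] := unliftP ord0 i.
    by under eq_fun do rewrite rV_consS; exact: measurable_coord.
  by under eq_fun do rewrite rV_cons0; exact: measurable_cst.
under eq_integral do rewrite slice.
have cd0 : 0 <= c ^- d by rewrite invr_ge0 exprn_ge0// ltW.
have F0 t : (0 <= \int[leb d]_x f (rV_cons (t, x)))%E by exact: integral_ge0.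
rewrite ge0_integralZl_EFin//; last first.
  apply: (measurableT_comp mF); exact: mulrl_measurable.
rewrite (ge0_integral_scale c0 mF F0) muleA -EFinM -tonelli_rV//.
by rewrite -invfM exprSr.
Qed.

End scaling.

Section C1_algebra.
Context {R : realType}.

(** [g] is only known to be derivable along [v], so the chain rule is applied to its restriction to
    the line through [x] in that direction. *)
Lemma is_derive_comp_R (V : normedModType R) (f : R -> R) (g : V -> R) (x v : V) a b :
  is_derive (g x) 1 f a -> is_derive x v g b -> is_derive x v (fun y => f (g y)) (a * b).
Proof.
move=> df dg; pose phi (t : R) := g (t *: v + x).
have phi0 : phi 0 = g x by rewrite /phi scale0r add0r.
have dphi : is_derive (0 : R) 1 phi b.
  apply: (is_derive_along _ dg) => h.
  by rewrite /phi addr0 [_ *: 1]mulr1.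
have dfphi : is_derive (0 : R) 1 (f \o phi) (a * b).
  by apply: is_derive1_comp; rewrite phi0.
by apply: (is_derive_along _ dfphi) => h; rewrite /= /phi addr0 [_ *: 1]mulr1.
Qed.

Context (d : nat).
Implicit Types (f g : 'rV[R]_d -> R) (F G : 'I_d -> 'rV[R]_d -> R).

Lemma C1_mul f F g G : C1 f F -> C1 g G ->
  C1 (fun x => f x * g x) (fun i x => f x * G i x + g x * F i x).
Proof.
move=> [cf cF df] [cg cG dg]; split.
- exact: continuous_mulr.
- by move=> i; apply: continuous_addr; apply: continuous_mulr.
- by move=> x i; apply: (is_derive_eq (is_deriveM (df x i) (dg x i))).
Qed.

Lemma C1_scale c f F : C1 f F -> C1 (fun x => c * f x) (fun i x => c * F i x).
Proof.
move=> [cf cF df]; split.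
- exact: continuous_scalel.
- by move=> i; exact: continuous_scalel.
- by move=> x i; apply: (is_derive_eq (is_deriveZ c (df x i))).
Qed.

Lemma C1_subc c f F : C1 f F -> C1 (fun x => f x - c) F.
Proof.
move=> [cf cF df]; split=> //.
- by apply: continuous_addr => //; exact: continuous_cstr.
- move=> x i; apply: (is_derive_eq (is_deriveB (df x i) (is_derive_cst c x _))).
  by rewrite subr0.
Qed.

Lemma C1_expR f F : C1 f F -> C1 (fun x => expR (f x)) (fun i x => expR (f x) * F i x).
Proof.
move=> [cf cF df].
have ce : continuous (fun x => expR (f x)).
  by move=> x; apply: continuous_comp; [exact: cf|exact: continuous_expR].
split=> // [i|x i]; first by apply: continuous_mulr.
exact: (is_derive_comp_R (is_derive_expR (f x)) (df x i)).
Qed.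

End C1_algebra.

Section integral_continuous.
Context {R : realType} (d : nat).
Local Notation leb := (@lebesgue_rV R).
Variable D : set 'rV[R]_d.
Hypothesis mD : measurable D.
Implicit Types f g : 'rV[R]_d -> R.

Lemma le_integral_rV f g : continuous f -> continuous g ->
  (forall x, 0 <= f x) -> (forall x, D x -> f x <= g x) ->
  (\int[leb d]_(x in D) (f x)%:E <= \int[leb d]_(x in D) (g x)%:E)%E.
Proof.
by move=> cf cg f0 fg; apply: ge0_le_integral_EFin => //; exact: measurable_continuous_rV.
Qed.

Lemma integralD_rV f g : continuous f -> continuous g ->
  (forall x, 0 <= f x) -> (forall x, 0 <= g x) ->
  (\int[leb d]_(x in D) (f x + g x)%:E =
   \int[leb d]_(x in D) (f x)%:E + \int[leb d]_(x in D) (g x)%:E)%E.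
Proof.
by move=> cf cg f0 g0; apply: ge0_integralD_EFin => //; exact: measurable_continuous_rV.
Qed.

Lemma integralZ_rV c f : continuous f -> (forall x, 0 <= f x) -> 0 <= c ->
  (\int[leb d]_(x in D) (c * f x)%:E = c%:E * \int[leb d]_(x in D) (f x)%:E)%E.
Proof.
by move=> cf f0 c0; apply: ge0_integralZ_EFin => //; exact: measurable_continuous_rV.
Qed.

Lemma integral_rV_ge0 f : (forall x, 0 <= f x) ->
  (0 <= \int[leb d]_(x in D) (f x)%:E)%E.
Proof. by move=> f0; apply: integral_ge0 => x _; rewrite lee_fin. Qed.

End integral_continuous.

Section cube_exhaustion.
Context {R : realType} (d : nat).
Local Notation leb := (@lebesgue_rV R).
Implicit Types f : 'rV[R]_d -> R.

Lemma cube_dotr M (x : 'rV[R]_d) : cube d M x -> dotr x x <= d%:R * M ^+ 2.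
Proof.
move=> xM; rewrite -[d in leRHS]card_ord -sum1_card natr_sum mulr_suml.
apply: ler_sum => i _; rewrite mul1r -expr2; have := xM i.
rewrite /= in_itv/= -ler_norml => h.
by rewrite -real_normK ?num_real// ler_sqr ?nnegrE// (le_trans _ h).
Qed.

Lemma cubeN_dotr M (x : 'rV[R]_d) : 0 <= M -> ~ cube d M x -> M ^+ 2 <= dotr x x.
Proof.
move=> M0 /existsNP[i]; rewrite /= in_itv/= -ler_norml => /negP; rewrite -ltNge => Mx.
rewrite /dotr (bigD1 i)//= -[leLHS]addr0 lerD//.
  by rewrite -expr2 -(real_normK (num_real (x _ _))) ler_sqr ?nnegrE// ltW.
by apply: sumr_ge0 => j _; rewrite -expr2 sqr_ge0.
Qed.

Lemma integral_cube_lty M f : 0 < M -> continuous f -> (forall x, 0 <= f x) ->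
  (\int[leb d]_(x in cube d M) (f x)%:E < +oo)%E.
Proof.
move=> M0 cf f0.
have [||c _ fc] := @EVT_max_rV R d f (cube d M) _ (@compact_cube R d M).
- by exists 0 => i /=; rewrite mxE in_itv/= oppr_le0 ltW.
- exact: continuous_subspaceT.
apply: (@le_lt_trans _ _ (\int[leb d]_(x in cube d M) (f c)%:E)%E).
  apply: le_integral_rV => //; first exact: measurable_cube.
  - exact: continuous_cstr.
  - by move=> x xM; apply: fc; rewrite inE.
rewrite integral_cst; last exact: measurable_cube.
have E : (leb d (cube d M) = \prod_(i < d) (2 * M)%:E)%E.
  transitivity (\prod_(i < d) @lebesgue_measure R `[(- M)%R, M])%E.
    exact: (@lebesgue_rV_box R d (fun=> `[- M, M]%classic)).
  apply: eq_bigr => i _; rewrite segment_lebesgue_measure; last lra.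
  by congr EFin; ring.
have Eoo : (leb d (cube d M) < +oo)%E by rewrite E prodEFin ltry.
by apply: lte_mul_pinfty => //; rewrite lee_fin.
Qed.

Lemma integral_le_cubes f (c : \bar R) : continuous f -> (forall x, 0 <= f x) ->
  (forall n, \int[leb d]_(x in cube d n.+1%:R) (f x)%:E <= c)%E ->
  (\int[leb d]_x (f x)%:E <= c)%E.
Proof.
move=> cf f0 fc.
have <- : \bigcup_n (cube d n.+1%:R : set 'rV[R]_d) = setT.
  apply/seteqP; split=> // x _.
  (* With k the truncation of |x|^2 plus one, x_i^2 <= |x|^2 < k <= k^2 because k >= 1, so |x_i| <=
     k. *)
  exists (Num.truncn (dotr x x)) => // i /=.
  have xi : x ord0 i ^+ 2 <= dotr x x.
    rewrite /dotr (bigD1 i)//= -expr2 lerDl.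
    by apply: sumr_ge0 => j _; rewrite -expr2 sqr_ge0.
  have := truncnS_gt (dotr x x); set k := _.+1%:R => xk.
  have k1 : 1 <= k by rewrite ler1n.
  by rewrite in_itv/=; apply/andP; split; nra.
have mcube n := @measurable_cube R d n.+1%:R.
have cvgf : (\int[leb d]_(x in cube d n.+1%:R) (f x)%:E @[n --> \oo] -->
    \int[leb d]_(x in \bigcup_n cube d n.+1%:R) (f x)%:E)%E.
  apply: ge0_nondecreasing_set_cvg_integral => //.
  + apply/nondecreasing_seqP => n; apply/subsetPset => x xn i; have := xn i.
    rewrite /= !in_itv/= => /andP[h1 h2].
    have : n.+1%:R <= n.+2%:R :> R by rewrite ler_nat.
    by move=> h; apply/andP; split; lra.
  + by move=> n; exact: measurable_continuous_EFin_rV.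
  + by move=> n x _; rewrite lee_fin.
by apply: cvge_le cvgf; exact: nearW.
Qed.

End cube_exhaustion.

(** * Moment bounds for tame potentials *)

Section tame.
Context {R : realType} (d : nat).
Local Notation leb := (@lebesgue_rV R).
Implicit Types (U s : 'rV[R]_d -> R) (G S : 'I_d -> 'rV[R]_d -> R).

Definition tame K a b U G := [/\ C1 U G,
  forall x, \sum_(i < d) G i x ^+ 2 <= K * (1 + dotr x x),
  forall x, `|U x| <= K * (1 + dotr x x) &
  forall x, a * dotr x x - b <= \sum_(i < d) x ord0 i * G i x].

Lemma dotr_ge0 (x : 'rV[R]_d) : 0 <= dotr x x.
Proof. by apply: sumr_ge0 => i _; rewrite -expr2 sqr_ge0. Qed.

Lemma continuous_dotr : continuous (fun x : 'rV[R]_d => dotr x x).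
Proof.
by apply: continuous_bigsum => i; apply: continuous_mulr; exact: coord_continuous.
Qed.

Variables (K a b : R) (U : 'rV[R]_d -> R) (G : 'I_d -> 'rV[R]_d -> R).
Hypotheses (a0 : 0 < a) (b0 : 0 <= b) (UG : tame K a b U G).

Local Notation p x := (expR (- U x)).

Lemma continuous_tame_density : continuous (fun x => p x).
Proof.
have [[cU _ _] _ _ _] := UG => x.
apply: (@continuous_comp _ _ _ (fun x => - U x) expR); last exact: continuous_expR.
exact: (continuous_oppr cU).
Qed.

Lemma C1_sqr_tame_density s S : C1 s S ->
  C1 (fun x => s x ^+ 2 * p x)
    (fun i x => (2 * s x * S i x - s x ^+ 2 * G i x) * p x).
Proof.
move=> sS; have [UC _ _ _] := UG.
have := C1_mul (C1_mul sS sS) (C1_expR (C1_scale (-1) UC)).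
rewrite (_ : (fun i x => _) = (fun i x => (2 * s x * S i x - s x ^+ 2 * G i x) * p x)).
  by under eq_fun do rewrite mulN1r.
by apply/funext => i; apply/funext => x; rewrite mulN1r; ring.
Qed.

Let cp := continuous_tame_density.
Let p0 x : 0 <= p x. Proof. exact: expR_ge0. Qed.

(** For u = s^2 exp(-U), the term <x, grad u> contains -s^2 <x, grad U> exp(-U), which dissipativity
    bounds by (b - a |x|^2) u. The integral of div(x u) over the cube is nonnegative, so the moment
    is paid for by d u, b u and the cross term 2 s <x, grad s>. *)
Lemma moment_bound_cube s S M : C1 s S -> 0 < M ->
  (\int[leb d]_(x in cube d M) (s x ^+ 2 * dotr x x * p x)%:E <=
   (4 / a ^+ 2)%:E * \int[leb d]_(x in cube d M) ((\sum_(i < d) S i x ^+ 2) * p x)%:E +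
   (2 * (b + d%:R) / a)%:E * \int[leb d]_(x in cube d M) (s x ^+ 2 * p x)%:E)%E.
Proof.
move=> sS M0; have uV := C1_sqr_tame_density sS.
pose u x := s x ^+ 2 * p x.
pose V i x := (2 * s x * S i x - s x ^+ 2 * G i x) * p x.
rewrite -/u in uV; have [cu cV _] := uV.
have [cs cS _] := sS; have [_ _ _ UGd] := UG.
have u0 x : 0 <= u x by rewrite mulr_ge0 ?sqr_ge0.
pose A (x : 'rV[R]_d) := \sum_(i < d) (u x + Num.max 0 (x ord0 i * V i x)).
pose B (x : 'rV[R]_d) := \sum_(i < d) Num.max 0 (- (x ord0 i * V i x)).
have cxV i : continuous (fun x : 'rV[R]_d => x ord0 i * V i x).
  by apply: continuous_mulr; [exact: coord_continuous|exact: cV].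
have cB : continuous B.
  by apply: continuous_bigsum => i; exact: (continuous_max0 (continuous_oppr (cxV i))).
have cA : continuous A.
  apply: continuous_bigsum => i.
  exact: (continuous_addr cu (continuous_max0 (cxV i))).
have B0 x : 0 <= B x by apply: sumr_ge0 => i _; rewrite le_max lexx.
have A0 x : 0 <= A x by apply: sumr_ge0 => i _; rewrite addr_ge0// le_max lexx.
pose X (x : 'rV[R]_d) := s x ^+ 2 * dotr x x * p x.
pose Z (x : 'rV[R]_d) := (\sum_(i < d) S i x ^+ 2) * p x.
have cX : continuous X.
  apply: continuous_mulr => //; apply: continuous_mulr; last exact: continuous_dotr.
  exact: continuous_sqr.
have cZ : continuous Z.
  by apply: continuous_mulr => //; apply: continuous_bigsum => i; exact: continuous_sqr.
have X0 x : 0 <= X x by rewrite mulr_ge0// mulr_ge0 ?sqr_ge0 ?dotr_ge0.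
have Z0 x : 0 <= Z x by rewrite mulr_ge0// sumr_ge0// => i _; exact: sqr_ge0.
have AB x : A x - B x = d%:R * u x + \sum_(i < d) x ord0 i * V i x.
  rewrite /A /B -sumrB mulr_natl -[X in _ *+ X]card_ord -sumr_const -big_split/=.
  apply: eq_bigr => i _; rewrite -addrA; congr (_ + _).
  by have [h|h] := leP 0 (x ord0 i * V i x); [rewrite max_l|rewrite max_r]; lra.
have aN0 : a != 0 by rewrite gt_eqF.
(* [A - B] is div(x u). Young's inequality 2 s x_i S_i <= (2/a) S_i^2 + (a/2) s^2 x_i^2 spends half
   of the a |x|^2 given by dissipativity and leaves a/2 of it for the moment. *)
have young x : a / 2 * X x + A x <= (2 / a * Z x + (b + d%:R) * u x) + B x.
  suff : A x - B x <= 2 / a * Z x + (b + d%:R) * u x - a / 2 * X x by lra.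
  rewrite AB.
  suff : \sum_(i < d) x ord0 i * V i x <= 2 / a * Z x + b * u x - a / 2 * X x by lra.
  have -> : \sum_(i < d) x ord0 i * V i x =
      (\sum_(i < d) 2 * s x * (x ord0 i * S i x) -
       s x ^+ 2 * \sum_(i < d) x ord0 i * G i x) * p x.
    rewrite [X in _ - X]mulr_sumr -sumrB mulr_suml; apply: eq_bigr => i _.
    by rewrite /V; ring.
  have -> : 2 / a * Z x + b * u x - a / 2 * X x =
      (2 / a * (\sum_(i < d) S i x ^+ 2) + a / 2 * (s x ^+ 2 * dotr x x) -
       s x ^+ 2 * (a * dotr x x - b)) * p x.
    by rewrite /Z /u /X; field.
  rewrite ler_wpM2r// lerB//; last by rewrite ler_wpM2l ?sqr_ge0.
  rewrite /dotr !mulr_sumr -big_split/=; apply: ler_sum => i _.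
  have := sqr_ge0 (a * (s x * x ord0 i) - 2 * S i x) => h.
  have -> : 2 / a * S i x ^+ 2 + a / 2 * (s x ^+ 2 * (x ord0 i * x ord0 i)) =
      2 * s x * (x ord0 i * S i x) + (2 * a)^-1 * (a * (s x * x ord0 i) - 2 * S i x) ^+ 2.
    by field.
  by rewrite lerDl mulr_ge0// invr_ge0 mulr_ge0// ltW.
have mQ := @measurable_cube R d M.
have a2 : 0 <= a / 2 by rewrite divr_ge0// ltW.
have va : 0 <= 2 / a by rewrite divr_ge0// ltW.
have bd : 0 <= b + d%:R by rewrite addr_ge0.
suff XZu : (\int[leb d]_(x in cube d M) (X x)%:E <=
   (4 / a ^+ 2)%:E * \int[leb d]_(x in cube d M) (Z x)%:E +
   (2 * (b + d%:R) / a)%:E * \int[leb d]_(x in cube d M) (u x)%:E)%E by exact: XZu.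
have cX2 : continuous (fun x => a / 2 * X x) by exact: continuous_scalel.
have cZ2 : continuous (fun x => 2 / a * Z x) by exact: continuous_scalel.
have cu2 : continuous (fun x => (b + d%:R) * u x) by exact: continuous_scalel.
have X20 x : 0 <= a / 2 * X x by rewrite mulr_ge0.
have Z20 x : 0 <= 2 / a * Z x by rewrite mulr_ge0.
have u20 x : 0 <= (b + d%:R) * u x by rewrite mulr_ge0.
have : (\int[leb d]_(x in cube d M) (a / 2 * X x + A x)%:E <=
    \int[leb d]_(x in cube d M) ((2 / a * Z x + (b + d%:R) * u x) + B x)%:E)%E.
  apply: le_integral_rV => //.
  - exact: continuous_addr.
  - by apply: continuous_addr => //; exact: continuous_addr.
  - by move=> x; rewrite addr_ge0.
rewrite integralD_rV// integralD_rV//; last 2 first.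
- exact: continuous_addr.
- by move=> x; rewrite addr_ge0.
rewrite integralD_rV// !integralZ_rV//.
have BA : (\int[leb d]_(x in cube d M) (B x)%:E <=
    \int[leb d]_(x in cube d M) (A x)%:E)%E := integral_parts_cube uV u0 M0.
(* On the cube all these integrals are finite. Hence the integral of [A] cancels once that of [B] is
   replaced by the larger integral of [A]. *)
move: BA (integral_cube_lty M0 cA A0) (integral_cube_lty M0 cX X0)
  (integral_cube_lty M0 cZ Z0) (integral_cube_lty M0 cu u0)
  (integral_rV_ge0 (cube d M) X0) (integral_rV_ge0 (cube d M) A0)
  (integral_rV_ge0 (cube d M) B0) (integral_rV_ge0 (cube d M) Z0)
  (integral_rV_ge0 (cube d M) u0).
set IX := (\int[leb d]_(x in cube d M) (X x)%:E)%E.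
set IZ := (\int[leb d]_(x in cube d M) (Z x)%:E)%E.
set Iu := (\int[leb d]_(x in cube d M) (u x)%:E)%E.
set IA := (\int[leb d]_(x in cube d M) (A x)%:E)%E.
set IB := (\int[leb d]_(x in cube d M) (B x)%:E)%E.
case: IX => [rX||]//; case: IZ => [rZ||]//; case: Iu => [ru||]//; case: IA => [rA||]//.
case: IB => [rB||]//.
rewrite -!EFinM -!EFinD !lee_fin => BA _ _ _ _ _ _ _ _ _ H.
have {}H : a / 2 * rX <= 2 / a * rZ + (b + d%:R) * ru by lra.
have -> : 4 / a ^+ 2 * rZ + 2 * (b + d%:R) / a * ru =
    2 / a * (2 / a * rZ + (b + d%:R) * ru) by field.
apply: le_trans (ler_wpM2l va H).
have -> : 2 / a * (a / 2 * rX) = rX by field.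
exact: lexx.
Qed.

Lemma moment_bound s S : C1 s S ->
  (\int[leb d]_x (s x ^+ 2 * dotr x x * p x)%:E <=
   (4 / a ^+ 2)%:E * \int[leb d]_x ((\sum_(i < d) S i x ^+ 2) * p x)%:E +
   (2 * (b + d%:R) / a)%:E * \int[leb d]_x (s x ^+ 2 * p x)%:E)%E.
Proof.
move=> sS; have [cs cS _] := sS.
have cu : continuous (fun x => s x ^+ 2 * p x).
  by apply: continuous_mulr => //; exact: continuous_sqr.
have cZ : continuous (fun x => (\sum_(i < d) S i x ^+ 2) * p x).
  by apply: continuous_mulr => //; apply: continuous_bigsum => i; exact: continuous_sqr.
have Z0 x : 0 <= (\sum_(i < d) S i x ^+ 2) * p x.
  by rewrite mulr_ge0// sumr_ge0// => i _; exact: sqr_ge0.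
apply: integral_le_cubes.
- apply: continuous_mulr => //; apply: continuous_mulr; last exact: continuous_dotr.
  exact: continuous_sqr.
- by move=> x; rewrite mulr_ge0// mulr_ge0 ?sqr_ge0 ?dotr_ge0.
- move=> n; apply: (le_trans (moment_bound_cube sS _)); first by rewrite ltr0n.
  apply: leeD; apply: lee_wpmul2l.
  + by rewrite lee_fin divr_ge0 ?sqr_ge0.
  + apply: ge0_subset_integral => //; first exact: measurable_cube.
      exact: measurable_continuous_EFin_rV.
    by move=> x _; rewrite lee_fin.
  + by rewrite lee_fin divr_ge0 ?(ltW a0)// mulr_ge0// addr_ge0.
  + apply: ge0_subset_integral => //; first exact: measurable_cube.
      exact: measurable_continuous_EFin_rV.
    by move=> x _; rewrite lee_fin mulr_ge0 ?sqr_ge0.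
Qed.

End tame.

(** * The log-Sobolev inequality for tame potentials *)

Section poincare_tame_density.
Context {R : realType} (d : nat).
Local Notation leb := (@lebesgue_rV R).

Lemma ge0_lty_EFin (x : \bar R) : (0 <= x)%E -> (x < +oo)%E ->
  exists2 r, 0 <= r & x = r%:E.
Proof. by case: x => [r r0 _||]//; exists r. Qed.

(** On a large cube the density lies between positive constants and the local inequality applies;
    outside, 1 <= |x|^2 / M^2, and the moment bound for f - c returns the energy plus a small
    multiple of the left-hand side, which is absorbed. The constant is fixed before [U] and involves
    neither [B] nor [e]. *)
Lemma poincare_tame (K a b : R) : 0 <= K -> 0 < a -> 0 <= b ->
  exists2 CP : R, 0 < CP & forall (U : 'rV[R]_d -> R) G, tame K a b U G ->
  (\int[leb d]_x (expR (- U x))%:E = 1)%E ->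
  forall f F B e, C1 f F -> (forall x, `|f x| <= B) -> 0 < e ->
  exists c, (\int[leb d]_x ((f x - c) ^+ 2 * expR (- U x))%:E <=
    CP%:E * \int[leb d]_x ((\sum_(i < d) F i x ^+ 2) * expR (- U x))%:E + e%:E)%E.
Proof.
move=> K0 a0 b0.
pose C1c := 4 / a ^+ 2; pose C2 := 2 * (b + d%:R) / a.
have C1c0 : 0 <= C1c by rewrite divr_ge0 ?sqr_ge0.
have C20 : 0 <= C2 by rewrite divr_ge0 ?(ltW a0)// mulr_ge0// addr_ge0.
(* Chosen so that M^2 >= 2 C2: the moment bound divided by M^2 then contains at most half of the
   integral to be estimated. *)
pose M := 1 + 2 * C2.
have M0 : 0 < M by rewrite /M; lra.
have M2 : 2 * C2 <= M ^+ 2 by rewrite /M; nra.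
have M20 : 0 < M ^+ 2 by rewrite exprn_gt0.
have [Kd Kd0 HKd] := @local_poincare R d M M0.
(* On the cube |x|^2 <= d M^2, so the growth bound on [U] puts the density between 1/E and E.
   Passing to Lebesgue measure and back costs E twice. *)
pose E := expR (K * (1 + d%:R * M ^+ 2)).
have E0 : 0 < E by exact: expR_gt0.
have CP0 : 0 < 2 * (E * E * Kd + C1c / M ^+ 2).
  have h1 : 0 < E * E * Kd by rewrite !mulr_gt0.
  have h2 : 0 <= C1c / M ^+ 2 by rewrite divr_ge0// ltW.
  lra.
exists (2 * (E * E * Kd + C1c / M ^+ 2)) => //.
move=> U G UG p1 f F B e fF fB e0.
have cp := continuous_tame_density UG.
have [_ _ UK _] := UG.
have [cf cF _] := fF.
pose p x := expR (- U x).
have p0 x : 0 <= p x by exact: expR_ge0.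
rewrite -/(p _) in cp p1 *.
pose e1 := e / (2 * E).
have e10 : 0 < e1 by rewrite divr_gt0// mulr_gt0.
have [c Hc] := HKd f F e1 fF e10; exists c.
have fcF := C1_subc c fF; have [cfc _ _] := fcF.
pose T x := \sum_(i < d) F i x ^+ 2.
have cT : continuous T by apply: continuous_bigsum => i; exact: continuous_sqr.
have T0 x : 0 <= T x by apply: sumr_ge0 => i _; exact: sqr_ge0.
pose w x := (f x - c) ^+ 2 * p x.
pose X x := (f x - c) ^+ 2 * dotr x x * p x.
have cfc2 : continuous (fun x => (f x - c) ^+ 2) by exact: continuous_sqr.
have cw : continuous w by exact: continuous_mulr.
have cX : continuous X.
  by apply: continuous_mulr => //; apply: continuous_mulr => //; exact: continuous_dotr.
have w0 x : 0 <= w x by rewrite mulr_ge0// sqr_ge0.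
have X0 x : 0 <= X x by rewrite mulr_ge0// mulr_ge0 ?sqr_ge0 ?dotr_ge0.
have cTp : continuous (fun x => T x * p x) by exact: continuous_mulr.
have Tp0 x : 0 <= T x * p x by exact: mulr_ge0.
suff : (\int[leb d]_x (w x)%:E <= (2 * (E * E * Kd + C1c / M ^+ 2))%:E *
  \int[leb d]_x (T x * p x)%:E + e%:E)%E by [].
set IZ := (\int[leb d]_x (T x * p x)%:E)%E.
have IZ0 : (0 <= IZ)%E by exact: integral_rV_ge0.
have [->|IZN] := eqVneq IZ +oo%E.
  by rewrite gt0_muley ?lte_fin// addye// leey.
have [z z0 zE] : exists2 z, 0 <= z & IZ = z%:E.
  by apply: ge0_lty_EFin => //; rewrite ltey.
(* The boundedness of [f] makes the left-hand side finite, so that half of it can be absorbed at the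
   end. *)
have [y y0 yE] : exists2 y, 0 <= y & (\int[leb d]_x (w x)%:E = y%:E)%E.
  apply: ge0_lty_EFin; first exact: integral_rV_ge0.
  apply: (@le_lt_trans _ _ (\int[leb d]_x ((B + `|c|) ^+ 2 * p x)%:E)%E).
    apply: le_integral_rV => //; first exact: continuous_scalel.
    move=> x _; rewrite ler_wpM2r// -real_normK ?num_real// ler_sqr ?nnegrE//.
      by rewrite (le_trans (ler_normB _ _))// lerD2r.
    by rewrite addr_ge0// (le_trans _ (fB x)).
  by rewrite integralZ_rV ?sqr_ge0// p1 mule1 ltry.
have mQ := @measurable_cube R d M.
have pE x : cube d M x -> p x <= E /\ 1 <= E * p x.
  move=> /cube_dotr xM; have := UK x; rewrite ler_norml => /andP[U1 U2].
  have KM : K * (1 + dotr x x) <= K * (1 + d%:R * M ^+ 2).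
    by rewrite ler_wpM2l// lerD2l.
  split; first by rewrite ler_expR; lra.
  rewrite -expRD -[leLHS]expR0 ler_expR; lra.
have q1 : (\int[leb d]_(x in cube d M) (w x)%:E <= (E * (Kd * (E * z) + e1))%:E)%E.
  apply: (@le_trans _ _ (\int[leb d]_(x in cube d M) (E * (f x - c) ^+ 2)%:E)%E).
    apply: le_integral_rV => //; first exact: continuous_scalel.
    by move=> x /pE[pxE _]; rewrite /w mulrC ler_wpM2r ?sqr_ge0.
  rewrite integralZ_rV ?(ltW E0)//; last by move=> x; exact: sqr_ge0.
  rewrite EFinM lee_wpmul2l ?lee_fin ?(ltW E0)//.
  apply: (le_trans Hc); rewrite EFinD leeD2r// EFinM lee_wpmul2l ?lee_fin ?(ltW Kd0)//.
  apply: (@le_trans _ _ (\int[leb d]_(x in cube d M) (E * (T x * p x))%:E)%E).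
    apply: le_integral_rV => //; first exact: continuous_scalel.
    by move=> x /pE[_ Ep]; rewrite mulrCA -[leLHS]mulr1 ler_wpM2l//; exact: T0.
  rewrite integralZ_rV ?(ltW E0)// EFinM lee_wpmul2l ?lee_fin ?(ltW E0)// -zE.
  apply: ge0_subset_integral => //; first exact: measurable_continuous_EFin_rV.
  by move=> x _; rewrite lee_fin.
have q2 : (\int[leb d]_x (X x)%:E <= (C1c * z + C2 * y)%:E)%E.
  have := moment_bound a0 b0 UG fcF.
  by rewrite -/(p _) -[X in (_ <= X)%E -> _]/(C1c%:E * IZ + C2%:E * \int[leb d]_x (w x)%:E)%E
    yE zE -!EFinM -EFinD.
(* Integrated form of the pointwise bound of w by its restriction to the cube plus X / M^2. *)
have q3 : (y%:E <= (E * (Kd * (E * z) + e1))%:E + (M ^- 2)%:E * (C1c * z + C2 * y)%:E)%E.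
  have vM : 0 <= M ^- 2 by rewrite invr_ge0 ltW.
  apply: (@le_trans _ _ (\int[leb d]_(x in cube d M) (w x)%:E +
      (M ^- 2)%:E * \int[leb d]_x (X x)%:E)%E); last first.
    by apply: leeD => //; rewrite lee_wpmul2l ?lee_fin.
  rewrite -yE -integralZ_rV// [X in (_ <= X + _)%E]integral_mkcond.
  have mwQ : measurable_fun setT ((EFin \o w) \_ (cube d M)).
    apply/(measurable_restrictT _ mQ); exact: measurable_continuous_EFin_rV.
  have wQ0 x : (0 <= ((EFin \o w) \_ (cube d M)) x)%E.
    by apply: erestrict_ge0 => {}x _; rewrite lee_fin.
  have cMX : continuous (fun x => M ^- 2 * X x) by exact: continuous_scalel.
  have MX0 x : (0 <= (M ^- 2 * X x)%:E)%E by rewrite lee_fin mulr_ge0.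
  have mMX : measurable_fun setT (fun x => (M ^- 2 * X x)%:E).
    exact: measurable_continuous_EFin_rV.
  rewrite -ge0_integralD//.
  apply: ge0_le_integral => //.
  - by move=> x _; rewrite lee_fin.
  - exact: measurable_continuous_EFin_rV.
  - exact: emeasurable_funD.
  - move=> x _; rewrite patchE; case: ifPn => [_|].
      by rewrite leeDl.
    rewrite notin_setE => /(cubeN_dotr (ltW M0)) Mx.
    rewrite add0e lee_fin.
    have -> : M ^- 2 * X x = w x * (dotr x x / M ^+ 2) by rewrite /X /w; ring.
    by rewrite -[leLHS]mulr1 ler_wpM2l// ler_pdivlMr// mul1r.
have {}q3 : y <= E * (Kd * (E * z) + e1) + M ^- 2 * (C1c * z + C2 * y).
  by rewrite -lee_fin EFinD [X in (_ <= _ + X)%E]EFinM.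
rewrite yE zE -EFinM -EFinD lee_fin.
have h1 : E * e1 = e / 2 by rewrite /e1; field; rewrite gt_eqF.
have h2 : M ^- 2 * (C2 * y) <= y / 2.
  rewrite mulrA [X in _ <= X]mulrC ler_wpM2r// mulrC ler_pdivrMr//; lra.
have h3 : M ^- 2 * (C1c * z) = C1c / M ^+ 2 * z by ring.
nra.
Qed.

(** For f^2 of integral 1 against a probability, adding 1 - f^2 to the integrand does not change the
    entropy but makes the integrand nonnegative. The case t = 0 relies on the factor t^2 in front of
    the logarithm. *)
Lemma entropy_pointwise_ge0 (t : R) : 0 <= t ^+ 2 * ln (t ^+ 2) - t ^+ 2 + 1.
Proof.
have [->|t0] := eqVneq t 0; first by rewrite expr0n/= mul0r subr0 add0r ler01.
set x := t ^+ 2; have x0 : 0 < x by rewrite exprn_even_gt0.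
have : ln x^-1 <= x^-1 - 1.
  have := @le_ln1Dx R (x^-1 - 1); rewrite (addrC 1) subrK; apply.
  by rewrite ltrBrDr addNr invr_gt0.
rewrite lnV ?posrE// => h.
have : x * - ln x <= x * (x^-1 - 1) by rewrite ler_wpM2l// ltW.
rewrite mulrBr mulfV ?gt_eqF// mulr1 mulrN; lra.
Qed.

(** The left-hand side has a double zero at t = s, since s is 1 or -1; away from s it grows like t^2
    ln t^2, and there t^2 <= 4 (t - s)^2. *)
Lemma entropy_pointwise_le (t s : R) : s ^+ 2 = 1 ->
  t ^+ 2 * ln (t ^+ 2) - t ^+ 2 + 1 <=
  9 * (t - s) ^+ 2 + 4 * ((t - s) ^+ 2 * lnp (4 * (t - s) ^+ 2)).
Proof.
move=> s1; set v := (t - s) ^+ 2.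
have v0 : 0 <= v by exact: sqr_ge0.
have l0 : 0 <= lnp (4 * v) by exact: lnp_ge0.
have vl0 : 0 <= v * lnp (4 * v) by exact: mulr_ge0.
have t4 : t ^+ 2 <= 2 * v + 2.
  have := sqr_ge0 (t - s - s); rewrite /v; nra.
(* Near s: ln x <= x - 1 at x = t^2 bounds the expression by (t^2 - 1)^2 = (t - s)^2 (t + s)^2, and
   |t + s| <= 3 gives the 9. Far from s: t^2 <= 2v + 2 <= 4v, and 1 - t^2 is covered by 9v. *)
have [v1|v1] := leP v 1.
  have [te|t0] := eqVneq t 0.
    have vE : v = 1 by rewrite /v te sub0r sqrrN.
    rewrite te expr0n/= mul0r; lra.
  have x0 : 0 < t ^+ 2 by rewrite exprn_even_gt0.
  have : ln (t ^+ 2) <= t ^+ 2 - 1.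
    have := @le_ln1Dx R (t ^+ 2 - 1); rewrite (addrC 1) subrK; apply; lra.
  move=> /(ler_wpM2l (ltW x0)) h.
  suff : (t ^+ 2 - 1) ^+ 2 <= 9 * v by nra.
  have -> : t ^+ 2 - 1 = (t - s) * (t + s) by rewrite -s1; ring.
  rewrite exprMn -/v.
  rewrite mulrC ler_wpM2r//.
  have : (t + s) ^+ 2 = (t - s) ^+ 2 + 4 * (s * (t - s)) + 4 * s ^+ 2 by ring.
  rewrite -/v s1 => ->.
  have : s * (t - s) <= 1.
    have := sqr_ge0 (s - (t - s)); rewrite /v in v1; nra.
  lra.
have : t ^+ 2 * ln (t ^+ 2) <= 4 * (v * lnp (4 * v)).
  have [x1|x1] := leP (t ^+ 2) 1.
    have : ln (t ^+ 2) <= 0 by exact: ln_le0.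
    have := sqr_ge0 t; nra.
  have x0 : 0 < t ^+ 2 by lra.
  rewrite mulrA; apply: ler_pM; rewrite ?(ltW x0) ?ln_ge0 ?(ltW x1)//; first lra.
  apply: (le_trans (ln_le_lnp x0)); apply: le_lnp; lra.
have := sqr_ge0 t; lra.
Qed.

End poincare_tame_density.

Lemma measurable_ln_comp {R : realType} {d} {T : measurableType d} (f : T -> R) :
  measurable_fun setT f -> measurable_fun setT (fun x => ln (f x)).
Proof. exact: (measurableT_comp (@measurable_ln R)). Qed.

Section entropy_tame_density.
Context {R : realType} (d : nat).
Local Notation leb := (@lebesgue_rV R).

(** The Euclidean inequality is applied to g = s exp(-U/2), whose square is s^2 exp(-U). Its energy
    contains s^2 |grad U|^2 exp(-U), and returning from g^2 to s^2 inside the logarithm adds U; both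
    grow at most like K (1 + |x|^2), which is why the second moment appears. *)
Lemma log_moment_bound (K a b n : R) (U s : 'rV[R]_d -> R) G S :
  0 <= K -> tame K a b U G -> C1 s S -> n <= 4 ->
  (\int[leb d]_x (s x ^+ 2 * expR (- U x))%:E = n%:E)%E ->
  (\int[leb d]_x (s x ^+ 2 * lnp (4 * s x ^+ 2) * expR (- U x))%:E <=
   2%:E * \int[leb d]_x ((\sum_(i < d) S i x ^+ 2) * expR (- U x))%:E +
   (2 * K)%:E * \int[leb d]_x (s x ^+ 2 * dotr x x * expR (- U x))%:E +
   ((2 * K + d%:R + 16) * n)%:E)%E.
Proof.
move=> K0 UG sS n4 sn.
have cp := continuous_tame_density UG.
have [UC UG2 UK _] := UG; have [cU cG _] := UC; have [cs cS _] := sS.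
pose p x := expR (- U x).
have pp x : 0 < p x by exact: expR_gt0.
have p0 x : 0 <= p x by exact: expR_ge0.
rewrite -/(p _) in cp sn *.
have cs2 : continuous (fun x => s x ^+ 2) by exact: continuous_sqr.
have s20 x : 0 <= s x ^+ 2 by exact: sqr_ge0.
have cln : continuous (fun x => lnp (4 * s x ^+ 2)).
  have := continuous_lnp_div 1 (continuous_scalel (c := 4) cs2).
  by under eq_fun do rewrite divr1.
pose X x := s x ^+ 2 * dotr x x * p x.
pose T x := \sum_(i < d) S i x ^+ 2.
pose w x := s x ^+ 2 * p x.
have cT : continuous T by apply: continuous_bigsum => i; exact: continuous_sqr.
have T0 x : 0 <= T x by apply: sumr_ge0 => i _; exact: sqr_ge0.
have cX : continuous X.
  by apply: continuous_mulr => //; apply: continuous_mulr => //; exact: continuous_dotr.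
have cw : continuous w by exact: continuous_mulr.
have w0 x : 0 <= w x by exact: mulr_ge0.
have X0 x : 0 <= X x by rewrite mulr_ge0// mulr_ge0 ?dotr_ge0.
have cTp : continuous (fun x => T x * p x) by exact: continuous_mulr.
have Tp0 x : 0 <= T x * p x by exact: mulr_ge0.
have n0 : 0 <= n by rewrite -lee_fin -sn; exact: integral_rV_ge0.
have IT0 : (0 <= \int[leb d]_x (T x * p x)%:E)%E by exact: integral_rV_ge0.
have IX0 : (0 <= \int[leb d]_x (X x)%:E)%E by exact: integral_rV_ge0.
have K20 : 0 <= 2 * K by rewrite mulr_ge0.
have cn0 : 0 <= (2 * K + d%:R + 16) * n by rewrite mulr_ge0// !addr_ge0.
(* For n = 0 the quotient g^2 / n is meaningless, but s^2 exp(-U) vanishes almost everywhere. *)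
have [nE|nN0] := eqVneq n 0.
  have -> : (\int[leb d]_x (s x ^+ 2 * lnp (4 * s x ^+ 2) * p x)%:E =
      \int[leb d]_x (w x * lnp (4 * s x ^+ 2))%:E)%E.
    by apply: eq_integral => x _; rewrite /w mulrAC.
  rewrite ge0_integralM_eq0//.
  - by rewrite !adde_ge0// ?mule_ge0// lee_fin.
  - exact: measurable_continuous_rV.
  - exact: measurable_continuous_rV.
  - by move=> x _; exact: lnp_ge0.
  - exact: etrans sn (congr1 EFin nE).
have np : 0 < n by rewrite lt_neqAle eq_sym nN0.
pose g x := s x * expR (- 2^-1 * U x).
pose Gg i x := s x * (expR (- 2^-1 * U x) * (- 2^-1 * G i x)) + expR (- 2^-1 * U x) * S i x.
have gG : C1 g Gg := C1_mul sS (C1_expR (C1_scale (- 2^-1) UC)).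
have e2 x : expR (- 2^-1 * U x) ^+ 2 = p x.
  by rewrite -expRM_natl /p; congr expR; field.
have g2 x : g x ^+ 2 = w x by rewrite /g exprMn e2.
have Igw : (\int[leb d]_x (g x ^+ 2)%:E = n%:E)%E.
  by rewrite -sn; apply: eq_integral => x _; rewrite g2.
have cg2 : continuous (fun x => g x ^+ 2) by apply: continuous_sqr; case: gG.
have cgl : continuous (fun x => g x ^+ 2 * lnp (g x ^+ 2 / n)).
  exact: (continuous_mulr cg2 (continuous_lnp_div n cg2)).
have := euclidean_log_sobolev gG Igw.
have gl0 x : 0 <= g x ^+ 2 * lnp (g x ^+ 2 / n) by rewrite mulr_ge0 ?sqr_ge0 ?lnp_ge0.
have grad_g x : \sum_(i < d) Gg i x ^+ 2 <= 2 * (T x * p x) + (K / 2 * X x + K / 2 * w x).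
  apply: (@le_trans _ _ ((2 * T x + 2^-1 * s x ^+ 2 * \sum_(i < d) G i x ^+ 2) * p x)).
    rewrite mulrDl mulr_sumr mulr_sumr -mulrDl -big_split/= mulr_suml.
    apply: ler_sum => i _; rewrite -(e2 x).
    have -> : Gg i x ^+ 2 = expR (- 2^-1 * U x) ^+ 2 * (S i x - 2^-1 * s x * G i x) ^+ 2.
      by rewrite /Gg; ring.
    rewrite mulrC ler_wpM2r ?sqr_ge0//.
    have := sqr_ge0 (S i x + 2^-1 * s x * G i x); nra.
  have := ler_wpM2l (s20 x) (UG2 x) => h.
  have -> : 2 * (T x * p x) + (K / 2 * X x + K / 2 * w x) =
      (2 * T x + 2^-1 * (s x ^+ 2 * (K * (1 + dotr x x)))) * p x.
    by rewrite /X /w; field.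
  rewrite ler_wpM2r// lerD2l -mulrA ler_wpM2l//.
set I1 := (\int[leb d]_x (\sum_(i < d) Gg i x ^+ 2)%:E)%E => ELS.
have K02 : 0 <= K / 2 by rewrite divr_ge0.
have wn : (\int[leb d]_x (w x)%:E = n%:E)%E := sn.
have hI1 : (I1 <= 2%:E * \int[leb d]_x (T x * p x)%:E +
    ((K / 2)%:E * \int[leb d]_x (X x)%:E + (K / 2 * n)%:E))%E.
  have c1 : continuous (fun x => 2 * (T x * p x)) by exact: continuous_scalel.
  have c2 : continuous (fun x => K / 2 * X x) by exact: continuous_scalel.
  have c3 : continuous (fun x => K / 2 * w x) by exact: continuous_scalel.
  have c23 : continuous (fun x => K / 2 * X x + K / 2 * w x) by exact: continuous_addr.
  have h1 x : 0 <= 2 * (T x * p x) by rewrite mulr_ge0.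
  have h2 x : 0 <= K / 2 * X x by rewrite mulr_ge0.
  have h3 x : 0 <= K / 2 * w x by rewrite mulr_ge0.
  have h23 x : 0 <= K / 2 * X x + K / 2 * w x by rewrite addr_ge0.
  rewrite [(K / 2 * n)%:E]EFinM -wn -!integralZ_rV//
    -(integralD_rV measurableT c2 c3 h2 h3) -(integralD_rV measurableT c1 c23 h1 h23).
  apply: le_integral_rV => //.
  - apply: continuous_bigsum => i; apply: continuous_sqr; by case: gG.
  - exact: continuous_addr.
  - by move=> x; apply: sumr_ge0 => i _; exact: sqr_ge0.
(* From 4 s^2 = (g^2 / n) (4n) exp(U) and subadditivity of [lnp] on products; since n <= 4, the
   middle factor contributes at most 16. *)
have ptw x : s x ^+ 2 * lnp (4 * s x ^+ 2) * p x <=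
    g x ^+ 2 * lnp (g x ^+ 2 / n) + (K * X x + (K + 16) * w x).
  have l1 : lnp (4 * s x ^+ 2) <= lnp (g x ^+ 2 / n) + lnp (4 * n) + `|U x|.
    have -> : 4 * s x ^+ 2 = g x ^+ 2 / n * (4 * n) * expR (U x).
      rewrite g2 /w /p expRN; field; rewrite nN0/= gt_eqF//; exact: expR_gt0.
    apply: (le_trans (lnpM _ (expR_ge0 _))); apply: lerD.
      by apply: lnpM; rewrite mulr_ge0.
    rewrite -[leRHS]lnp_expR ?normr_ge0//; apply: le_lnp.
    by rewrite ler_expR ler_norm.
  have l2 : lnp (4 * n) <= 16.
    by apply: (le_trans (lnp_le _)); [rewrite mulr_ge0|lra].
  have l3 : lnp (4 * s x ^+ 2) <= lnp (g x ^+ 2 / n) + (K * dotr x x + (K + 16)).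
    have := UK x; lra.
  rewrite mulrAC -/(w x); apply: (le_trans (ler_wpM2l (w0 x) l3)).
  rewrite mulrDr -g2 lerD2l g2.
  have -> : K * X x + (K + 16) * w x = w x * (K * dotr x x + (K + 16)).
    by rewrite /X /w; ring.
  exact: lexx.
have K16 : 0 <= K + 16 by rewrite addr_ge0.
have hA : (\int[leb d]_x (s x ^+ 2 * lnp (4 * s x ^+ 2) * p x)%:E <=
  \int[leb d]_x (g x ^+ 2 * lnp (g x ^+ 2 / n))%:E +
  (K%:E * \int[leb d]_x (X x)%:E + ((K + 16) * n)%:E))%E.
  have c2 : continuous (fun x => K * X x) by exact: continuous_scalel.
  have c3 : continuous (fun x => (K + 16) * w x) by exact: continuous_scalel.
  have c23 : continuous (fun x => K * X x + (K + 16) * w x) by exact: continuous_addr.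
  have h2 x : 0 <= K * X x by rewrite mulr_ge0.
  have h3 x : 0 <= (K + 16) * w x by rewrite mulr_ge0.
  have h23 x : 0 <= K * X x + (K + 16) * w x by rewrite addr_ge0.
  rewrite [((K + 16) * n)%:E]EFinM -wn -!integralZ_rV//
    -(integralD_rV measurableT c2 c3 h2 h3) -(integralD_rV measurableT cgl c23 gl0 h23).
  apply: le_integral_rV => //.
  - by apply: continuous_mulr => //; exact: continuous_mulr.
  - exact: continuous_addr.
  - by move=> x; rewrite mulr_ge0// mulr_ge0// lnp_ge0.
apply: (le_trans hA); apply: (le_trans (leeD2r _ (le_trans ELS (leeD2r _ hI1)))).
rewrite -/(X _) -/(T _).
set IT := (\int[leb d]_x (T x * p x)%:E)%E in IT0 *.
set IX := (\int[leb d]_x (X x)%:E)%E in IX0 *.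
have ooD (u : \bar R) : (0 <= u -> +oo + u = +oo)%E by case: u.
have [->|ITN] := eqVneq IT +oo%E.
  rewrite -[X in (_ <= X)%E]addeA [X in (_ <= X + _)%E]gt0_muley ?lte_fin//.
  by rewrite ooD ?leey// adde_ge0// mule_ge0.
have [t t0 ->] : exists2 t, 0 <= t & IT = t%:E.
  by apply: ge0_lty_EFin => //; rewrite ltey.
(* For K = 0 the moment, possibly infinite, has coefficient 0 and its product is 0 by convention.
   For K > 0 an infinite moment makes the bound trivial. *)
have [KE|KN] := eqVneq K 0.
  rewrite KE !mul0r !mulr0 !mul0e !add0e !add0r -!EFinM -!EFinD lee_fin; nra.
have [->|IXN] := eqVneq IX +oo%E.
  have Kp : 0 < K by rewrite lt_neqAle eq_sym KN.
  rewrite [X in (_ <= _ + X + _)%E]gt0_muley ?lte_fin ?mulr_gt0//.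
  by rewrite -[(2 * t%:E)%E]EFinM [X in (_ <= X + _)%E]addeC !ooD ?leey ?lee_fin// mulr_ge0.
have [x x0 ->] : exists2 x, 0 <= x & IX = x%:E.
  by apply: ge0_lty_EFin => //; rewrite ltey.
rewrite -!EFinM -!EFinD lee_fin.
have := mulr_ge0 K0 x0; have := mulr_ge0 K0 n0; nra.
Qed.

(** With c from the Poincare inequality and s = f - sign(c), the integral n of s^2 is at most four
    times that of (f - c)^2. The pointwise entropy bound, the log-moment bound and the moment bound
    then reduce everything to the energy and a multiple of n. *)
Lemma log_sobolev_tame (K a b : R) : 0 <= K -> 0 < a -> 0 <= b ->
  exists2 C : R, 0 < C & forall (U : 'rV[R]_d -> R) G, tame K a b U G ->
  (\int[leb d]_x (expR (- U x))%:E = 1)%E ->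
  forall f F B, C1 f F -> (forall x, `|f x| <= B) ->
  (\int[leb d]_x (f x ^+ 2 * expR (- U x))%:E = 1)%E ->
  (\int[leb d]_x ((f x ^+ 2 * ln (f x ^+ 2) - f x ^+ 2 + 1) * expR (- U x))%:E <=
   C%:E * \int[leb d]_x ((\sum_(i < d) F i x ^+ 2) * expR (- U x))%:E)%E.
Proof.
move=> K0 a0 b0; have [CP CP0 HP] := poincare_tame d K0 a0 b0.
pose C1c := 4 / a ^+ 2; pose C2 := 2 * (b + d%:R) / a.
have C1c0 : 0 <= C1c by rewrite divr_ge0 ?sqr_ge0.
have C20 : 0 <= C2 by rewrite divr_ge0 ?(ltW a0)// mulr_ge0// addr_ge0.
(* Total coefficient of n: 9 from the pointwise bound, and 4 times the coefficients in the
   log-moment bound, including 2K times the share C2 of the moment bound. In [C] below, n is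
   replaced by 4 (CP z + e1), while 8 and 8 K C1c are the direct energy terms. *)
pose beta := 9 + 4 * (2 * K * C2 + 2 * K + d%:R + 16).
have beta0 : 0 < beta.
  have := mulr_ge0 K0 C20; have : 0 <= d%:R :> R by []; rewrite /beta; nra.
pose C := 4 * beta * CP + 8 + 8 * K * C1c.
have C0 : 0 < C.
  have := mulr_ge0 K0 C1c0; have := mulr_gt0 beta0 CP0; rewrite /C; nra.
exists C => // U G UG p1 f F B fF fB f1.
have cp := continuous_tame_density UG.
have [cf cF _] := fF.
pose p x := expR (- U x).
have p0 x : 0 <= p x by exact: expR_ge0.
rewrite -/(p _) in cp p1 f1 *.
pose T x := \sum_(i < d) F i x ^+ 2.
have cT : continuous T by apply: continuous_bigsum => i; exact: continuous_sqr.
have T0 x : 0 <= T x by apply: sumr_ge0 => i _; exact: sqr_ge0.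
have IT0 : (0 <= \int[leb d]_x (T x * p x)%:E)%E.
  by apply: integral_rV_ge0 => x; exact: mulr_ge0.
rewrite -[X in (_ <= _ * X)%E]/(\int[leb d]_x (T x * p x)%:E)%E.
set IT := (\int[leb d]_x (T x * p x)%:E)%E in IT0 *.
have [->|ITN] := eqVneq IT +oo%E; first by rewrite gt0_muley// leey.
have [z z0 zE] : exists2 z, 0 <= z & IT = z%:E.
  by apply: ge0_lty_EFin => //; rewrite ltey.
(* The Poincare inequality has an additive error. Its constant does not depend on that error, so the
   error may be sent to 0; [e1] is scaled so that 4 beta e1 = e. *)
rewrite zE -EFinM; apply/lee_addgt0Pr => e e0.
pose e1 := e / (4 * beta).
have e10 : 0 < e1 by rewrite divr_gt0// mulr_gt0.
have [c] := HP U G UG p1 f F B e1 fF fB e10.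
rewrite -/(p _) -[X in (_ <= _ * X + _)%E -> _]/IT zE -EFinM -EFinD => Yc.
pose w x := (f x - c) ^+ 2 * p x.
have [cfc _ _] := C1_subc c fF.
have cw : continuous w by apply: continuous_mulr => //; exact: continuous_sqr.
have w0 x : 0 <= w x by rewrite mulr_ge0 ?sqr_ge0.
have [y y0 yE] : exists2 y, 0 <= y & (\int[leb d]_x (w x)%:E = y%:E)%E.
  by apply: ge0_lty_EFin; [exact: integral_rV_ge0|exact: (le_lt_trans Yc (ltry _))].
have {Yc} yz : y <= CP * z + e1 by rewrite -lee_fin -yE.
(* The sign of c, with value 1 at c = 0 so that its square is always 1. *)
pose sg : R := if 0 <= c then 1 else -1.
have sg1 : sg ^+ 2 = 1 by rewrite /sg; case: ifP => _; rewrite ?sqrrN expr1n.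
have csg : c = `|c| * sg.
  rewrite /sg; case: leP => [h|h]; first by rewrite mulr1 ger0_norm.
  by rewrite ltr0_norm// mulrN1 opprK.
pose s x := f x - sg.
have sF : C1 s F := C1_subc sg fF; have [cs _ _] := sF.
have cs2 : continuous (fun x => s x ^+ 2) by exact: continuous_sqr.
pose v x := s x ^+ 2 * p x.
have cv : continuous v by exact: continuous_mulr.
have v0 x : 0 <= v x by rewrite mulr_ge0 ?sqr_ge0.
pose h x := f x ^+ 2 * p x.
have ch : continuous h by apply: continuous_mulr => //; exact: continuous_sqr.
have h0 x : 0 <= h x by rewrite mulr_ge0 ?sqr_ge0.
have {}f1 : (\int[leb d]_x (h x)%:E = 1)%E := f1.
have {}p1 : (\int[leb d]_x (p x)%:E = 1)%E := p1.
(* Reverse triangle inequality in L^2: integrating 2 c f <= |c| (f^2 + 1) gives 1 + c^2 <= y + 2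
   |c|. *)
have c1y : (`|c| - 1) ^+ 2 <= y.
  have : (\int[leb d]_x (h x + c ^+ 2 * p x)%:E <=
      \int[leb d]_x (w x + (`|c| * h x + `|c| * p x))%:E)%E.
    apply: le_integral_rV => //.
    - by apply: continuous_addr => //; exact: continuous_scalel.
    - apply: continuous_addr => //.
      by apply: continuous_addr; exact: continuous_scalel.
    - by move=> x; rewrite addr_ge0// mulr_ge0// sqr_ge0.
    - move=> x _; rewrite -subr_ge0.
      have -> : w x + (`|c| * h x + `|c| * p x) - (h x + c ^+ 2 * p x) =
          `|c| * (f x ^+ 2 + sg ^+ 2) * p x - 2 * c * f x * p x.
        by rewrite sg1 /w /h; ring.
      rewrite [in X in _ - X]csg -mulrBl.
      have -> : `|c| * (f x ^+ 2 + sg ^+ 2) - 2 * (`|c| * sg) * f x =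
          `|c| * (f x - sg) ^+ 2 by ring.
      by rewrite mulr_ge0// mulr_ge0// sqr_ge0.
  have cch : continuous (fun x => `|c| * h x) by exact: continuous_scalel.
  have ccp : continuous (fun x => `|c| * p x) by exact: continuous_scalel.
  have cc2 : continuous (fun x => c ^+ 2 * p x) by exact: continuous_scalel.
  have cch0 x : 0 <= `|c| * h x by rewrite mulr_ge0.
  have ccp0 x : 0 <= `|c| * p x by rewrite mulr_ge0.
  have cc20 x : 0 <= c ^+ 2 * p x by rewrite mulr_ge0// sqr_ge0.
  have ccs : continuous (fun x => `|c| * h x + `|c| * p x) by exact: continuous_addr.
  have ccs0 x : 0 <= `|c| * h x + `|c| * p x by rewrite addr_ge0.
  rewrite (integralD_rV measurableT ch cc2 h0 cc20) (integralD_rV measurableT cw ccs w0 ccs0)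
    (integralD_rV measurableT cch ccp cch0 ccp0).
  rewrite !integralZ_rV ?sqr_ge0// f1 p1 yE !mule1 -!EFinD lee_fin => q.
  have := real_normK (num_real c); nra.
have [n n0 nE] : exists2 n, 0 <= n & (\int[leb d]_x (v x)%:E = n%:E)%E.
  apply: ge0_lty_EFin; first exact: integral_rV_ge0.
  apply: (@le_lt_trans _ _ (\int[leb d]_x (2 * h x + 2 * p x)%:E)%E).
    apply: le_integral_rV => //; first by apply: continuous_addr; exact: continuous_scalel.
    move=> x _; rewrite /h mulrA -mulrDl ler_wpM2r//.
    have := sqr_ge0 (f x + sg); rewrite /s; nra.
  rewrite integralD_rV ?integralZ_rV//.
  - by rewrite f1 p1 !mule1 -EFinD ltry.
  - exact: continuous_scalel.
  - exact: continuous_scalel.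
  - by move=> x; rewrite mulr_ge0.
  - by move=> x; rewrite mulr_ge0.
(* From s^2 <= 2 f^2 + 2 and total mass 1; the log-moment bound requires it. *)
have n4 : n <= 4.
  rewrite -lee_fin -nE.
  apply: (@le_trans _ _ (\int[leb d]_x (2 * h x + 2 * p x)%:E)%E).
    apply: le_integral_rV => //; first by apply: continuous_addr; exact: continuous_scalel.
    move=> x _; rewrite /h mulrA -mulrDl ler_wpM2r//.
    have := sqr_ge0 (f x + sg); rewrite /s; nra.
  rewrite integralD_rV ?integralZ_rV//.
  - by rewrite f1 p1 !mule1 -EFinD lee_fin; lra.
  - exact: continuous_scalel.
  - exact: continuous_scalel.
  - by move=> x; rewrite mulr_ge0.
  - by move=> x; rewrite mulr_ge0.
(* From s^2 <= 2 (f - c)^2 + 2 (c - sg)^2, where |c - sg| = | |c| - 1 | has square at most y. *)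
have n4y : n <= 4 * y.
  have c2 : 0 <= 2 * (c - sg) ^+ 2 by rewrite mulr_ge0// sqr_ge0.
  have : (\int[leb d]_x (v x)%:E <= \int[leb d]_x (2 * w x + 2 * (c - sg) ^+ 2 * p x)%:E)%E.
    apply: le_integral_rV => //; first by apply: continuous_addr; exact: continuous_scalel.
    move=> x _; rewrite /v /w mulrA -mulrDl ler_wpM2r//.
    have := sqr_ge0 (f x - c - (c - sg)); rewrite /s; nra.
  rewrite integralD_rV ?integralZ_rV//; first last.
  - by move=> x; rewrite mulr_ge0.
  - by move=> x; rewrite mulr_ge0.
  - exact: continuous_scalel.
  - exact: continuous_scalel.
  rewrite nE yE p1 mule1 -EFinM -EFinD lee_fin => q.
  have q2 : (c - sg) ^+ 2 = (`|c| - 1) ^+ 2.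
    have -> : c - sg = (`|c| - 1) * sg by rewrite mulrBl -csg mul1r.
    by rewrite exprMn sg1 mulr1.
  lra.
have := log_moment_bound K0 UG sF n4 nE.
have := moment_bound a0 b0 UG sF.
rewrite -/(p _) -/C1c -/C2.
rewrite -[X in (_ <= _ * X + _)%E -> _]/IT.
rewrite -[X in (_ <= _ + _ * X)%E -> _]/(\int[leb d]_x (v x)%:E)%E.
rewrite zE nE -!EFinM -EFinD.
set IX := (\int[leb d]_x (s x ^+ 2 * dotr x x * _)%:E)%E => HX.
have [x x0 xE] : exists2 x, 0 <= x & IX = x%:E.
  apply: ge0_lty_EFin; last exact: (le_lt_trans HX (ltry _)).
  by apply: integral_rV_ge0 => x; rewrite mulr_ge0// mulr_ge0 ?sqr_ge0 ?dotr_ge0.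
rewrite -[X in (_ <= _ * X + _ + _)%E -> _]/IT zE xE.
rewrite xE lee_fin in HX.
rewrite -!EFinM -!EFinD => HL.
have cln : continuous (fun x => lnp (4 * s x ^+ 2)).
  have := continuous_lnp_div 1 (continuous_scalel (c := 4) cs2).
  by under eq_fun do rewrite divr1.
have csl : continuous (fun x => s x ^+ 2 * lnp (4 * s x ^+ 2) * p x).
  by apply: continuous_mulr => //; exact: continuous_mulr.
have sl0 x1 : 0 <= s x1 ^+ 2 * lnp (4 * s x1 ^+ 2) * p x1.
  by rewrite mulr_ge0// mulr_ge0 ?sqr_ge0 ?lnp_ge0.
apply: (@le_trans _ _ (\int[leb d]_x
    (9 * v x + 4 * (s x ^+ 2 * lnp (4 * s x ^+ 2) * p x))%:E)%E).
  apply: ge0_le_integral_EFin => //.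
  - apply: measurable_funM; last exact: measurable_continuous_rV.
    have mf2 : measurable_fun setT (fun x => f x ^+ 2).
      by apply: measurable_continuous_rV; exact: continuous_sqr.
    apply: measurable_funD => //; apply: measurable_funB => //.
    apply: measurable_funM => //; exact: measurable_ln_comp.
  - apply: measurable_continuous_rV.
    by apply: continuous_addr; exact: continuous_scalel.
  - by move=> x1 _; rewrite mulr_ge0// entropy_pointwise_ge0.
  - move=> x1 _.
    have -> : 9 * v x1 + 4 * (s x1 ^+ 2 * lnp (4 * s x1 ^+ 2) * p x1) =
      (9 * s x1 ^+ 2 + 4 * (s x1 ^+ 2 * lnp (4 * s x1 ^+ 2))) * p x1 by rewrite /v; ring.
    by rewrite ler_wpM2r//; exact: entropy_pointwise_le.
rewrite integralD_rV ?integralZ_rV//; first last.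
- by move=> x1; rewrite mulr_ge0.
- by move=> x1; rewrite mulr_ge0.
- exact: continuous_scalel.
- exact: continuous_scalel.
rewrite nE -EFinM.
have H4 : (0 <= 4%:E :> \bar R)%E by rewrite lee_fin.
apply: (le_trans (leeD2l _ (lee_wpmul2l H4 HL))).
rewrite -!EFinM -!EFinD lee_fin.
have be : beta * (4 * e1) = e by rewrite /e1; field; rewrite gt_eqF.
have bn : beta * n <= beta * (4 * (CP * z + e1)).
  by rewrite ler_wpM2l ?(ltW beta0)//; lra.
have Kx : K * x <= K * (C1c * z + C2 * n) by rewrite ler_wpM2l.
move: bn; rewrite /C {1}/beta; nra.
Qed.

End entropy_tame_density.

(** * Test functions and densities *)

Section density_integral.
Context {R : realType} {d : nat}.
Local Notation leb := (@lebesgue_rV R).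
Variables (p : 'rV[R]_d -> R) (hp : prob_density p).

Import HBNNSimple.

Lemma integral_density_indic (A : set 'rV[R]_d) : measurable A ->
  (\int[density_prob hp]_x (\1_A x)%:E = \int[leb d]_x (\1_A x * p x)%:E)%E.
Proof.
move=> mA; rewrite integral_indic// setIT.
rewrite [LHS]integral_mkcond; apply: eq_integral => x _.
by rewrite patchE indicE; case: ifP => _; rewrite ?mul1r ?mul0r.
Qed.

Lemma integral_density_nnsfun (h : {nnsfun 'rV[R]_d >-> R}) :
  (\int[density_prob hp]_x (h x)%:E = \int[leb d]_x (h x * p x)%:E)%E.
Proof.
have [mp p0 _] := hp.
have mh r : measurable (h @^-1` [set r]) by exact: measurable_sfunP.
have mi r : measurable_fun setT (fun x => \1_(h @^-1` [set r]) x * p x).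
  by apply: measurable_funM => //; exact: measurable_indic.
have i0 r x : 0 <= \1_(h @^-1` [set r]) x * p x by rewrite mulr_ge0.
have -> : (\int[leb d]_x (h x * p x)%:E = \int[leb d]_x
    (\sum_(y \in range h) y%:E * (\1_(h @^-1` [set y]) x * p x)%:E))%E.
  apply: eq_integral => x _.
  rewrite [in LHS](fimfunE h x) mulrC fsbig_finite//= fsbig_finite//=.
  rewrite mulr_sumr -sumEFin; apply: eq_bigr => r _.
  by rewrite -EFinM; congr EFin; ring.
rewrite ge0_integral_fsum//; last 2 first.
- by move=> r; apply: measurable_funeM; exact/measurable_EFinP.
(* A negative r is not a value of [h], so its indicator is 0 and the term is still nonnegative. *)
- move=> r x _; have [r0|r0] := leP 0 r; first by rewrite mule_ge0// lee_fin.
  rewrite indicE memNset ?mul0r ?mule0// => hxr.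
  by have : 0 <= h x by []; rewrite hxr leNgt r0.
rewrite integralT_nnsfun sintegralE; apply: eq_fsbigr => r rh.
transitivity (r%:E * \int[leb d]_x (\1_(h @^-1` [set r]) x * p x)%:E)%E.
  by congr (_ * _)%E; rewrite -integral_density_indic// integral_indic// setIT.
rewrite ge0_integralZl//.
- exact/measurable_EFinP.
- by move=> x _; rewrite lee_fin.
- by move: rh; rewrite inE => -[x _ <-]; rewrite lee_fin.
Qed.

(** From indicators to simple functions by linearity, then to [F] by monotone convergence on both
    sides. *)
Lemma ge0_integral_density (F : 'rV[R]_d -> R) : measurable_fun setT F ->
  (forall x, 0 <= F x) ->
  (\int[density_prob hp]_x (F x)%:E = \int[leb d]_x (F x * p x)%:E)%E.
Proof.
have [mp p0 _] := hp.
move=> mF F0; have mF' : measurable_fun setT (EFin \o F) by exact/measurable_EFinP.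
pose h := nnsfun_approx measurableT mF'.
have hF x : (EFin \o h^~ x) n @[n --> \oo] --> (F x)%:E.
  by apply: (cvg_nnsfun_approx measurableT mF') => // ? _; rewrite lee_fin.
have ndh x n m : (n <= m)%N -> h n x <= h m x.
  by move=> nm; exact/lefP/nd_nnsfun_approx.
transitivity (limn (fun n => \int[density_prob hp]_x (h n x)%:E)%E).
  rewrite -monotone_convergence//.
  - by apply: eq_integral => x _; apply/esym/cvg_lim => //; exact: hF.
  - by move=> n; exact/measurable_EFinP.
  - by move=> n x _; rewrite lee_fin.
  - by move=> x _ n m nm; rewrite lee_fin; exact: ndh.
transitivity (limn (fun n => \int[leb d]_x (h n x * p x)%:E)%E).
  by apply: congr_lim; apply/funext => n; exact: integral_density_nnsfun.
rewrite -monotone_convergence//.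
- apply: eq_integral => x _; apply/cvg_lim => //.
  under eq_fun do rewrite EFinM; rewrite EFinM.
  by apply: cvgeZr => //; exact: hF.
- by move=> n; apply/measurable_EFinP; apply: measurable_funM.
- by move=> n x _; rewrite lee_fin mulr_ge0.
- by move=> x _ n m nm; rewrite lee_fin ler_wpM2r//; exact: ndh.
Qed.

End density_integral.

Section test_functions.
Context {R : realType} {d : nat}.
Implicit Types f : 'rV[R]_d -> R.

Definition partial f (i : 'I_d) x : R := 'D_(delta_mx ord0 i) f x.

Lemma differentiable_C1 f : (forall x, differentiable f x) ->
  (forall i, continuous (partial f i)) -> C1 f (partial f).
Proof.
move=> df cf; split=> // [x|x i]; first exact: differentiable_continuous.
by apply: derivableP; exact: diff_derivable.
Qed.

Lemma test_function_C1 f : test_function f -> C1 f (partial f).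
Proof.
move=> [sf _]; apply: differentiable_C1 => [x|i x]; first exact: (sf [::]).
exact/differentiable_continuous/(sf [:: i]).
Qed.

Lemma continuous_compact_bounded f (K : set 'rV[R]_d) : continuous f -> compact K ->
  (forall x, ~ K x -> f x = 0) -> exists2 B, 0 <= B & forall x, `|f x| <= B.
Proof.
move=> cf cK fK.
have [[y0 Ky0]|K0] := pselect (K !=set0); last first.
  by exists 0 => // x; rewrite fK ?normr0// => Kx; apply: K0; exists x.
have cn : continuous (fun x => `|f x|).
  by move=> x; apply: (continuous_comp (cf x)); exact: norm_continuous.
have [y _ yM] := @compact_EVT_max _ R _ _ (ex_intro _ y0 Ky0) cK (continuous_subspaceT cn).
exists `|f y| => // x; have [Kx|/fK ->] := pselect (K x); last by rewrite normr0.
by apply: yM; rewrite inE.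
Qed.

Lemma test_function_bounded f : test_function f ->
  exists2 B, 0 <= B & forall x, `|f x| <= B.
Proof.
move=> tf; have [cf _ _] := test_function_C1 tf; have [_ cK] := tf.
apply: (continuous_compact_bounded cf cK) => x Kx.
by apply: contra_notP Kx => /eqP fx; exact: subset_closure.
Qed.

Lemma test_function_partial_bounded f : test_function f ->
  exists2 B, 0 <= B & forall x, \sum_(i < d) partial f i x ^+ 2 <= B.
Proof.
move=> tf; have [_ cF _] := test_function_C1 tf; have [_ cK] := tf.
have /choice[B BP] i : exists B, 0 <= B /\ forall x, `|partial f i x| <= B.
  suff /(continuous_compact_bounded (cF i) cK)[B B0 BP] :
      forall x, ~ closure [set x | f x != 0] x -> partial f i x = 0 by exists B.
  move=> x Kx; rewrite /partial.
  (* The complement of the support is open, so [f] is locally zero there and its partial derivatives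
     vanish with it. *)
  have : \forall y \near x, f y = cst 0 y.
    have /open_nbhs_nbhs : open_nbhs x (~` closure [set x | f x != 0]).
      by split => //; apply: closed_openC; exact: closed_closure.
    apply: filterS => y Ky /=; apply: contra_notP Ky => /eqP fy.
    exact: subset_closure.
  by move=> /near_eq_derive ->; rewrite derive_cst.
exists (\sum_(i < d) B i ^+ 2); first by apply: sumr_ge0 => i _; exact: sqr_ge0.
move=> x; apply: ler_sum => i _; have [Bi0 Bi] := BP i.
by rewrite -real_normK ?num_real// ler_sqr ?nnegrE.
Qed.

Lemma enorm_ge0 (x : 'rV[R]_d) : 0 <= enorm x. Proof. exact: sqrtr_ge0. Qed.

Lemma sqr_enorm (x : 'rV[R]_d) : enorm x ^+ 2 = dotr x x.
Proof. by rewrite sqr_sqrtr// dotr_ge0. Qed.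

Lemma sqr_enorm_grad f x : enorm (grad f x) ^+ 2 = \sum_(i < d) partial f i x ^+ 2.
Proof. by rewrite sqr_enorm; apply: eq_bigr => i _; rewrite mxE -expr2. Qed.

End test_functions.

Section log_sobolev_density.
Context {R : realType} (d : nat).
Local Notation leb := (@lebesgue_rV R).

(** Both sides are homogeneous of degree 2 in f, so f is normalised by N^(-1/2), with N the integral
    of f^2. The rest of the work is to pass from extended-real integrals to the real-valued ones in
    the definition of entropy, which requires finiteness. *)
Lemma tame_lsi (K a b : R) : 0 <= K -> 0 < a -> 0 <= b ->
  exists2 C : R, 0 < C & forall (p : 'rV[R]_d -> R) (hp : prob_density p) U G,
    tame K a b U G -> (forall x, p x = expR (- U x)) -> lsi_with (density_prob hp) C.
Proof.
move=> K0 a0 b0; have [C C0 HC] := log_sobolev_tame d K0 a0 b0.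
exists C => // p hp U G UG pU f tf.
have [mp p0 p1] := hp.
have p1' : (\int[leb d]_x (expR (- U x))%:E = 1)%E.
  by rewrite -p1; apply: eq_integral => x _; rewrite pU.
have fF := test_function_C1 tf; have [cf cF _] := fF.
have [B B0 fB] := test_function_bounded tf.
have [B' B'0 FB] := test_function_partial_bounded tf.
pose nu : probability 'rV[R]_d R := density_prob hp.
have nuE (g : 'rV[R]_d -> R) : measurable_fun setT g -> (forall x, 0 <= g x) ->
    (\int[nu]_x (g x)%:E = \int[leb d]_x (g x * p x)%:E)%E.
  exact: ge0_integral_density.
pose T x := \sum_(i < d) partial f i x ^+ 2.
have cT : continuous T by apply: continuous_bigsum => i; exact: continuous_sqr.
have T0 x : 0 <= T x by apply: sumr_ge0 => i _; exact: sqr_ge0.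
have cf2 : continuous (fun x => f x ^+ 2) by exact: continuous_sqr.
have bounded_lty (g : 'rV[R]_d -> R) c : measurable_fun setT g ->
    (forall x, 0 <= g x) -> (forall x, g x <= c) -> (\int[nu]_x (g x)%:E < +oo)%E.
  move=> mg g0 gc; apply: (@le_lt_trans _ _ (\int[nu]_x c%:E)%E).
    apply: ge0_le_integral => //.
    - by move=> x _; rewrite lee_fin.
    - exact/measurable_EFinP.
    - by move=> x _; rewrite lee_fin.
  have -> : (\int[nu]_x c%:E = c%:E * nu setT)%E by exact: integral_cst.
  by rewrite probability_setT mule1 ltry.
have fin_Rintegral (g : 'rV[R]_d -> R) : (forall x, 0 <= g x) ->
    (\int[nu]_x (g x)%:E < +oo)%E -> (\int[nu]_x (g x)%:E = (\int[nu]_x (g x)%R)%R%:E)%E.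
  move=> g0 goo; rewrite /Rintegral fineK// ge0_fin_numE//.
  by apply: integral_ge0 => x _; rewrite lee_fin.
have f2B x : f x ^+ 2 <= B ^+ 2.
  by rewrite -real_normK ?num_real// ler_sqr ?nnegrE.
have mf2 : measurable_fun setT (fun x => f x ^+ 2) by exact: measurable_continuous_rV.
have f20 x : 0 <= f x ^+ 2 by exact: sqr_ge0.
have NE := fin_Rintegral _ f20 (bounded_lty _ _ mf2 f20 f2B).
have mT : measurable_fun setT T by exact: measurable_continuous_rV.
have TE := fin_Rintegral _ T0 (bounded_lty _ _ mT T0 FB).
rewrite /lsi_with /entropy -/nu.
have -> : \int[nu]_x (enorm (grad f x) ^+ 2) = \int[nu]_x (T x).
  by apply: eq_Rintegral => x _; rewrite sqr_enorm_grad.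
set N := \int[nu]_x (f x ^+ 2) in NE *.
set Z := \int[nu]_x (T x) in TE *.
have Z0 : 0 <= Z by exact: Rintegral_ge0.
(* For N = 0 the quotient f^2 / 0 is 0 and ln 0 = 0, so the entropy is 0. *)
have [N0|NN0] := eqVneq N 0.
  have -> : \int[nu]_x (f x ^+ 2 * ln (f x ^+ 2 / N)) = \int[nu]_x (0 : R).
    by apply: eq_Rintegral => x _; rewrite N0 invr0 mulr0 ln0// mulr0.
  by rewrite Rintegral_cst// mul0r mulr_ge0// ltW.
have Np : 0 < N by rewrite lt_neqAle eq_sym NN0 Rintegral_ge0.
pose c := (Num.sqrt N)^-1.
have c2 : c ^+ 2 = N^-1 by rewrite exprVn sqr_sqrtr// ltW.
have gG := C1_scale c fF.
have gB x : `|c * f x| <= `|c| * B by rewrite normrM ler_wpM2l.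
have g2 x : (c * f x) ^+ 2 = f x ^+ 2 / N by rewrite exprMn c2 mulrC.
pose phi x := (c * f x) ^+ 2 * ln ((c * f x) ^+ 2) - (c * f x) ^+ 2 + 1.
have phi0 x : 0 <= phi x by exact: entropy_pointwise_ge0.
have mg2 : measurable_fun setT (fun x => (c * f x) ^+ 2).
  by apply: measurable_continuous_rV; apply: continuous_sqr; exact: continuous_scalel.
have mphi : measurable_fun setT phi.
  apply: measurable_funD => //; apply: measurable_funB => //.
  apply: measurable_funM => //.
  exact: measurable_ln_comp.
have If2 : (\int[leb d]_x (f x ^+ 2 * p x)%:E = N%:E)%E by rewrite -nuE.
have Ig2 : (\int[leb d]_x ((c * f x) ^+ 2 * expR (- U x))%:E = 1)%E.
  under eq_integral do rewrite -pU g2 mulrAC mulrC.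
  rewrite ge0_integralZ_EFin ?If2 ?invr_ge0 ?(ltW Np)//.
  - by rewrite -EFinM mulVf.
  - exact: measurable_funM.
  - by move=> x _; rewrite mulr_ge0.
have := HC U G UG p1' _ _ _ gG gB Ig2.
have -> : (\int[leb d]_x (((c * f x) ^+ 2 * ln ((c * f x) ^+ 2) - (c * f x) ^+ 2 + 1) *
    expR (- U x))%:E = \int[nu]_x (phi x)%:E)%E.
  by rewrite nuE//; apply: eq_integral => x _; rewrite pU.
have -> : (\int[leb d]_x ((\sum_(i < d) (c * partial f i x) ^+ 2) * expR (- U x))%:E =
    (Z / N)%:E)%E.
  rewrite mulrC EFinM -TE nuE// -ge0_integralZ_EFin ?invr_ge0 ?(ltW Np)//.
  - apply: eq_integral => x _; rewrite -pU mulrA mulr_sumr; congr (_ * _)%:E.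
    by apply: eq_bigr => i _; rewrite exprMn c2.
  - exact: measurable_funM.
  - by move=> x _; rewrite mulr_ge0.
move=> phiZ.
(* Integrability of the entropy integrand is read off from the inequality itself, whose right-hand
   side is finite. *)
have phioo : (\int[nu]_x (phi x)%:E < +oo)%E.
  by apply: (le_lt_trans phiZ); rewrite -EFinM ltry.
rewrite fin_Rintegral// -EFinM lee_fin in phiZ.
have int (g : 'rV[R]_d -> R) : measurable_fun setT g -> (forall x, 0 <= g x) ->
    (\int[nu]_x (g x)%:E < +oo)%E -> nu.-integrable setT (EFin \o g).
  move=> mg g0 goo; apply/integrableP; split; first exact/measurable_EFinP.
  by under eq_integral do rewrite /= ger0_norm//.
have iphi := int _ mphi phi0 phioo.
have if2 := int _ mf2 f20 (bounded_lty _ _ mf2 f20 f2B).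
have i1 : nu.-integrable setT (EFin \o (fun=> N)).
  exact: finite_measure_integrable_cst.
(* The entropy integrand is N phi + (f^2 - N), and the last term integrates to 0. *)
have -> : \int[nu]_x (f x ^+ 2 * ln (f x ^+ 2 / N)) = N * \int[nu]_x (phi x).
  have -> : \int[nu]_x (f x ^+ 2 * ln (f x ^+ 2 / N)) =
      \int[nu]_x (N * phi x + (f x ^+ 2 - N)).
    by apply: eq_Rintegral => x _; rewrite /phi !g2; field.
  have iNphi : nu.-integrable setT (EFin \o (fun x => N * phi x)).
    have := integrableZl measurableT N iphi.
    by apply: eq_integrable => // x _.
  have if2N : nu.-integrable setT (EFin \o (fun x => f x ^+ 2 - N)).
    have := integrableB measurableT if2 i1.
    by apply: eq_integrable => // x _.
  rewrite RintegralD// RintegralZl// RintegralB// Rintegral_cst//.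
  rewrite -/N; have -> : fine (nu setT) = 1 by rewrite probability_setT.
  by rewrite mulr1 subrr addr0.
have := ler_wpM2l (ltW Np) phiZ.
by have -> : N * (C * (Z / N)) = C * Z by field.
Qed.

End log_sobolev_density.

(** * Potentials with Lipschitz gradient *)

Lemma continuous_at_bound {R : realType} (T : topologicalType) (f q : T -> R) x :
  q x = 0 -> continuous q -> (forall y, `|f y - f x| <= q y) -> {for x, continuous f}.
Proof.
move=> qx cq fq; apply/cvgrPdist_lt => e e0.
have /cvgrPdist_lt/(_ e e0) := cq x; apply: filterS => y.
rewrite qx sub0r normrN distrC; apply: le_lt_trans.
exact: le_trans (fq y) (ler_norm _).
Qed.

Section potentials.
Context {R : realType} {d : nat}.
Implicit Types (U : 'rV[R]_d -> R) (x y v : 'rV[R]_d).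

Lemma dotrZZ (c : R) x y : dotr (c *: x) (c *: y) = c ^+ 2 * dotr x y.
Proof. by rewrite /dotr mulr_sumr; apply: eq_bigr => i _; rewrite !mxE; ring. Qed.

Lemma dotrZl (c : R) x y : dotr (c *: x) y = c * dotr x y.
Proof. by rewrite /dotr mulr_sumr; apply: eq_bigr => i _; rewrite !mxE mulrA. Qed.

Lemma dotrZr (c : R) x y : dotr x (c *: y) = c * dotr x y.
Proof. by rewrite /dotr mulr_sumr; apply: eq_bigr => i _; rewrite !mxE mulrCA. Qed.

Lemma enormZ (c : R) x : 0 <= c -> enorm (c *: x) = c * enorm x.
Proof. by move=> c0; rewrite /enorm dotrZZ sqrtrM ?sqr_ge0// sqrtr_sqr ger0_norm. Qed.

Lemma normr_dotr_le x y : `|dotr x y| <= (dotr x x + dotr y y) / 2.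
Proof.
apply: (le_trans (ler_norm_sum _ _ _)).
rewrite /dotr -big_split/= mulr_suml; apply: ler_sum => i _.
rewrite ler_norml; apply/andP; split.
  have := sqr_ge0 (x ord0 i + y ord0 i); nra.
have := sqr_ge0 (x ord0 i - y ord0 i); nra.
Qed.

Lemma dotr_subr_le x y : dotr x x <= 2 * dotr (x - y) (x - y) + 2 * dotr y y.
Proof.
rewrite /dotr !mulr_sumr -big_split/=; apply: ler_sum => i _; rewrite !mxE.
have := sqr_ge0 (x ord0 i - 2 * y ord0 i); nra.
Qed.

Lemma derive_dotr_grad U x v : differentiable U x -> 'D_v U x = dotr v (grad U x).
Proof.
move=> dU; rewrite deriveE// {1}(row_sum_delta v) linear_sum/=.
by apply: eq_bigr => i _; rewrite linearZ/= mxE deriveE.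
Qed.

Lemma is_derive_dotr_grad U x v : differentiable U x ->
  is_derive x v U (dotr v (grad U x)).
Proof.
by move=> dU; rewrite -derive_dotr_grad//; apply: derivableP; exact: diff_derivable.
Qed.

Lemma is_derive_ray U x (t : R) : differentiable U (t *: x) ->
  is_derive t 1 (fun s => U (s *: x)) (dotr x (grad U (t *: x))).
Proof.
move=> dU; apply: is_derive_along (is_derive_dotr_grad x dU) => h; congr U.
by rewrite scalerDl [h *: 1]mulr1.
Qed.

Lemma grad_affine U (k c : R) x : differentiable U (c *: x) ->
  grad (fun y => k + U (c *: y)) x = c *: grad U (c *: x).
Proof.
move=> dU; apply/rowP => i; rewrite !mxE.
set e := delta_mx ord0 i.
have /is_derive_along : is_derive (c *: x) (c *: e) (fun y => k + U y) (c * 'D_e U (c *: x)).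
  have := is_derive_dotr_grad (c *: e) dU; rewrite dotrZl -derive_dotr_grad//.
  move=> dUe; apply: (is_derive_eq (is_deriveD (is_derive_cst k (c *: x) (c *: e)) dUe)).
  by rewrite add0r.
move=> /(_ _ x e (fun y => k + U (c *: y)))[|_ ->//] h.
by congr (_ + U _); rewrite scalerDr !scalerA mulrC.
Qed.

Section lipschitz_gradient.
Variables (U : 'rV[R]_d -> R) (L : R).
Hypotheses (dU : forall x, differentiable U x) (UL : lipschitz_with L (grad U)).

Lemma lipschitz_grad_dotr x y :
  dotr (grad U x - grad U y) (grad U x - grad U y) <= L ^+ 2 * dotr (x - y) (x - y).
Proof.
have := UL x y; rewrite -!sqr_enorm -exprMn => h.
by rewrite ler_sqr ?nnegrE ?enorm_ge0// (le_trans (enorm_ge0 _) h).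
Qed.

Lemma dotr_grad_le x :
  dotr (grad U x) (grad U x) <= 2 * L ^+ 2 * dotr x x + 2 * dotr (grad U 0) (grad U 0).
Proof.
apply: (le_trans (dotr_subr_le _ (grad U 0))); rewrite lerD2r -mulrA ler_wpM2l//.
by have := lipschitz_grad_dotr x 0; rewrite subr0.
Qed.

(** The topology on row vectors comes from the sup norm, while the Lipschitz bound is Euclidean; the
    bridge is the majorant |L| |y - x|, which is continuous and vanishes at y = x. *)
Lemma continuous_partial i : continuous (partial U i).
Proof.
move=> x.
pose q y := `|L| * Num.sqrt (dotr (y - x) (y - x)).
have cq : continuous q.
  apply: continuous_scalel => y; apply: continuous_comp; last exact: sqrt_continuous.
  suff h : continuous (fun y => dotr (y - x) (y - x)) by exact: h.
  apply: continuous_bigsum => j.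
  have h : continuous (fun y : 'rV[R]_d => (y - x) ord0 j).
    under eq_fun do rewrite !mxE.
    by apply: continuous_addr; [exact: coord_continuous|exact: continuous_cstr].
  exact: continuous_mulr.
apply: (continuous_at_bound _ cq) => [|y].
  by rewrite /q subrr /dotr big1 ?sqrtr0 ?mulr0// => j _; rewrite mxE mul0r.
rewrite /q -sqrtr_sqr -(sqrtr_sqr L) -sqrtrM ?sqr_ge0//.
apply: ler_wsqrtr; apply: le_trans (lipschitz_grad_dotr y x).
rewrite /dotr (bigD1 i)//= !mxE -expr2 lerDl.
by apply: sumr_ge0 => j _; rewrite -expr2 sqr_ge0.
Qed.

(** The gradient grows linearly from its value at 0, and the mean value theorem on the ray from 0 to
    x then makes U grow quadratically. [u], [g] and [l] are upper bounds rather than exact values,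
    so that one constant can serve a whole family of potentials. *)
Lemma lipschitz_tame a b (u g l : R) : 0 <= b ->
  `|U 0| <= u -> dotr (grad U 0) (grad U 0) <= g -> L ^+ 2 <= l ->
  (forall x, a * dotr x x - b <= dotr x (grad U x)) ->
  tame (u + 2 * g + 2 * l + 1) a b U (partial U).
Proof.
move=> b0 Uu Gg Ll UD.
have u0 : 0 <= u by rewrite (le_trans _ Uu).
have g0 : 0 <= g by rewrite (le_trans _ Gg)// dotr_ge0.
have l0 : 0 <= l by rewrite (le_trans _ Ll)// sqr_ge0.
have GL x : dotr (grad U x) (grad U x) <= 2 * l * dotr x x + 2 * g.
  apply: (le_trans (dotr_grad_le x)); apply: lerD; last by rewrite ler_wpM2l.
  by rewrite ler_wpM2r ?dotr_ge0// ler_wpM2l.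
split.
- by apply: differentiable_C1 => // i; exact: continuous_partial.
- move=> x; have := GL x; rewrite -!sqr_enorm sqr_enorm_grad => h.
  apply: (le_trans h); rewrite sqr_enorm.
  have := dotr_ge0 x; have := mulr_ge0 u0 (dotr_ge0 x); have := mulr_ge0 g0 (dotr_ge0 x); lra.
- move=> x.
  have dphi (t : R) : is_derive t 1 (fun s => U (s *: x)) (dotr x (grad U (t *: x))).
    exact: is_derive_ray.
  have [t t01] : exists2 t, t \in `]0, 1[%R &
      U (1 *: x) - U (0 *: x) = dotr x (grad U (t *: x)) * (1 - 0).
    apply: (@MVT _ (fun s => U (s *: x)) (fun t => dotr x (grad U (t *: x)))) => //.
    by apply: continuous_subspaceT => t; exact: (is_derive_continuous dphi).
  rewrite scale1r scale0r subr0 mulr1 => UE.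
  have := normr_dotr_le x (grad U (t *: x)); rewrite -UE => h.
  have : dotr (t *: x) (t *: x) <= dotr x x.
    rewrite dotrZZ ler_piMl ?dotr_ge0//; move: t01; rewrite in_itv/= => /andP[t0 t1].
    by rewrite expr_le1 ?ltW.
  move=> /(ler_wpM2l l0) tx.
  have := GL (t *: x) => h2.
  have : `|U x| <= `|U x - U 0| + `|U 0| by rewrite -[X in `|X| <= _](subrK (U 0)) ler_normD.
  have x0 := dotr_ge0 x.
  have := mulr_ge0 l0 x0; have := mulr_ge0 u0 x0; have := mulr_ge0 g0 x0; move=> *; lra.
- move=> x; apply: (le_trans (UD x)); rewrite le_eqVlt; apply/orP; left; apply/eqP.
  by apply: eq_bigr => i _; rewrite mxE.
Qed.

End lipschitz_gradient.

End potentials.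

(** * Dilations *)

Section derivative_in.
Context {R : realType}.
Implicit Types (I : set R) (f : R -> R) (t l : R).

Lemma derive_in_is_derive I f t l : ProperFilter (within [set h | I (t + h)] 0^') ->
  is_derive t 1 f l -> derivable_in I f t /\ derive_in I f t = l.
Proof.
move=> IF [/cvg_ex[/= l' fl'] fl].
have {fl}l'E : l' = l by rewrite -fl; apply/esym/cvg_lim.
have q : diff_quotient_in I f t --> l.
  apply: cvg_within_filter; rewrite -l'E; move: fl'; apply: cvg_trans.
  apply: near_eq_cvg; near=> h => /=.
  by rewrite [h *: 1]mulr1 [h + t]addrC.
split; first by apply/cvg_ex; exists l.
exact/cvg_lim.
Unshelve. all: by end_near. Qed.

(** No point of [0, b] is isolated in it; this is what makes the limit of difference quotients taken
    inside the interval unique. *)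
Lemma within_itv_proper (b t : R) : 0 < b -> t \in `[0, b] ->
  ProperFilter (within [set h | [set` `[0, b]] (t + h)] 0^').
Proof.
rewrite in_itv/= => b0 /andP[t0 tb]; apply: Build_ProperFilter_ex => P [e /= e0 eP].
(* Step to the right, unless t is the right endpoint, where the step goes to the left. *)
have [tlb|tgb] := ltP t b.
  pose h := Num.min (e / 2) (b - t).
  have h0 : 0 < h by rewrite lt_min divr_gt0//= subr_gt0.
  have he : h < e by rewrite gt_min ltr_pdivrMr//; apply/orP; left; lra.
  have hb : h <= b - t by rewrite ge_min lexx orbT.
  exists h; apply: eP => /=; rewrite ?gt_eqF//.
    by rewrite sub0r normrN gtr0_norm.
  by rewrite in_itv/=; apply/andP; split; lra.
pose h := Num.min (e / 2) b.
have h0 : 0 < h by rewrite lt_min divr_gt0.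
have he : h < e by rewrite gt_min ltr_pdivrMr//; apply/orP; left; lra.
have hb : h <= b by rewrite ge_min lexx orbT.
exists (- h); apply: eP => /=; rewrite ?oppr_eq0 ?gt_eqF//.
  by rewrite sub0r normrN normrN gtr0_norm.
by rewrite in_itv/=; apply/andP; split; lra.
Qed.

End derivative_in.

Section dilation.
Context {R : realType} {d : nat}.
Variables (p : 'rV[R]_d -> R) (t : R).
Hypotheses (p0 : forall x, 0 < p x) (t1 : t < 1).

Local Notation U := (potential p).
Local Notation V := (potential (dilation p t)).
Local Notation c := (Num.sqrt (1 - t))^-1.

Let tt : 0 < 1 - t. Proof. by rewrite subr_gt0. Qed.
Let c0 : 0 < c. Proof. by rewrite invr_gt0 sqrtr_gt0. Qed.
Let c2 : c ^+ 2 = (1 - t)^-1. Proof. by rewrite exprVn sqr_sqrtr// ltW. Qed.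

Lemma dilation_gt0 x : 0 < dilation p t x.
Proof. by rewrite mulr_gt0// invr_gt0 powR_gt0. Qed.

Lemma potential_dilation : V = fun x => d%:R / 2 * ln (1 - t) + U (c *: x).
Proof.
apply/funext => x; rewrite /potential /dilation lnM ?posrE ?invr_gt0 ?powR_gt0//.
by rewrite lnV ?posrE ?powR_gt0// ln_powR opprD opprK.
Qed.

Lemma dilation_prob_density : prob_density p -> prob_density (dilation p t).
Proof.
move=> [mp _ p1].
have mpc : measurable_fun setT (fun x : 'rV[R]_d => p (c *: x)).
  apply: (measurableT_comp mp); apply: measurable_fun_rVP => i.
  under eq_fun do rewrite mxE.
  by apply: measurable_funM => //; exact: measurable_coord.
have pc0 x : 0 <= p (c *: x) by exact: ltW.
split=> [|x|]; first exact: measurable_funM.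
  by rewrite ltW// dilation_gt0.
rewrite /dilation ge0_integralZ_EFin ?invr_ge0 ?powR_ge0//.
rewrite (ge0_integral_rV_scale (f := fun x => (p x)%:E))//; last 2 first.
- exact/measurable_EFinP.
- by move=> x; rewrite lee_fin ltW.
(* The prefactor (1 - t)^(d/2) is the d-th power of sqrt(1 - t), hence exactly the Jacobian of the
   dilation. *)
rewrite p1 mule1 -EFinM exprVn invrK [d%:R / 2]mulrC powRrM powR12_sqrt ?(ltW tt)//.
by rewrite powR_mulrn ?sqrtr_ge0// mulVf// gt_eqF// exprn_gt0// sqrtr_gt0.
Qed.

Hypothesis dU : forall x, differentiable U x.

Lemma differentiable_potential_dilation x : differentiable V x.
Proof.
rewrite potential_dilation; apply: differentiableD; first exact: differentiable_cst.
apply: (@differentiable_comp _ _ _ _ (fun x => c *: x) U) => //.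
Qed.

Lemma grad_potential_dilation x : grad V x = c *: grad U (c *: x).
Proof. by rewrite potential_dilation grad_affine. Qed.

Lemma lipschitz_potential_dilation L :
  lipschitz_with L (grad U) -> lipschitz_with (L / (1 - t)) (grad V).
Proof.
move=> UL x y; rewrite !grad_potential_dilation -scalerBr enormZ ?(ltW c0)//.
apply: (le_trans (ler_wpM2l (ltW c0) (UL _ _))).
by rewrite -scalerBr enormZ ?(ltW c0)// -c2; lra.
Qed.

(** With c = (1 - t)^(-1/2) one has <x, grad V(x)> = <c x, grad U(c x)>. Since c >= 1, the quadratic
    term only grows and |c x| < r implies |x| < r, so the same three constants serve. *)
Lemma dissipative_potential_dilation a b r : 0 < a -> 0 < b -> 0 <= t ->
  dissipative_with a b r (grad U) -> dissipative_with a b r (grad V).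
Proof.
move=> a0 b0 t0 UD x; rewrite grad_potential_dilation dotrZr -dotrZl.
have c1 : 1 <= c.
  by rewrite -(expr_ge1 (n := 2)) ?(ltW c0)// c2 invf_ge1//; lra.
apply: le_trans (UD (c *: x)); rewrite enormZ ?(ltW c0)//; apply: lerB.
  by rewrite ler_wpM2l ?(ltW a0)// exprMn ler_peMl ?sqr_ge0// expr_ge1 ?(ltW c0).
rewrite ler_wpM2l ?(ltW b0)// !indicE; have [cx|//] := boolP (c *: x \in _).
rewrite mem_set//=; move: cx; rewrite inE/= enormZ ?(ltW c0)//.
by apply: le_lt_trans; rewrite ler_peMl ?enorm_ge0.
Qed.

(** Writing the factor (1 - s)^(-1/2) as exp(k(s)) with k(s) = - ln(1 - s) / 2 gives V = - d k +
    U(exp(k) x), so the derivative is k' (<x, grad V> - d). Expressed through grad V, it is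
    controlled by the bounds already known for V. *)
Lemma is_derive_potential_dilation x : is_derive t 1 (fun s => potential (dilation p s) x)
  (- (d%:R / 2 / (1 - t)) + (2 * (1 - t))^-1 * dotr x (grad V x)).
Proof.
have ttN0 : 1 - t != 0 by rewrite gt_eqF.
have sN0 : Num.sqrt (1 - t) != 0 by rewrite gt_eqF// sqrtr_gt0.
pose k s : R := - 2^-1 * ln (1 - s).
pose W s := - d%:R * k s + U (expR (k s) *: x).
have kE s : s < 1 -> expR (k s) = (Num.sqrt (1 - s))^-1.
  move=> s1; rewrite /k mulNr expRN -powR12_sqrt ?subr_ge0 ?(ltW s1)//.
  by rewrite /powR gt_eqF// subr_gt0.
apply: (@near_eq_is_derive _ _ _ W).
  near=> s; have s1 : s < 1 by near: s; exact: lt_nbhsl.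
  rewrite /W kE// /potential /dilation lnM ?posrE ?invr_gt0 ?powR_gt0 ?subr_gt0//.
  by rewrite lnV ?posrE ?powR_gt0 ?subr_gt0// ln_powR /k; field.
have d1 : is_derive t 1 (fun s : R => 1 - s) (- 1).
  have := is_deriveB (is_derive_cst (1 : R) t (1 : R)) (is_derive_id t (1 : R)).
  by rewrite sub0r => h; exact: h.
have dln : is_derive t 1 (fun s => ln (1 - s)) ((1 - t)^-1 * - 1).
  exact: (is_derive_comp_R (g := fun s : R => 1 - s) (is_derive1_ln tt) d1).
have dk : is_derive t 1 k (2 * (1 - t))^-1.
  by apply: (is_derive_eq (is_deriveZ (- 2^-1) dln)); rewrite /GRing.scale/=; field.
have dE := is_derive_comp_R (is_derive_expR (k t)) dk.
have dUr := is_derive_comp_R (g := fun s : R => expR (k s))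
  (is_derive_ray (dU (expR (k t) *: x))) dE.
apply: (is_derive_eq (is_deriveD (is_deriveZ (- d%:R) dk) dUr)).
rewrite grad_potential_dilation kE// dotrZr /GRing.scale/=.
by field; rewrite ttN0 sN0.
Unshelve. all: by end_near. Qed.

End dilation.

Theorem proposition4p12 (R : realType) (d : nat) (p : 'rV[R]_d -> R)
    (p_density : prob_density p)
    (p_gt0 : forall x, 0 < p x)
    (U_diff : forall x, differentiable (potential p) x)
    (gradU_lipschitz : exists L, lipschitz_with L (grad (potential p)))
    (gradU_dissipative : dissipative (grad (potential p)))
    (taubar : R) (taubar01 : 0 < taubar < 1) :
  path_assumption `[0, taubar] (dilation p).
Proof.
have [L UL] := gradU_lipschitz.
have [a [b [r [a0 b0 r0 UD]]]] := gradU_dissipative.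
have /andP[tau0 tau1] := taubar01.
have It t : [set` `[0, taubar]] t -> [/\ 0 <= t, t <= taubar & t < 1].
  by rewrite /= in_itv/= => /andP[t0 tt]; split=> //; exact: le_lt_trans tau1.
set V := fun t => potential (dilation p t).
(* The largest value of 1 / (1 - t) on the interval; here taubar < 1 enters. *)
pose m := (1 - taubar)^-1.
have m1 : 1 <= m by rewrite invf_ge1; lra.
have mt t : [set` `[0, taubar]] t -> 0 < (1 - t)^-1 <= m.
  by move=> /It[t0 tt t1]; rewrite invr_gt0 lef_pV2 ?posrE; lra.
have dens t : [set` `[0, taubar]] t -> prob_density (dilation p t).
  by move=> /It[_ _ t1]; exact: dilation_prob_density.
have VL t : [set` `[0, taubar]] t -> lipschitz_with (L / (1 - t)) (grad (V t)).
  by move=> /It[_ _ t1]; exact: lipschitz_potential_dilation.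
have dV t : [set` `[0, taubar]] t -> forall x, differentiable (V t) x.
  by move=> /It[_ _ t1]; exact: differentiable_potential_dilation.
have VD t : [set` `[0, taubar]] t -> dissipative_with a b r (grad (V t)).
  by move=> /It[t0 _ t1]; exact: dissipative_potential_dilation.
(* [u], [g] and L^2 m^2 bound, uniformly in t, the potential at 0, the squared norm of its gradient
   at 0 and the squared Lipschitz constant; [K] combines them as in [lipschitz_tame]. *)
pose u := d%:R / 2 * - ln (1 - taubar) + `|potential p 0|.
pose g := m * dotr (grad (potential p) 0) (grad (potential p) 0).
pose K := u + 2 * g + 2 * (L ^+ 2 * m ^+ 2) + 1.
have Vtame t : [set` `[0, taubar]] t -> tame K a b (V t) (partial (V t)).
  move=> tI; have [t0 tt t1] := It t tI; have /andP[mt0 mtm] := mt t tI.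
  apply: (lipschitz_tame (dV t tI) (VL t tI)); rewrite ?(ltW b0)//.
  - rewrite /V potential_dilation// scaler0 (le_trans (ler_normD _ _))// lerD2r.
    rewrite normrM ger0_norm// ler_wpM2l// ler0_norm.
      by rewrite lerN2 ler_ln ?posrE; lra.
    by apply: ln_le0; lra.
  - rewrite /V grad_potential_dilation// scaler0 dotrZZ exprVn sqr_sqrtr; last lra.
    by rewrite ler_wpM2r// dotr_ge0.
  - by rewrite exprMn ler_wpM2l ?sqr_ge0// ler_sqr ?nnegrE ?(ltW mt0)//; lra.
  - move=> x; rewrite -sqr_enorm; apply: le_trans (VD t tI x).
    by rewrite lerD2l lerN2 ler_piMr ?(ltW b0).
(* The growth bound at x = 0 for t = 0 reads |V_0(0)| <= K. *)
have K0 : 0 <= K.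
  have tI0 : [set` `[0, taubar]] 0 by rewrite /= in_itv/= lexx ltW.
  have [_ _ VK _] := Vtame 0 tI0; have := VK 0.
  rewrite /dotr big1 ?addr0 ?mulr1 => [|i _]; last by rewrite mxE mul0r.
  exact: le_trans.
(* One constant for all t: it yields both the inequality for each density and the uniform bound on
   the log-Sobolev constants. *)
have [C C0 HC] := tame_lsi d K0 a0 (ltW b0).
have lsiC t (tI : [set` `[0, taubar]] t) : lsi_with (density_prob (dens t tI)) C.
  have [_ _ t1] := It t tI; apply: (HC _ _ _ _ (Vtame t tI)) => x.
  by rewrite /V /potential opprK lnK// posrE dilation_gt0.
have derV x t : [set` `[0, taubar]] t ->
    derivable_in [set` `[0, taubar]] (V ^~ x) t /\
    derive_in [set` `[0, taubar]] (V ^~ x) t =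
      - (d%:R / 2 / (1 - t)) + (2 * (1 - t))^-1 * dotr x (grad (V t) x).
  move=> tI; have [t0 tt t1] := It t tI; apply: derive_in_is_derive.
    exact: within_itv_proper.
  exact: is_derive_potential_dilation.
pose lsc t (tI : [set` `[0, taubar]] t) := lsi_const (density_prob (dens t tI)).
split.
  split; [exact: interval_is_interval|by move=> t /It[]|].
  by rewrite /= in_itv/= lexx ltW.
split; first by move=> t x /It[_ _ t1]; exact: dilation_gt0.
(* The log-Sobolev constant refers to the probability built from a proof that t lies in the
   interval; off the interval the function takes the dummy value 0. *)
exists dens, (fun t => L / (1 - t)), (fun=> a), (fun=> b), (fun=> r),
  (fun t => if pselect ([set` `[0, taubar]] t) is left tI then lsc t tI else 0).
split.
- split; first by move=> x t tI; have [] := derV x t tI.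
  have dK : 0 < d%:R + K + 1 by rewrite ltr_wpDl// addr_ge0.
  (* The derivative in t is (<x, grad V> - d) / (2 (1 - t)), and |<x, grad V>| is at most half of
     |x|^2 + |grad V|^2, hence at most half of |x|^2 + K (1 + |x|^2). *)
  exists (m * (d%:R + K + 1)); first by rewrite mulr_gt0// (lt_le_trans ltr01).
  move=> x t tI; have [_ ->] := derV x t tI; have /andP[mt0 mtm] := mt t tI.
  have [_ VK _ _] := Vtame t tI.
  have {}VK := VK x; rewrite -sqr_enorm_grad !sqr_enorm in VK.
  have := normr_dotr_le x (grad (V t) x); set D := dotr x (grad (V t) x) => h.
  apply: (le_trans (ler_normD _ _)); rewrite normrN invfM !normrM.
  rewrite (ger0_norm (ltW mt0)) [`|2^-1|]ger0_norm ?invr_ge0// [`|d%:R|]ger0_norm//.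
  have x0 := dotr_ge0 x; rewrite sqr_enorm.
  apply: (@le_trans _ _ ((1 - t)^-1 * ((d%:R + K + 1) * (dotr x x + 1)))); last first.
    by rewrite -mulrA ler_wpM2r// mulr_ge0 ?(ltW dK)// addr_ge0.
  have -> : d%:R / 2 * (1 - t)^-1 + 2^-1 * (1 - t)^-1 * `|D| =
      (1 - t)^-1 * (d%:R / 2 + `|D| / 2) by ring.
  rewrite ler_wpM2l ?(ltW mt0)//.
  have := mulr_ge0 K0 x0; have d0 : 0 <= d%:R :> R by []; have := mulr_ge0 d0 x0.
  lra.
- by move=> t tI; split; [exact: dV|exact: VL].
- by move=> t [tI _]; split => //; exact: VD.
- split.
  (* The sign of [L] is not prescribed, so the absolute value is taken before 1 / (1 - t) is
     replaced by its bound. *)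
  + apply: (@le_lt_trans _ _ (`|L| * m)%:E); last exact: ltry.
    apply: ge_ereal_sup => _ [t [tI _] <-]; rewrite lee_fin.
    have /andP[mt0 mtm] := mt t tI.
    apply: (le_trans (ler_wpM2r (ltW mt0) (ler_norm L))).
    by rewrite ler_wpM2l.
  + apply: (@lt_le_trans _ _ a%:E); first by rewrite lte_fin.
    by apply: le_ereal_inf_tmp => _ [t _ <-].
  + apply: (@le_lt_trans _ _ b%:E); last exact: ltry.
    by apply: ge_ereal_sup => _ [t _ <-].
  + apply: (@le_lt_trans _ _ r%:E); last exact: ltry.
    by apply: ge_ereal_sup => _ [t _ <-].
- split.
    move=> t tI; split; first by exists C => //; exact: lsiC.
    by case: pselect => // tI'; congr lsc; exact: Prop_irrelevance.
  apply: (@le_lt_trans _ _ C%:E); last exact: ltry.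
  apply: ge_ereal_sup => _ [t tI <-]; rewrite lee_fin.
  (* The infimum defining the log-Sobolev constant is at most [C], as [C] is admissible and 0 is a
     lower bound. *)
  case: pselect => // tI'; apply: ge_inf; last by split => //; exact: lsiC.
  by exists 0 => B [/ltW].
Qed.
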